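(* Let $0<\alpha<1$ and $\beta>0$. There is a constant $c$ such that for every $\psi\in C^{\infty}(\mathbb{R}^{2})$ and every real $a=(a_0,a_1,a_2,a_3)$ with $D\neq 0$, the integral $$I_{\alpha,\beta}=\int_{|x|\le1}E_{\alpha,\beta}\bigl(iP_{3}(a,x)\bigr)\,\psi(x)\,dx_{1}\,dx_{2}$$ with phase $$P_{3}(a,x)=a_{0}x_{1}^{3}+3a_{1}x_{1}^{2}x_{2}+3a_{2}x_{1}x_{2}^{2}+a_{3}x_{2}^{3}$$ satisfies $$|I_{\alpha,\beta}|\le\frac{c\,\|\psi\|_{L^{\infty}}}{|D|^{1/6}},$$ where $$D=3a_{1}^{2}a_{2}^{2}+6a_{0}a_{1}a_{2}a_{3}-4a_{0}a_{2}^{3}-4a_{1}^{3}a_{3}-a_{0}^{2}a_{3}^{2}$$ is the discriminant of $P_{3}$.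
   Context: The two-parameter Mittag-Leffler function is $E_{\alpha,\beta}(z)=\sum_{k=0}^{\infty}\frac{z^{k}}{\Gamma(\alpha k+\beta)}$, $z\in\mathbb{C}$. Here $x=(x_1,x_2)\in\mathbb{R}^2$ and $\{|x|\le 1\}$ is the closed Euclidean unit disc in $\mathbb{R}^2$. *)

(* Defs.v *)
From HB Require Import structures.
From mathcomp Require Import all_boot all_order all_algebra.
From mathcomp Require Import all_classical all_reals all_analysis.
From mathcomp Require Import complex.

Set Implicit Arguments.
Unset Strict Implicit.
Unset Printing Implicit Defensive.

Import Order.TTheory GRing.Theory Num.Theory.
Import numFieldNormedType.Exports.
Import ComplexField.Normc.

Local Open Scope classical_set_scope.
Local Open Scope ring_scope.
Local Open Scope complex_scope.

(* Euler's integral; only meant for [0 < s]. *)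
Definition Gamma (R : realType) (s : R) : R :=
  Rintegral (@lebesgue_measure R) `]0, +oo[
    (fun t => t `^ (s - 1) * expR (- t)).

(* [R[i]^o] carries the topology given by the modulus. *)
Definition mittag_leffler (R : realType) (alpha beta : R) (z : R[i]) : R[i] :=
  limn (series (fun k : nat =>
    z ^+ k / (Gamma (alpha * k%:R + beta))%:C : R[i]^o)).

Definition lebesgue2 (R : realType) :
    {measure set (measurableTypeR R * measurableTypeR R)%type -> \bar R} :=
  (@lebesgue_measure R \x @lebesgue_measure R)%E.

Definition unit_disc (R : realType) : set (R * R) :=
  [set x | Num.sqrt (x.1 ^+ 2 + x.2 ^+ 2) <= 1].

Definition Cintegral (R : realType) (D : set (R * R)) (f : R * R -> R[i]) :
    R[i] :=
  Rintegral (@lebesgue2 R) D (fun x => complex.Re (f x)) +i*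
  Rintegral (@lebesgue2 R) D (fun x => complex.Im (f x)).

(* [iter_partial [:: b1; ...; bn] f] is d_{b1} (... (d_{bn} f)), where [false]
   stands for the variable x_1 and [true] for x_2. *)
Definition basis2 (R : realType) (b : bool) : R * R :=
  if b then (0, 1) else (1, 0).

Definition iter_partial (R : realType) (s : seq bool) (f : R * R -> R) :
    R * R -> R :=
  foldr (fun b g => fun x => 'D_(basis2 R b) g x) f s.

Definition smooth2 (R : realType) (f : R * R -> R) : Prop :=
  forall s : seq bool,
    continuous (iter_partial s f) /\
    forall (x : R * R) (b : bool), derivable (iter_partial s f) x (basis2 R b).

Definition Csmooth2 (R : realType) (f : R * R -> R[i]) : Prop :=
  smooth2 (fun x => complex.Re (f x)) /\ smooth2 (fun x => complex.Im (f x)).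

(* Essential supremum of the modulus over [D] ([f] is extended by 0 off [D]),
   an element of [\bar R]. *)
Definition Linfty_norm (R : realType) (D : set (R * R)) (f : R * R -> R[i]) :
    \bar R :=
  Lnorm (@lebesgue2 R) +oo%E
    (fun x => (\1_D x * normc (f x))%:E).

Definition P3 (R : realType) (a0 a1 a2 a3 : R) (x : R * R) : R :=
  a0 * x.1 ^+ 3 + 3 * a1 * x.1 ^+ 2 * x.2
  + 3 * a2 * x.1 * x.2 ^+ 2 + a3 * x.2 ^+ 3.

Definition disc3 (R : realType) (a0 a1 a2 a3 : R) : R :=
  3 * a1 ^+ 2 * a2 ^+ 2 + 6 * a0 * a1 * a2 * a3 - 4 * a0 * a2 ^+ 3
  - 4 * a1 ^+ 3 * a3 - a0 ^+ 2 * a3 ^+ 2.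

Definition Iab (R : realType) (alpha beta a0 a1 a2 a3 : R)
    (psi : R * R -> R[i]) : R[i] :=
  Cintegral (@unit_disc R) (fun x =>
    mittag_leffler alpha beta ('i%C * (P3 a0 a1 a2 a3 x)%:C) * psi x).

(* Main.v *)
Require Import Defs.
From HB Require Import structures.
From mathcomp Require Import all_boot all_order all_algebra.
From mathcomp Require Import all_classical all_reals all_analysis.
From mathcomp Require Import complex.
From mathcomp Require Import ring lra measurable_realfun.
Import Order.TTheory GRing.Theory Num.Theory.
Import numFieldNormedType.Exports.
Import ComplexField.Normc.

(** Two estimates, combined pointwise, give the theorem:
    - [|E_(alpha,beta)(i u)| <= C / (1 + |u|)] for all real [u]
      ([mittag_leffler_imag]);
    - the integral of [1 / (1 + |P3|)] over the whole plane is at most a constant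
      times [|D| ^ (-1/6)] ([plane_int]).

    The decay of [E]. Put [z = e^w] with [w = x + i y]. For an integrand [f] that is real
    on the real axis, the integral over the end [x = x0] and the upper side [y = m] of
    a half strip, [pi / 2 < m < pi], has an imaginary part [contour m x0 f] that does
    not depend on [x0] as long as no pole is crossed ([contour_shift], from Cauchy's theorem on rectangles).
    For [exp (e^w + (1 - s) w)] its value is [pi / Gamma s] ([Gamma_hankel]): after
    multiplication by [t ^ (s - 1) e^(-t)] and integration in [t], the exchange of
    integrals leaves the contour integral of [e^(c w) / (1 - e^w)], and this is [pi],
    half a residue, as one sees by letting the contour cross the pole, where the
    Poisson kernel appears.
    Next, [z^A / (z^A + y) = 1 - y / (z^A + y)] makes the contour integral [J b] of
    [e^z z^(A - b) / (z^A + y)] satisfy [J b = pi / Gamma b - y J (b + A)]. Iterating,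
    the partial sums of [pi E_(A,b)(-y)] are [J b] up to a remainder, which vanishes
    on contours far to the right. When [A m < pi], the two summands of [z^A + y]
    cannot cancel, so [J b = O(1 / (1 + y))]. The even and odd parts of the series,
    [E_(alpha,beta)(i t) = E_(2 alpha,beta)(-t^2) + i t E_(2 alpha,alpha+beta)(-t^2)],
    bring this to the imaginary axis; [alpha < 1] leaves room for [m] between [pi / 2]
    and [pi / (2 alpha)].

    The plane integral. The substitution [x1 = t x2] and the homogeneity of the form
    reduce it to the integral in [t] of [inner |p t|], where [p t = P3 (t, 1)] and
    [inner q] is a multiple of [q ^ (-2/3)]. Let [z] be the complex root of [p] nearest
    to [t], and [d <= M] its distances to the two other roots. Then [|p t|] is at least
    a multiple of [|a0| d^2 M] times [v (1 + v^(1/3))^3], [v = |t - Re z| / d], whose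
    power [-2/3] has an explicit antiderivative ([is_derive_weight]). What results is
    [d / (|a0| d^2 M)^(2/3)] for each root, at most a multiple of [|D| ^ (-1/6)] because
    [27 D = a0^4 prod (zi - zj)^2] and no distance of roots in this product exceeds
    [2 M] ([admissible_root]). If [a0 = 0] one root is at infinity and the same argument
    applies to a quadratic polynomial. *)

Set Implicit Arguments.
Unset Strict Implicit.
Unset Printing Implicit Defensive.
Local Open Scope classical_set_scope.
Local Open Scope ring_scope.
Local Open Scope complex_scope.

(** * The complex exponential and holomorphic functions *)

Section ComplexExponential.
Context {R : realType}.
Implicit Types (x y t : R) (z u v : R[i]).

Notation Re := (@complex.Re R).
Notation Im := (@complex.Im R).

Definition cexp z : R[i] := (expR (Re z) * cos (Im z)) +i* (expR (Re z) * sin (Im z)).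

Lemma ReD u v : Re (u + v) = Re u + Re v.
Proof. by case: u; case: v. Qed.
Lemma ImD u v : Im (u + v) = Im u + Im v.
Proof. by case: u; case: v. Qed.
Lemma ReN u : Re (- u) = - Re u. Proof. by case: u. Qed.
Lemma ImN u : Im (- u) = - Im u. Proof. by case: u. Qed.
Lemma ReM u v : Re (u * v) = Re u * Re v - Im u * Im v.
Proof. by case: u; case: v. Qed.
Lemma ImM u v : Im (u * v) = Re u * Im v + Im u * Re v.
Proof. by case: u; case: v. Qed.
Lemma ReV u : Re u^-1 = Re u / (Re u ^+ 2 + Im u ^+ 2).
Proof. by case: u. Qed.
Lemma ImV u : Im u^-1 = - Im u / (Re u ^+ 2 + Im u ^+ 2).
Proof. by case: u => a b /=; rewrite mulNr. Qed.
Definition ReImE := (ReD, ImD, ReN, ImN, ReM, ImM, ReV, ImV).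

Lemma eqRI u v : Re u = Re v -> Im u = Im v -> u = v.
Proof. by case: u => a b; case: v => c d /= -> ->. Qed.

Lemma cexpD u v : cexp (u + v) = cexp u * cexp v.
Proof.
apply: eqRI; rewrite /cexp !ReImE /= ?ReImE expRD ?cosD ?sinD; ring.
Qed.

Lemma cexp0 : cexp 0 = 1.
Proof. by rewrite /cexp /= expR0 cos0 sin0 mul1r mulr0. Qed.

Lemma normcE2 u : normc u = Num.sqrt (Re u ^+ 2 + Im u ^+ 2).
Proof. by case: u. Qed.

Lemma normc_cexp z : normc (cexp z) = expR (Re z).
Proof.
rewrite normcE2 /= !exprMn -mulrDr cos2Dsin2 mulr1 sqrtr_sqr ger0_norm //.
Qed.

Lemma cexp_real x : cexp x%:C = (expR x)%:C.
Proof. by rewrite /cexp /= cos0 sin0 mulr1 mulr0. Qed.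

Lemma normc_ge0 z : 0 <= normc z. Proof. by rewrite normcE2 sqrtr_ge0. Qed.
Lemma ler_Re_normc z : `|Re z| <= normc z.
Proof. by rewrite normcE2 -sqrtr_sqr ler_wsqrtr // lerDl sqr_ge0. Qed.
Lemma ler_Im_normc z : `|Im z| <= normc z.
Proof. by rewrite normcE2 -sqrtr_sqr ler_wsqrtr // lerDr sqr_ge0. Qed.
Lemma normc_leD1 z : normc z <= `|Re z| + `|Im z|.
Proof.
rewrite normcE2 -[leRHS]ger0_norm ?addr_ge0 // -sqrtr_sqr ler_wsqrtr //.
rewrite sqrrD !real_normK ?num_real // lerD2r lerDl.
by rewrite mulrn_wge0 // mulr_ge0.
Qed.
Lemma normcR x : normc x%:C = `|x|.
Proof. by rewrite normcE2 /= expr0n addr0 sqrtr_sqr. Qed.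
Lemma normcX z n : normc (z ^+ n) = normc z ^+ n.
Proof. by elim: n => [|n IH]; rewrite ?expr0 ?normc1 // !exprS normcM IH. Qed.
Lemma ReZ x z : Re (x%:C * z) = x * Re z.
Proof. by rewrite ReM /= mul0r subr0. Qed.
Lemma ImZ x z : Im (x%:C * z) = x * Im z.
Proof. by rewrite ImM /= mul0r addr0. Qed.
Lemma normc_eq0 z : (normc z == 0) = (z == 0).
Proof. by apply/eqP/eqP => [/eq0_normc|->] //; rewrite normc0. Qed.
Lemma sqnormc_neq0 z : z != 0 -> Re z ^+ 2 + Im z ^+ 2 != 0.
Proof.
apply: contra_neq => h; apply: eq0_normc; by rewrite normcE2 h sqrtr0.
Qed.

End ComplexExponential.
Arguments cexp : simpl never.
Notation Re := complex.Re.
Notation Im := complex.Im.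

Section ComplexDerivative.
Context {R : realType}.
Implicit Types (f g : R -> R[i]) (t : R).

(** Componentwise, so that the real fundamental theorem of calculus applies to the real
    and imaginary parts. *)
Definition cder f t (d : R[i]) :=
  is_derive t 1 (fun s => Re (f s)) (Re d) /\
  is_derive t 1 (fun s => Im (f s)) (Im d).

Lemma cder_eq f t d d' : cder f t d -> d = d' -> cder f t d'.
Proof. by move=> h <-. Qed.

Lemma cder_cst (c : R[i]) t : cder (fun=> c) t 0.
Proof. by split; exact: is_derive_cst. Qed.

Lemma cderD f g t a b : cder f t a -> cder g t b -> cder (fun s => f s + g s) t (a + b).
Proof.
move=> [f1 f2] [g1 g2]; split; rewrite ReImE.
  rewrite (_ : (fun s => _) = (fun s => Re (f s)) + (fun s => Re (g s))).
    exact: is_deriveD.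
  by apply/funext => s; rewrite ReD.
rewrite (_ : (fun s => _) = (fun s => Im (f s)) + (fun s => Im (g s))).
  exact: is_deriveD.
by apply/funext => s; rewrite ImD.
Qed.

Lemma cderM f g t a b : cder f t a -> cder g t b ->
  cder (fun s => f s * g s) t (a * g t + f t * b).
Proof.
move=> [f1 f2] [g1 g2]; split.
  rewrite (_ : (fun s => _) = (fun s => Re (f s)) * (fun s => Re (g s)) -
     (fun s => Im (f s)) * (fun s => Im (g s))).
    apply: is_derive_eq (is_deriveB (is_deriveM f1 g1) (is_deriveM f2 g2)) _.
    by rewrite !ReImE /GRing.scale /=; ring.
  by apply/funext => s; rewrite ReM.
rewrite (_ : (fun s => _) = (fun s => Re (f s)) * (fun s => Im (g s)) +
     (fun s => Im (f s)) * (fun s => Re (g s))).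
  apply: is_derive_eq (is_deriveD (is_deriveM f1 g2) (is_deriveM f2 g1)) _.
  by rewrite !ReImE /GRing.scale /=; ring.
by apply/funext => s; rewrite ImM.
Qed.

Lemma cderZ f t a (c : R[i]) : cder f t a -> cder (fun s => c * f s) t (c * a).
Proof.
move=> h; apply: cder_eq (cderM (cder_cst c t) h) _; by rewrite mul0r add0r.
Qed.

Lemma cderV f t a : f t != 0 -> cder f t a -> cder (fun s => (f s)^-1) t (- a / f t ^+ 2).
Proof.
move=> f0 [f1 f2].
have n0 := sqnormc_neq0 f0.
pose N := (fun s => Re (f s)) ^+ 2 + (fun s => Im (f s)) ^+ 2 : R -> R.
have Nt : N t = Re (f t) ^+ 2 + Im (f t) ^+ 2 by rewrite /N !fctE.
have N0 : N t != 0 by rewrite Nt.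
have dN : is_derive t 1 N (2 * (Re (f t) * Re a + Im (f t) * Im a)).
  apply: is_derive_eq (is_deriveD (is_deriveX 2 f1) (is_deriveX 2 f2)) _.
  by rewrite /GRing.scale /= !expr1; ring.
have dV := is_deriveV N0 dN.
have EV : (fun s => Re (f s)) * (fun s => (N s)^-1) = fun s => Re (f s)^-1.
  by apply/funext => s; rewrite ReV /N !fctE.
have EW : (- (fun s => Im (f s))) * (fun s => (N s)^-1) = fun s => Im (f s)^-1.
  by apply/funext => s; rewrite ImV /N !fctE.
split; rewrite -?EV -?EW (expr2 (f t)) invfM.
  apply: is_derive_eq; rewrite !ReImE Nt /GRing.scale /=.
  by field.
apply: is_derive_eq; rewrite !ReImE Nt /GRing.scale /= fctE.
by field.
Qed.

Lemma cder_exp f t a : cder f t a -> cder (fun s => cexp (f s)) t (a * cexp (f t)).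
Proof.
move=> [f1 f2]; split.
  rewrite (_ : (fun s => _) = (expR \o (fun s => Re (f s))) * (cos \o (fun s => Im (f s)))) //.
  apply: is_derive_eq; rewrite !ReImE /GRing.scale /=; ring.
rewrite (_ : (fun s => _) = (expR \o (fun s => Re (f s))) * (sin \o (fun s => Im (f s)))) //.
apply: is_derive_eq; rewrite !ReImE /GRing.scale /=; ring.
Qed.

Lemma cder_Re_cont f t d : cder f t d -> {for t, continuous (fun s => Re (f s))}.
Proof. by move=> [h _]; apply/differentiable_continuous/derivable1_diffP; case: h. Qed.
Lemma cder_Im_cont f t d : cder f t d -> {for t, continuous (fun s => Im (f s))}.
Proof. by move=> [_ h]; apply/differentiable_continuous/derivable1_diffP; case: h. Qed.

End ComplexDerivative.

Section Holomorphic.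
Context {R : realType}.
Implicit Types (f g : R -> R -> R[i]) (x y : R).

(** One complex number [d] governing both partial derivatives: the Cauchy-Riemann
    equations at [x + i y]. *)
Definition hol f x y (d : R[i]) :=
  cder (f ^~ y) x d /\ cder (f x) y ('i%C * d).

Lemma hol_eq f x y d d' : hol f x y d -> d = d' -> hol f x y d'.
Proof. by move=> h <-. Qed.

Lemma hol_cst (c : R[i]) x y : hol (fun _ _ => c) x y 0.
Proof. by split; rewrite ?mulr0; exact: cder_cst. Qed.

Lemma hol_id x y : hol (fun x y => x +i* y) x y 1.
Proof.
split; split => /=.
- exact: is_derive_id.
- exact: is_derive_cst.
- by rewrite mulr1 /= mulr0 subrr; exact: is_derive_cst.
- by rewrite /= mulr0 mulr1 add0r; exact: is_derive_id.
Qed.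

Lemma holD f g x y a b : hol f x y a -> hol g x y b ->
  hol (fun x y => f x y + g x y) x y (a + b).
Proof. by move=> [f1 f2] [g1 g2]; split; rewrite ?mulrDr; apply: cderD. Qed.

Lemma holM f g x y a b : hol f x y a -> hol g x y b ->
  hol (fun x y => f x y * g x y) x y (a * g x y + f x y * b).
Proof.
move=> [f1 f2] [g1 g2]; split; first exact: cderM.
by apply: cder_eq (cderM f2 g2) _; ring.
Qed.

Lemma holZ f x y a (c : R[i]) : hol f x y a -> hol (fun x y => c * f x y) x y (c * a).
Proof.
move=> h; apply: hol_eq (holM (hol_cst c x y) h) _; by rewrite mul0r add0r.
Qed.

Lemma holV f x y a : f x y != 0 -> hol f x y a ->
  hol (fun x y => (f x y)^-1) x y (- a / f x y ^+ 2).
Proof.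
move=> n0 [f1 f2]; split; first exact: (cderV (f:=f^~y)).
by apply: cder_eq (cderV n0 f2) _; ring.
Qed.

Lemma hol_exp f x y a : hol f x y a ->
  hol (fun x y => cexp (f x y)) x y (a * cexp (f x y)).
Proof.
move=> [f1 f2]; split; first exact: (cder_exp (f:=f^~y)).
by apply: cder_eq (cder_exp f2) _; ring.
Qed.

End Holomorphic.

(** * Integrals over the real line *)

Section RealIntegrals.
Context {R : realType}.
Notation mu := (@lebesgue_measure R).

Lemma is_derive_continuous (f : R -> R) (x d : R) : is_derive x 1 f d ->
  {for x, continuous f}.
Proof. by case=> df _; exact/differentiable_continuous/derivable1_diffP. Qed.

(** Both sides are measures that agree on half-open intervals. *)
Lemma lebesgue_measure_affine (k b : R) (A : set (measurableTypeR R)) : k != 0 ->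
  measurable A -> mu A = (`|k|%:E * mu ((fun x : R => (k * x + b)%R) @^-1` A))%E.
Proof.
move=> k0 mA.
pose f (x : measurableTypeR R) : measurableTypeR R := k * x + b.
have mf : measurable_fun setT f.
  by apply: measurable_funD => //; exact: measurable_funM.
pose nu := mscale (NngNum (normr_ge0 k)) (pushforward mu f)%E : {measure set (measurableTypeR R) -> \bar R}.
have -> : (`|k|%:E * mu ((fun x : R => (k * x + b)%R) @^-1` A))%E = nu mf A by [].
apply: lebesgue_measure_unique => // X [[u v]] /= _ <-.
rewrite /nu /mscale /= /pushforward.
have [k_gt0|k_lt0|/eqP] := ltrgt0P k; last by rewrite (negbTE k0).
  rewrite (_ : _ @^-1` _ = `](u - b) / k, (v - b) / k]%classic); last first.
    apply/seteqP; split => x /=; rewrite !in_itv /= /f ltr_pdivrMr // ler_pdivlMr //.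
      by move=> /andP[? ?]; apply/andP; split; lra.
    by move=> /andP[? ?]; apply/andP; split; lra.
  rewrite !lebesgue_measure_itv /= !lte_fin.
  have -> : ((u - b) / k < (v - b) / k) = (u < v).
    by rewrite ltr_pM2r ?invr_gt0 // ltrD2r.
  case: ifP => _; last by rewrite mule0.
  by rewrite -!EFinB -EFinM; congr EFin; field.
rewrite (_ : _ @^-1` _ = `[(v - b) / k, (u - b) / k[%classic); last first.
  apply/seteqP; split => x /=; rewrite !in_itv /= /f ltr_ndivlMr // ler_ndivrMr //.
    by move=> /andP[? ?]; apply/andP; split; lra.
  by move=> /andP[? ?]; apply/andP; split; lra.
rewrite !lebesgue_measure_itv /= !lte_fin.
have -> : ((v - b) / k < (u - b) / k) = (u < v).
  by rewrite ltr_nM2r ?invr_lt0 // ltrD2r.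
case: ifP => _; last by rewrite mule0.
by rewrite -!EFinB -EFinM; congr EFin; field.
Qed.

Lemma ge0_integral_affine (g : R -> \bar R) (k b : R) : k != 0 ->
  measurable_fun setT g -> (forall x, (0 <= g x)%E) ->
  (\int[mu]_x g x = `|k|%:E * \int[mu]_x g (k * x + b)%R)%E.
Proof.
move=> k0 mg g0.
pose f (x : measurableTypeR R) : measurableTypeR R := k * x + b.
have mf : measurable_fun setT f.
  by apply: measurable_funD => //; exact: measurable_funM.
pose nu := mscale (NngNum (normr_ge0 k)) (pushforward mu f)%E : {measure set (measurableTypeR R) -> \bar R}.
rewrite (@eq_measure_integral _ _ _ _ (nu mf)); last first.
  by move=> A mA _; exact: (lebesgue_measure_affine b k0 mA).
rewrite ge0_integral_mscale //; congr (_ * _)%E.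
by rewrite ge0_integral_pushforward //= preimage_setT.
Qed.

Lemma integral_shift (g : R -> \bar R) (b : R) : measurable_fun setT g ->
  (\int[mu]_x g x = \int[mu]_x g (x + b)%R)%E.
Proof.
move=> mg.
have aux (h : R -> \bar R) : measurable_fun setT h -> (forall x, (0 <= h x)%E) ->
    (\int[mu]_x h x = \int[mu]_x h (x + b)%R)%E.
  move=> mh h0; rewrite (@ge0_integral_affine h 1 b) // ?oner_neq0 // normr1 mul1e.
  by under eq_integral do rewrite mul1r.
rewrite integralE [RHS]integralE; congr (_ - _)%E.
  rewrite (aux (g^\+)%E (measurable_funepos mg) (funepos_ge0 g)).
  by apply: eq_integral => x _; rewrite !funeposE.
rewrite (aux (g^\-)%E (measurable_funeneg mg) (funeneg_ge0 g)).
by apply: eq_integral => x _; rewrite !funenegE.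
Qed.

Lemma Rintegral_shift (g : R -> R) (a b : R) : measurable_fun setT g ->
  \int[mu]_(x in `[a + b, +oo[) g x = \int[mu]_(x in `[a, +oo[) g (x + b).
Proof.
move=> mg; rewrite /Rintegral; congr fine.
rewrite integral_mkcond (integral_shift b); last first.
  by apply/(measurable_restrictT (EFin \o g)) => //; apply/measurable_EFinP; exact: measurable_funTS.
rewrite [RHS]integral_mkcond; apply: eq_integral => x _.
rewrite !patchE /=.
have -> : (x + b \in `[a + b, +oo[%classic) = (x \in `[a, +oo[%classic).
  by rewrite !mem_setE !in_itv /= !andbT lerD2r.
by case: ifP.
Qed.

Lemma integrable_eq (D : set R) (f g : R -> R) : measurable D ->
  (forall x, D x -> f x = g x) -> mu.-integrable D (EFin \o f) ->
  mu.-integrable D (EFin \o g).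
Proof.
move=> mD fg.
have H := @eq_integrable _ _ _ mu D mD (EFin \o f) (EFin \o g); apply: H.
by move=> x /[1!inE] /= /fg ->.
Qed.

Lemma integrable_bound (D : set R) (f g : R -> R) : measurable D ->
  measurable_fun D f -> (forall x, D x -> `|f x| <= g x) ->
  mu.-integrable D (EFin \o g) -> mu.-integrable D (EFin \o f).
Proof.
move=> mD mf fg; have H := @le_integrable _ _ _ mu D mD (EFin \o f) (EFin \o g).
apply: H; first exact/measurable_EFinP.
by move=> x /fg h; rewrite lee_fin (le_trans h) // ler_norm.
Qed.

Lemma integrable_scale (D : set R) (f : R -> R) (k : R) : measurable D ->
  mu.-integrable D (EFin \o f) -> mu.-integrable D (EFin \o (fun x => k * f x)).
Proof. by move=> mD fi; have H := @integrableZl _ _ _ mu D mD k _ fi; exact: H. Qed.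

Lemma Rintegral_scale (D : set R) (f : R -> R) (k : R) : measurable D ->
  mu.-integrable D (EFin \o f) ->
  \int[mu]_(x in D) (k * f x) = k * \int[mu]_(x in D) f x.
Proof. by move=> mD fi; rewrite RintegralZl. Qed.

Lemma integrable_add (D : set R) (f g : R -> R) : measurable D ->
  mu.-integrable D (EFin \o f) -> mu.-integrable D (EFin \o g) ->
  mu.-integrable D (EFin \o (fun x => f x + g x)).
Proof.
by move=> mD fi gi; have H := @integrableD _ _ _ mu D mD _ _ fi gi; exact: H.
Qed.

Lemma Rintegral_add (D : set R) (f g : R -> R) : measurable D ->
  mu.-integrable D (EFin \o f) -> mu.-integrable D (EFin \o g) ->
  \int[mu]_(x in D) (f x + g x) = \int[mu]_(x in D) f x + \int[mu]_(x in D) g x.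
Proof. by move=> mD fi gi; rewrite RintegralD. Qed.

Lemma continuous_itv_integrable (f : R -> R) (a b : R) :
  {in `[a, b], continuous f} -> mu.-integrable `[a, b] (EFin \o f).
Proof.
move=> cf; apply: continuous_compact_integrable; first exact: segment_compact.
by apply: continuous_in_subspaceT => x; rewrite inE => /cf.
Qed.

Lemma cvg_expRN (c : R) : 0 < c -> expR (- (c * x)) @[x --> +oo] --> 0.
Proof.
move=> c0; apply: (@cvg_comp _ _ _ (fun x => c * x) (fun x => expR (- x)) +oo%R +oo%R).
  exact: gt0_cvgMry.
exact: cvgr_expR.
Qed.

Lemma integrable_expRN (a c : R) : 0 < c ->
  mu.-integrable `[a, +oo[ (EFin \o (fun x => expR (- (c * x)))).
Proof.
move=> c0; apply/integrableP; split.
  apply/measurable_EFinP; apply: measurable_funTS; apply: continuous_measurable_fun => x.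
  by apply: continuous_comp; [apply: cvgN; exact: mulrl_continuous|exact: continuous_expR].
under eq_integral => x _ do rewrite /= ger0_norm ?expR_ge0 //.
have dF (x : R) : is_derive x 1 (fun x : R => - c^-1 * expR (- (c * x))) (expR (- (c * x))).
  apply: is_derive_eq.
  by rewrite /GRing.scale /=; field; rewrite gt_eqF.
rewrite (@ge0_continuous_FTC2y _ _ (fun x => - c^-1 * expR (- (c * x))) _ 0).
- by rewrite ltry.
- by move=> x _; exact: expR_ge0.
- apply: continuous_subspaceT => x.
  by apply: continuous_comp; [apply: cvgN; exact: mulrl_continuous|exact: continuous_expR].
- suff : (- c^-1 * expR (- (c * x))) @[x --> +oo] --> - c^-1 * 0 by rewrite mulr0.
  by apply: cvgMl_tmp; exact: cvg_expRN.
- by move=> x _; apply: ex_derive.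
- by apply: cvg_at_right_filter; exact: is_derive_continuous (dF a).
- by move=> x _; rewrite derive1E derive_val.
Qed.

(** Truncations of the half line are dominated by [|f|]. *)
Lemma cvg_Rintegral_itvcy (f : R -> R) (a : R) :
  mu.-integrable `[a, +oo[ (EFin \o f) ->
  \int[mu]_(x in `[a, a + n%:R]) f x @[n --> \oo] --> \int[mu]_(x in `[a, +oo[) f x.
Proof.
move=> fi.
pose f_ n := (EFin \o f) \_ `[a, a + n%:R].
have mfi := measurable_int _ fi.
have : (\int[mu]_(x in `[a, +oo[) f_ n x)%E @[n --> \oo] --> (\int[mu]_(x in `[a, +oo[) (f x)%:E)%E.
  apply: (@dominated_cvg _ _ _ mu _ _ f_ _ (fun x => `|(f x)%:E|%E)) => //=.
  - move=> n; apply/measurable_restrict => //.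
    by apply: measurable_funS mfi.
  - move=> x; rewrite in_itv /= andbT => ax.
    apply: cvg_near_cst; near=> n.
    rewrite /f_ patchE ifT // mem_setE in_itv /= ax /= -lerBlDl.
    by near: n; exact: nbhs_infty_ger.
  - exact: (integrable_abse fi).
  - move=> n x _; rewrite /f_ patchE; case: ifP => //= _.
    by rewrite normr0 lee_fin.
have -> : (fun n => \int[mu]_(x in `[a, +oo[) f_ n x)%E = (fun n => (\int[mu]_(x in `[a, a + n%:R]) f x)%:E).
  apply/funext => n; rewrite /f_ -integral_mkcondr setIidr; last first.
    by move=> x /=; rewrite !in_itv /= andbT => /andP[].
  rewrite fineK //; apply: integrable_fin_num => //.
  apply: integrableS fi => //.
  by move=> x /=; rewrite !in_itv /= andbT => /andP[].
rewrite -[X in _ --> X -> _](fineK (integrable_fin_num _ fi)) //.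
by move=> /fine_cvgP[].
Unshelve. all: by end_near.
Qed.

Lemma cvg_Rintegral_dominated (D : set R) (F : nat -> R -> R) (f g : R -> R) :
  measurable D -> (forall n, measurable_fun D (F n)) ->
  (forall x, D x -> F n x @[n --> \oo] --> f x) ->
  mu.-integrable D (EFin \o g) -> (forall n x, D x -> `|F n x| <= g x) ->
  \int[mu]_(x in D) F n x @[n --> \oo] --> \int[mu]_(x in D) f x.
Proof.
move=> mD mF Ff gi Fg.
have Fi n : mu.-integrable D (EFin \o F n).
  by apply: integrable_bound gi => // x Dx; exact: Fg.
have mf : measurable_fun D f by apply: measurable_fun_cvg Ff.
have fi : mu.-integrable D (EFin \o f).
  apply: integrable_bound gi => // x Dx.
  have cn : `|F n x| @[n --> \oo] --> `|f x| by apply: cvg_norm; exact: Ff.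
  rewrite -(cvg_lim _ cn) //; apply: limr_le; first by apply/cvg_ex; exists `|f x|.
  by apply: nearW => n; exact: Fg.
have : (\int[mu]_(x in D) (F n x)%:E)%E @[n --> \oo] --> (\int[mu]_(x in D) (f x)%:E)%E.
  apply: (@dominated_cvg _ _ _ mu _ mD (fun n x => (F n x)%:E) _ (EFin \o g)) => //=.
  - by move=> n; apply/measurable_EFinP; exact: mF.
  - by move=> x Dx; apply: cvg_EFin; [exact: nearW|exact: Ff].
rewrite -[X in _ --> X -> _](fineK (integrable_fin_num _ fi)) //.
by move=> /fine_cvgP[].
Qed.

Lemma FTC2 (f F : R -> R) (a b : R) : a <= b ->
  (forall x, x \in `[a, b] -> is_derive x 1 F (f x)) -> {in `[a, b], continuous f} ->
  \int[mu]_(x in `[a, b]) f x = F b - F a.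
Proof.
rewrite le_eqVlt => /predU1P[<-|ab] dF cf.
  by rewrite set_itv1 Rintegral_set1 subrr.
have cF x : x \in `[a, b] -> F t @[t --> x] --> F x.
  by move=> /dF; exact: is_derive_continuous.
rewrite /Rintegral (continuous_FTC2 ab (F := F)) //.
- apply: continuous_in_subspaceT => x; rewrite inE; exact: cf.
- split.
  + move=> x xab; have [] := dF x => //.
    by apply: subset_itv_oo_cc.
  + by apply: cvg_at_right_filter; apply: cF; rewrite in_itv /= lexx ltW.
  + by apply: cvg_at_left_filter; apply: cF; rewrite in_itv /= lexx ltW.
- move=> x xab; rewrite derive1E; have [] := dF x => //.
  by apply: subset_itv_oo_cc.
Qed.

Lemma FTC2y (f F : R -> R) (a l : R) :
  (forall x : R, is_derive x 1 F (f x)) -> continuous f ->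
  mu.-integrable `[a, +oo[ (EFin \o f) -> F x @[x --> +oo] --> l ->
  \int[mu]_(x in `[a, +oo[) f x = l - F a.
Proof.
move=> dF cf fi Fl.
have E (n : nat) : \int[mu]_(x in `[a, a + n%:R]) f x = F (a + n%:R) - F a.
  by apply: FTC2 => //; rewrite lerDl.
have H : \int[mu]_(x in `[a, a + n%:R]) f x @[n --> \oo] --> l - F a.
  under eq_cvg do rewrite E.
  apply: cvgB; last exact: cvg_cst.
  apply: (@cvg_comp _ _ _ (fun n : nat => a + n%:R) F \oo +oo%R) => //.
  by apply: cvg_comp (@cvgr_idn R) _; exact: cvg_addrl.
exact: (cvg_unique _ (cvg_Rintegral_itvcy fi) H).
Qed.

End RealIntegrals.

(** * Fubini and Cauchy theorems *)

Section Exchange.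
Context {R : realType}.
Notation mu := (@lebesgue_measure R).

(** Fubini's theorem, where absolute integrability is certified by a bound [k] on the inner
    integrals. The integrability of the iterated integral is part of the conclusion because
    [Gamma_hankel] draws from it the integrability of the integrand of Gamma. *)
Lemma Rintegral_exchange (A B : set R) (f : R -> R -> R) (k : R -> R) :
  measurable A -> measurable B ->
  measurable_fun setT (fun p : R * R => f p.1 p.2) ->
  (forall x, A x -> mu.-integrable B (EFin \o f x)) ->
  (forall y, B y -> mu.-integrable A (EFin \o (f ^~ y))) ->
  (forall y, B y -> (\int[mu]_(x in A) `|(f x y)%:E| <= (k y)%:E)%E) ->
  mu.-integrable B (EFin \o k) ->
  mu.-integrable A (fun x => (\int[mu]_(y in B) f x y)%:E) /\
  \int[mu]_(x in A) (\int[mu]_(y in B) f x y) =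
  \int[mu]_(y in B) (\int[mu]_(x in A) f x y).
Proof.
move=> mA mB mf fB fA fk ki.
pose g (p : R * R) : \bar R := (fun p => (f p.1 p.2)%:E) \_ (A `*` B) p.
have mg : measurable_fun setT g.
  apply/(measurable_restrictT (fun p => (f p.1 p.2)%:E)); first exact: measurableX.
  by apply: measurable_funTS; exact/measurable_EFinP.
have gE x y : g (x, y) = if (x \in A) && (y \in B) then (f x y)%:E else 0%E.
  by rewrite /g patchE in_setX.
have gi : (product_measure1 mu mu).-integrable setT g.
  apply/integrable21ltyP => //.
  apply: (@le_lt_trans _ _ (\int[mu]_y ((fun y => `|(k y)%:E|%E) \_ B) y)%E); last first.
    by rewrite -integral_mkcond; case/integrableP: ki.
  apply: ge0_le_integral => //.
  - by move=> y _; exact: integral_ge0.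
  - have := @measurable_fun_fubini_tonelli_G _ _ _ _ _ mu (fun p => `|g p|%E).
    by apply => //; exact: measurableT_comp.
  - apply/(measurable_restrictT (fun y => `|(k y)%:E|%E)) => //.
    by apply: measurableT_comp => //; exact: measurable_int ki.
  - move=> y _; rewrite patchE; case: ifPn => yB; last first.
      by rewrite integral0_eq // => x _; rewrite gE (negbTE yB) andbF abse0.
    apply: le_trans (lee_abs _); apply: le_trans (fk _ _); last by rewrite -inE.
    rewrite [leRHS]integral_mkcond le_eqVlt; apply/predU1P; left.
    apply: eq_integral => x _; rewrite gE yB andbT patchE.
    by case: ifP => //; rewrite abse0.
have EA x : (\int[mu]_y g (x, y) = ((fun x => (\int[mu]_(y in B) f x y)%:E) \_ A) x)%E.
  rewrite patchE; case: ifPn => xA; last first.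
    by rewrite integral0_eq // => y _; rewrite gE (negbTE xA).
  rewrite fineK; last by apply: integrable_fin_num => //; apply: fB; rewrite -inE.
  rewrite [RHS]integral_mkcond; apply: eq_integral => y _.
  by rewrite gE xA patchE.
have EB y : (\int[mu]_x g (x, y) = ((fun y => (\int[mu]_(x in A) f x y)%:E) \_ B) y)%E.
  rewrite patchE; case: ifPn => yB; last first.
    by rewrite integral0_eq // => x _; rewrite gE (negbTE yB) andbF.
  rewrite fineK; last by apply: integrable_fin_num => //; apply: fA; rewrite -inE.
  rewrite [RHS]integral_mkcond; apply: eq_integral => x _.
  by rewrite gE yB andbT patchE.
split.
  have := integrable_fubini_F gi; rewrite /fubini_F.
  under eq_fun do rewrite EA; move=> h.
  have H := @integrable_mkcond _ _ _ mu A (fun x => (\int[mu]_(y in B) f x y)%:E) mA.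
  exact: H.2.
have := Fubini gi.
under eq_integral do rewrite EA; under [RHS]eq_integral do rewrite EB.
by rewrite -!integral_mkcond => e; exact: (congr1 fine e).
Qed.

End Exchange.
Section Cauchy.
Context {R : realType}.
Notation mu := (@lebesgue_measure R).

(** The integral of [Re f] over the vertical segment at [x] has derivative [Im f (x + i m)],
    by differentiation under the integral sign and the Cauchy-Riemann equations; the lower
    side contributes nothing since [f] is real there. The second derivative provides the
    continuity of [f'] that the fundamental theorem of calculus asks for. *)
Lemma Cauchy_rectangle (f f' f'' : R -> R -> R[i]) (u v m M x0 x1 : R) :
  0 < m -> u < x0 -> x0 <= x1 -> x1 < v ->
  (forall x y, u < x < v -> 0 <= y <= m ->
     [/\ hol f x y (f' x y), hol f' x y (f'' x y) & normc (f' x y) <= M]) ->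
  (forall x, u < x < v -> Im (f x 0) = 0) ->
  \int[mu]_(y in `[0, m]) Re (f x1 y) =
  \int[mu]_(y in `[0, m]) Re (f x0 y) + \int[mu]_(x in `[x0, x1]) Im (f x m).
Proof.
move=> m0 ux0 x01 x1v hf f0.
pose F x := \int[mu]_(y in `[0, m]) Re (f x y).
pose G x y := Re (f x y).
have Ry x y : u < x < v -> 0 <= y <= m -> is_derive y 1 (fun s => Re (f x s)) (- Im (f' x y)).
  move=> xuv ym; have [[_ [+ _]] _ _] := hf x y xuv ym.
  by rewrite !ReImE /= mul0r mul1r sub0r.
have Iy x y : u < x < v -> 0 <= y <= m -> is_derive y 1 (fun s => Im (f x s)) (Re (f' x y)).
  move=> xuv ym; have [[_ [_ +]] _ _] := hf x y xuv ym.
  by rewrite !ReImE /= mul0r mul1r add0r.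
have Rx x y : u < x < v -> 0 <= y <= m -> is_derive x 1 (fun s => Re (f s y)) (Re (f' x y)).
  by move=> xuv ym; have [[[+ _] _] _ _] := hf x y xuv ym.
have Ix x y : u < x < v -> 0 <= y <= m -> is_derive x 1 (fun s => Im (f s y)) (Im (f' x y)).
  by move=> xuv ym; have [[[_ +] _] _ _] := hf x y xuv ym.
have mm : 0 <= m <= m by rewrite lexx ltW.
have dF x : u < x < v -> is_derive x 1 F (Im (f x m)).
  move=> xuv.
  have xI : `]u, v[%classic x by rewrite /= in_itv.
  have intG z : `]u, v[%classic z -> mu.-integrable `[0, m] (EFin \o G z).
    rewrite /= in_itv /= => zuv; apply: continuous_itv_integrable => y.
    by rewrite in_itv /= => ym; exact: is_derive_continuous (Ry _ _ zuv ym).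
  have dG z y : `]u, v[%classic z -> `[0, m]%classic y -> derivable (G ^~ y) z 1.
    by rewrite /= !in_itv /= => zuv ym; case: (Rx z y zuv ym).
  have M0 : 0 <= M.
    have [_ _] := hf x m xuv mm; apply: le_trans; exact: normc_ge0.
  have intM : mu.-integrable `[0, m] (EFin \o (fun=> M)).
    by apply: continuous_itv_integrable => y _; exact: cvg_cst.
  have bG z y : `]u, v[%classic z -> `[0, m]%classic y -> `|partial1of2 G z y| <= M.
    rewrite /= !in_itv /= => zuv ym; rewrite partial1of2E.
    have [_ ->] := Rx z y zuv ym.
    by apply: le_trans (ler_Re_normc _) _; have [_ _] := hf z y zuv ym.
  have mI : measurable (`[0, m]%classic : set (measurableTypeR R)) by [].
  apply: DeriveDef.
    exact: (derivable_under_integral mI xI intG dG (fun=> M0) intM bG).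
  rewrite -derive1E (differentiation_under_integral mI xI intG dG (fun=> M0) intM bG).
  transitivity (\int[mu]_(y in `[0, m]) Re (f' x y)).
    apply: eq_Rintegral => y; rewrite inE /= in_itv /= => ym; rewrite partial1of2E.
    by have [_ ->] := Rx x y xuv ym.
  transitivity (Im (f x m) - Im (f x 0)); last by rewrite f0 ?subr0.
  apply: (FTC2 (F := fun y => Im (f x y))) => [|y|y]; first exact: ltW.
    by rewrite in_itv /=; exact: Iy.
  rewrite in_itv /= => ym.
  have [_ [_ h] _] := hf x y xuv ym; exact: cder_Re_cont h.
suff -> : \int[mu]_(x in `[x0, x1]) Im (f x m) = F x1 - F x0 by rewrite addrC subrK.
apply: FTC2 => // x; rewrite in_itv /= => /andP[x0x xx1].
  by apply: dF; rewrite (lt_le_trans ux0) //= (le_lt_trans xx1).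
apply: is_derive_continuous (Ix x m _ mm).
by rewrite (lt_le_trans ux0) //= (le_lt_trans xx1).
Qed.

End Cauchy.

(** * Hankel contours *)

Section Contour.
Context {R : realType}.
Notation mu := (@lebesgue_measure R).

(** The imaginary part of the integral of [f] along the segment from [x0] up to [x0 + i m],
    then along the ray going right at height [m]. For [f] real on the real axis this is half
    of a Hankel contour, whose other half is the mirror image. *)
Definition contour (m x0 : R) (f : R -> R -> R[i]) : R :=
  \int[mu]_(y in `[0, m]) Re (f x0 y) + \int[mu]_(x in `[x0, +oo[) Im (f x m).

Lemma Rintegral_splitcy (f : R -> R) (a b : R) : a <= b ->
  mu.-integrable `[a, +oo[ (EFin \o f) ->
  \int[mu]_(x in `[a, +oo[) f x =
  \int[mu]_(x in `[a, b]) f x + \int[mu]_(x in `[b, +oo[) f x.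
Proof.
move=> ab fi.
have fib : mu.-integrable `]b, +oo[ (EFin \o f).
  apply: integrableS fi => // x /=; rewrite !in_itv /= !andbT => /ltW.
  exact: le_trans.
rewrite -(Rintegral_itv_obnd_cbnd fib) -(@Rintegral_itvB _ f (BLeft a) (BInfty _ false) b) //.
by rewrite addrC subrK.
Qed.

Lemma contour_shift (f f' f'' : R -> R -> R[i]) (u v m M x0 x1 : R) :
  0 < m -> u < x0 -> x0 <= x1 -> x1 < v ->
  (forall x y, u < x < v -> 0 <= y <= m ->
     [/\ hol f x y (f' x y), hol f' x y (f'' x y) & normc (f' x y) <= M]) ->
  (forall x, u < x < v -> Im (f x 0) = 0) ->
  mu.-integrable `[x0, +oo[ (EFin \o (fun x => Im (f x m))) ->
  contour m x0 f = contour m x1 f.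
Proof.
move=> m0 ux0 x01 x1v hf f0 fi; rewrite /contour.
rewrite (Rintegral_splitcy x01 fi) (Cauchy_rectangle m0 ux0 x01 x1v hf f0).
by rewrite addrA.
Qed.

Lemma integrable_ray (f : R -> R) (a c K : R) : 0 < c ->
  {in `[a, +oo[, continuous f} ->
  (forall x, a <= x -> `|f x| <= K * expR (- (c * x))) ->
  mu.-integrable `[a, +oo[ (EFin \o f).
Proof.
move=> c0 cf fK.
apply: (@integrable_bound _ _ _ (fun x => K * expR (- (c * x)))) => //.
- apply: subspace_continuous_measurable_fun => //.
  by apply: continuous_in_subspaceT => x; rewrite inE => /cf.
- by move=> x /=; rewrite in_itv /= andbT => /fK.
- by apply: integrable_scale => //; exact: integrable_expRN.
Qed.

(** A double exponential beats every exponential: where [x] is not very negative,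
    [expR x >= (1 + x / 2)^2] and one completes the square. *)
Lemma superexp_decay (k c a : R) : 0 < k ->
  exists C, forall x, a <= x -> c * x - k * expR x <= C - x.
Proof.
move=> k0; exists (`|c + 1| * `|a| + (c + 1) ^+ 2 / k + 2 * `|c + 1|) => x ax.
have k1 : 0 <= (c + 1) ^+ 2 / k by rewrite divr_ge0 ?sqr_ge0 ?ltW.
have [x2|x2] := leP (-2) x.
  have e1 : 1 + x / 2 <= expR (x / 2) by exact: expR_ge1Dx.
  have e2 : (1 + x / 2) ^+ 2 <= expR x.
    have -> : expR x = expR (x / 2) ^+ 2 by rewrite -expRM_natl; congr expR; field.
    by rewrite lerXn2r ?nnegrE ?expR_ge0 //; lra.
  have e3 : k * (1 + x / 2) ^+ 2 <= k * expR x by rewrite ler_pM2l.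
  suff : (c + 1) * x - k * (1 + x / 2) ^+ 2 <= `|c + 1| * `|a| + (c + 1) ^+ 2 / k + 2 * `|c + 1|.
    by move: e3; set e := expR x; lra.
  have n1 : - (c + 1) <= `|c + 1| by rewrite -normrN ler_norm.
  have n2 : 0 <= `|c + 1| * `|a| by rewrite mulr_ge0.
  set z := 1 + x / 2.
  have -> : x = 2 * z - 2 by rewrite /z; lra.
  have : 0 <= ((c + 1) / k - z) ^+ 2 * k by rewrite mulr_ge0 ?sqr_ge0 ?ltW.
  have -> : ((c + 1) / k - z) ^+ 2 * k = (c + 1) ^+ 2 / k - 2 * (c + 1) * z + k * z ^+ 2.
    by field; rewrite gt_eqF.
  by set q := (c + 1) ^+ 2 / k; lra.
have n1 : (c + 1) * x <= `|c + 1| * `|a|.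
  apply: le_trans (ler_norm _) _; rewrite normrM ler_wpM2l //.
  by rewrite !ltr0_norm //; lra.
have : 0 <= k * expR x by rewrite mulr_ge0 ?expR_ge0 ?ltW.
have : 0 <= `|c + 1| by [].
move: n1 k1; set e := k * expR x; set q := (c + 1) ^+ 2 / k; set p := _ * `|a|.
lra.
Qed.

End Contour.

Section HankelKernel.
Context {R : realType}.
Notation mu := (@lebesgue_measure R).

(** In the coordinate [w = x + i y = log z], the integrand [e^(t z) z^(c - 1) dz]. *)
Definition hankel (t c x y : R) : R[i] :=
  cexp (t%:C * cexp (x +i* y) + c%:C * (x +i* y)).
Definition hankel1 (t c x y : R) : R[i] :=
  (t%:C * cexp (x +i* y) + c%:C) * hankel t c x y.
Definition hankel2 (t c x y : R) : R[i] :=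
  (t%:C * cexp (x +i* y) + (t%:C * cexp (x +i* y) + c%:C) ^+ 2) * hankel t c x y.

Lemma hol_cexp (x y : R) : hol (fun x y => cexp (x +i* y)) x y (cexp (x +i* y)).
Proof. by apply: hol_eq (hol_exp (hol_id x y)) _; rewrite mul1r. Qed.

Lemma hol_hankel t c x y : hol (hankel t c) x y (hankel1 t c x y).
Proof.
apply: hol_eq (hol_exp (holD (holZ t%:C (hol_cexp x y)) (holZ c%:C (hol_id x y)))) _.
by rewrite mulr1.
Qed.

Lemma hol_hankel1 t c x y : hol (hankel1 t c) x y (hankel2 t c x y).
Proof.
apply: hol_eq (holM (holD (holZ t%:C (hol_cexp x y)) (hol_cst c%:C x y)) (hol_hankel t c x y)) _.
by rewrite /hankel2 /hankel1; ring.
Qed.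

Lemma normc_hankel t c x y :
  normc (hankel t c x y) = expR (t * (expR x * cos y) + c * x).
Proof. by rewrite normc_cexp ReD !ReZ. Qed.

Lemma Re_hankel t c x y : Re (hankel t c x y) =
  expR (t * (expR x * cos y) + c * x) * cos (t * (expR x * sin y) + c * y).
Proof. by rewrite /hankel /cexp /= !mul0r !subr0 !addr0. Qed.

Lemma Im_hankel t c x y : Im (hankel t c x y) =
  expR (t * (expR x * cos y) + c * x) * sin (t * (expR x * sin y) + c * y).
Proof. by rewrite /hankel /cexp /= !mul0r !subr0 !addr0. Qed.

Lemma Im_hankel0 t c x : Im (hankel t c x 0) = 0.
Proof. by rewrite Im_hankel sin0 !mulr0 addr0 sin0 mulr0. Qed.

(** Crude, but uniform on a strip, as differentiation under the integral sign requires. *)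
Lemma hankel1_bound t c u v x y : u < x < v ->
  normc (hankel1 t c x y) <=
  (`|t| * expR v + `|c|) * expR (`|t| * expR v + `|c| * (`|u| + `|v|)).
Proof.
move=> /andP[ux xv]; rewrite normcM normc_hankel.
have ev : expR x <= expR v by rewrite ler_expR ltW.
apply: ler_pM; rewrite ?normc_ge0 ?expR_ge0 //.
  apply: le_trans (le_normcD _ _) _; rewrite normcM !normcR normc_cexp lerD //.
  by rewrite ler_wpM2l.
rewrite ler_expR lerD //.
  apply: le_trans (ler_norm _) _; rewrite normrM ler_wpM2l //.
  rewrite normrM ger0_norm ?expR_ge0 // -[leRHS]mulr1 ler_pM ?expR_ge0 //.
  by rewrite ler_norml cos_geN1 cos_le1.
apply: le_trans (ler_norm _) _; rewrite normrM ler_wpM2l //.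
rewrite ler_norml; apply/andP; split.
  by have := ler_norm (- u); rewrite normrN; have := normr_ge0 v; lra.
by have := ler_norm v; have := normr_ge0 u; lra.
Qed.

Lemma continuous_Im_hol (f f' : R -> R -> R[i]) (m x : R) :
  hol f x m (f' x m) -> {for x, continuous (fun x => Im (f x m))}.
Proof. by move=> [h _]; exact: (cder_Im_cont (f := f^~ m) h). Qed.

Lemma continuous_Re_hol (f f' : R -> R -> R[i]) (m x : R) :
  hol f x m (f' x m) -> {for x, continuous (fun x => Re (f x m))}.
Proof. by move=> [h _]; exact: (cder_Re_cont (f := f^~ m) h). Qed.

Lemma integrable_hankel_ray t c m a : 0 < t -> cos m < 0 ->
  mu.-integrable `[a, +oo[ (EFin \o (fun x => Im (hankel t c x m))).
Proof.
move=> t0 m0; have k0 : 0 < - (t * cos m) by rewrite -mulrN mulr_gt0 // oppr_gt0.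
have [C hC] := superexp_decay c a k0.
apply: (@integrable_ray _ _ _ 1 (expR C)) => //.
  by move=> x _; exact: continuous_Im_hol (hol_hankel t c x m).
move=> x ax; apply: le_trans (ler_Im_normc _) _.
rewrite normc_hankel -expRD ler_expR mul1r.
by move: (hC x ax); set e := expR x; lra.
Qed.

Lemma contour_hankel_shift t c m x0 x1 : 0 < t -> 0 < m -> cos m < 0 ->
  contour m x0 (hankel t c) = contour m x1 (hankel t c).
Proof.
move=> t0 m0 cm; wlog x01 : x0 x1 / x0 <= x1.
  by move=> h; have [/h//|/ltW/h//] := leP x0 x1.
have ux : x0 - 1 < x0 by rewrite ltrBlDr ltrDl.
have xv : x1 < x1 + 1 by rewrite ltrDl.
exact: (contour_shift m0 ux x01 xv
  (fun x y xuv _ => And3 (hol_hankel t c x y) (hol_hankel1 t c x y) (hankel1_bound t c y xuv))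
  (fun x _ => Im_hankel0 t c x) (integrable_hankel_ray c x0 t0 cm)).
Qed.

Lemma hankel_scale t c x y : 0 < t ->
  hankel t c x y = (expR (- (c * ln t)))%:C * hankel 1 c (x + ln t) y.
Proof.
move=> t0; rewrite /hankel -cexp_real -cexpD; congr cexp.
have -> : (x + ln t) +i* y = (ln t)%:C + (x +i* y) by apply: eqRI => /=; rewrite ?add0r // addrC.
rewrite cexpD cexp_real lnK // mul1r.
by apply: eqRI; rewrite !(ReD,ImD,ReZ,ImZ) /=; ring.
Qed.

Lemma measurable_Im_hankel t c m : measurable_fun setT (fun x => Im (hankel t c x m)).
Proof.
by apply: continuous_measurable_fun => x; exact: continuous_Im_hol (hol_hankel t c x m).
Qed.

(** Scaling [z] by [t] is a horizontal translation by [ln t] in the coordinate [w], and the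
    contour may be translated back. *)
Lemma contour_hankel_scale t c m x0 : 0 < t -> 0 < m -> cos m < 0 ->
  contour m x0 (hankel t c) = t `^ (- c) * contour m x0 (hankel 1 c).
Proof.
move=> t0 m0 cm; rewrite -(@contour_hankel_shift 1 c m (x0 + ln t)) //.
rewrite /contour mulrDr; congr (_ + _).
  under eq_Rintegral do rewrite hankel_scale // ReZ.
  rewrite RintegralZl //; first by rewrite /powR gt_eqF // mulNr.
  apply: continuous_itv_integrable => y _.
  have [_ h] := hol_hankel 1 c (x0 + ln t) y; exact: cder_Re_cont h.
rewrite Rintegral_shift; last exact: measurable_Im_hankel.
under eq_Rintegral do rewrite hankel_scale // ImZ.
rewrite RintegralZl //; first by rewrite /powR gt_eqF // mulNr.
apply: (@integrable_eq _ _ (fun x => (expR (- (c * ln t)))^-1 * Im (hankel t c x m))) => //.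
  move=> x _; rewrite (hankel_scale c x m t0) ImZ mulrA mulVf ?mul1r //.
  by rewrite gt_eqF ?expR_gt0.
by apply: integrable_scale => //; exact: integrable_hankel_ray.
Qed.

End HankelKernel.
Arguments hankel : simpl never.

(** * Laplace transforms *)

Section Laplace.
Context {R : realType}.
Notation mu := (@lebesgue_measure R).

Lemma Rintegral_expRN (a c : R) : 0 < c ->
  \int[mu]_(x in `[a, +oo[) expR (- (c * x)) = expR (- (c * a)) / c.
Proof.
move=> c0.
have dF (x : R) : is_derive x 1 (fun x : R => - c^-1 * expR (- (c * x))) (expR (- (c * x))).
  apply: is_derive_eq.
  by rewrite /GRing.scale /=; field; rewrite gt_eqF.
rewrite (@FTC2y _ _ _ a 0 dF).
- by rewrite mulNr opprK add0r mulrC.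
- move=> x; apply: continuous_comp; last exact: continuous_expR.
  by apply: cvgN; exact: mulrl_continuous.
- exact: integrable_expRN.
- suff : (- c^-1 * expR (- (c * x))) @[x --> +oo] --> - c^-1 * 0 by rewrite mulr0.
  by apply: cvgMl_tmp; exact: cvg_expRN.
Qed.

Lemma cder_cexp_line (z : R[i]) (t : R) :
  cder (fun t => cexp (- (t%:C * z))) t (- z * cexp (- (t%:C * z))).
Proof.
have h : cder (fun t : R => t%:C) t 1 by split; [exact: is_derive_id|exact: is_derive_cst].
have := cder_exp (cderZ (-1) (cderM h (cder_cst z t))).
rewrite !mulr0 mul1r mulN1r mulN1r addr0.
by under eq_fun do rewrite mulN1r.
Qed.

Lemma cvg_norm_le0 (f g : R -> R) : (forall x, `|f x| <= g x) ->
  g x @[x --> +oo] --> 0 -> f x @[x --> +oo] --> 0.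
Proof.
move=> fg g0; apply/norm_cvg0P; apply: (@squeeze_cvgr _ _ _ _ (cst 0) g) => //.
  by apply: nearW => x; rewrite normr_ge0 fg.
exact: cvg_cst.
Qed.

(** The antiderivative of [e^(-t z)] is explicit. The last bound is the certificate that
    [Rintegral_exchange] asks for. *)
Lemma laplace_cexp (a z : R[i]) : 0 < Re z ->
  [/\ mu.-integrable `]0, +oo[ (EFin \o (fun t => Re (a * cexp (- (t%:C * z))))),
   \int[mu]_(t in `]0, +oo[) Re (a * cexp (- (t%:C * z))) = Re (a / z) &
   (\int[mu]_(t in `]0%R, +oo[) `|(Re (a * cexp (- (t%:C * z))))%:E| <= (normc a / Re z)%:E)%E].
Proof.
move=> z0.
have z_neq0 : z != 0 by apply: contraTneq z0 => ->; rewrite ltxx.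
pose f t := Re (a * cexp (- (t%:C * z))).
have f_le t : `|f t| <= normc a * expR (- (Re z * t)).
  apply: le_trans (ler_Re_normc _) _; rewrite normcM normc_cexp.
  by rewrite ReN ReZ (mulrC t).
have cf : continuous f.
  by move=> t; exact: cder_Re_cont (cderZ a (cder_cexp_line z t)).
have fi : mu.-integrable `[0, +oo[ (EFin \o f).
  by apply: (integrable_ray z0) => [t _|t _]; [exact: cf|exact: f_le].
have sub : `]0, +oo[ `<=` (`[0, +oo[ : set R).
  by move=> t /=; rewrite !in_itv /= !andbT => /ltW.
have fi' : mu.-integrable `]0, +oo[ (EFin \o f) by apply: integrableS fi.
split=> //.
  rewrite Rintegral_itv_obnd_cbnd //.
  have dF (t : R) : is_derive t 1 (fun t : R => Re (- (a / z) * cexp (- (t%:C * z)))) (f t).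
    have [h _] := cderZ (- (a / z)) (cder_cexp_line z t).
    apply: is_derive_eq h _; congr Re; rewrite !mulrA; congr (_ * _).
    by field.
  rewrite (@FTC2y _ f _ 0 0 dF) //.
  - by rewrite mul0r oppr0 cexp0 mulr1 ReN opprK add0r.
  - apply: (@cvg_norm_le0 _ (fun t => normc (a / z) * expR (- (Re z * t)))).
      move=> t; apply: le_trans (ler_Re_normc _) _; rewrite normcM normcN normc_cexp.
      by rewrite ReN ReZ [t * _]mulrC.
    suff : (normc (a / z) * expR (- (Re z * t))) @[t --> +oo] --> normc (a / z) * 0.
      by rewrite mulr0.
    by apply: cvgMl_tmp; exact: cvg_expRN.
have gi : mu.-integrable `[0, +oo[ (EFin \o (fun t => normc a * expR (- (Re z * t)))).
  by apply: integrable_scale => //; exact: integrable_expRN.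
apply: (@le_trans _ _ (\int[mu]_(t in `[0%R, +oo[) (normc a * expR (- (Re z * t)))%:E)%E).
  apply: (@le_trans _ _ (\int[mu]_(t in `]0%R, +oo[) (normc a * expR (- (Re z * t)))%:E)%E).
    apply: ge0_le_integral => //.
    - by apply: measurableT_comp => //; exact: measurable_int fi'.
    - by apply: measurable_funS (measurable_int _ gi).
    - by move=> t _; rewrite lee_fin; exact: f_le.
  apply: ge0_subset_integral => //; first exact: measurable_int gi.
  by move=> t _; rewrite lee_fin mulr_ge0 ?normc_ge0 ?expR_ge0.
rewrite -[leLHS]fineK ?integrable_fin_num // lee_fin.
rewrite -/(Rintegral _ _ _) RintegralZl //; last exact: integrable_expRN.
by rewrite Rintegral_expRN // mulr0 oppr0 expR0 div1r.
Qed.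

End Laplace.

Section LaplaceHankel.
Context {R : realType}.
Notation mu := (@lebesgue_measure R).

(** The Laplace transform in [t], taken at [1], of [hankel t c]; see [hankel_laplaceE]. *)
Definition ckernel (c x y : R) : R[i] :=
  cexp (c%:C * (x +i* y)) / (1 - cexp (x +i* y)).

Lemma hankel_laplaceE (t c x y : R) : (expR (- t))%:C * hankel t c x y =
  cexp (c%:C * (x +i* y)) * cexp (- (t%:C * (1 - cexp (x +i* y)))).
Proof.
rewrite /hankel -cexp_real -!cexpD; congr cexp.
by apply: eqRI; rewrite !(ReD,ImD,ReN,ImN,ReZ,ImZ) /= ?(ReD,ImD,ReN,ImN) /=; ring.
Qed.

Lemma measurable_hankel_Re (c x0 : R) : measurable_fun setT
  (fun p : R * R => expR (- p.1) * Re (hankel p.1 c x0 p.2)).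
Proof.
under eq_fun do rewrite Re_hankel.
have mcos : measurable_fun setT (@cos R) by apply: continuous_measurable_fun; exact: continuous_cos.
have msin : measurable_fun setT (@sin R) by apply: continuous_measurable_fun; exact: continuous_sin.
have mc (f : R -> R) : measurable_fun setT f -> measurable_fun setT (fun p : R * R => f p.2).
  by move=> mf; exact: measurableT_comp.
have m1 : measurable_fun setT (fun p : R * R => p.1) by exact: measurable_fst.
have m2 : measurable_fun setT (fun p : R * R => p.2) by exact: measurable_snd.
apply: measurable_funM.
  by apply: measurableT_comp => //; exact: measurable_funN.
apply: measurable_funM.
  apply: measurableT_comp => //; apply: measurable_funD => //.
  apply: measurable_funM => //; apply: measurable_funM => //; exact: mc.
apply: measurableT_comp => //; apply: measurable_funD; apply: measurable_funM => //.
by apply: measurable_funM => //; exact: mc.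
Qed.

Lemma measurable_hankel_Im (c m : R) : measurable_fun setT
  (fun p : R * R => expR (- p.1) * Im (hankel p.1 c p.2 m)).
Proof.
under eq_fun do rewrite Im_hankel.
have msin : measurable_fun setT (@sin R) by apply: continuous_measurable_fun; exact: continuous_sin.
have mc (f : R -> R) : measurable_fun setT f -> measurable_fun setT (fun p : R * R => f p.2).
  by move=> mf; exact: measurableT_comp.
have m1 : measurable_fun setT (fun p : R * R => p.1) by exact: measurable_fst.
have m2 : measurable_fun setT (fun p : R * R => p.2) by exact: measurable_snd.
apply: measurable_funM.
  by apply: measurableT_comp => //; exact: measurable_funN.
apply: measurable_funM.
  apply: measurableT_comp => //; apply: measurable_funD; apply: measurable_funM => //.
  by apply: measurable_funM => //; exact: mc.
apply: measurableT_comp => //; apply: measurable_funD => //; apply: measurable_funM => //.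
by apply: measurable_funM => //; exact: mc.
Qed.

(** An exchange of integrals, possible because [Re (1 - e^w)] is positive along the contour:
    [x0 < 0] ensures it on the segment and [cos m < 0] on the ray. *)
Lemma laplace_contour (c m x0 : R) : c < 1 -> 0 < m -> cos m < 0 -> x0 < 0 ->
  mu.-integrable `]0, +oo[ (EFin \o (fun t => expR (- t) * contour m x0 (hankel t c))) /\
  \int[mu]_(t in `]0, +oo[) (expR (- t) * contour m x0 (hankel t c)) =
  contour m x0 (ckernel c).
Proof.
move=> c1 m0 cm x00.
have e1 : expR x0 < 1 by rewrite -expR0 ltr_expR.
have ReD1 x y : Re (1 - cexp (x +i* y)) = 1 - expR x * cos y by rewrite ReD ReN.
have Re1 y : 1 - expR x0 <= Re (1 - cexp (x0 +i* y)).
  rewrite ReD1 lerD2l lerN2 -[leRHS]mulr1 ler_pM2l ?expR_gt0 //; exact: cos_le1.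
have Re2 x : - cos m * expR x <= Re (1 - cexp (x +i* m)).
  by rewrite ReD1 mulNr mulrC lerDr.
have Re10 y : 0 < Re (1 - cexp (x0 +i* y)) by apply: lt_le_trans (Re1 y); rewrite subr_gt0.
have Re20 x : 0 < Re (1 - cexp (x +i* m)).
  by apply: lt_le_trans (Re2 x); rewrite mulr_gt0 ?expR_gt0 // oppr_gt0.
have E1 t y : expR (- t) * Re (hankel t c x0 y) =
    Re (cexp (c%:C * (x0 +i* y)) * cexp (- (t%:C * (1 - cexp (x0 +i* y))))).
  by rewrite -hankel_laplaceE ReZ.
have E2 t x : expR (- t) * Im (hankel t c x m) =
    Re (- 'i%C * cexp (c%:C * (x +i* m)) * cexp (- (t%:C * (1 - cexp (x +i* m))))).
  by rewrite -mulrA -hankel_laplaceE; case: (hankel t c x m) => a b /=; ring.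
have mO : measurable (`]0, +oo[%classic : set R) by [].
have X1 := @Rintegral_exchange R `]0, +oo[ `[0, m]
  (fun t y => expR (- t) * Re (hankel t c x0 y))
  (fun y => expR (c * x0) / (1 - expR x0)) mO (measurable_itv _) (measurable_hankel_Re c x0).
case: X1 => [t t0|y _|y _||i1 q1].
- apply: integrable_scale => //.
  apply: continuous_itv_integrable => y _.
  have [_ h] := hol_hankel t c x0 y; exact: cder_Re_cont h.
- have [h _ _] := laplace_cexp (cexp (c%:C * (x0 +i* y))) (Re10 y).
  by apply: integrable_eq h => // t _; rewrite E1.
- have [_ _ h] := laplace_cexp (cexp (c%:C * (x0 +i* y))) (Re10 y).
  under eq_integral do rewrite E1.
  apply: le_trans h _; rewrite lee_fin normc_cexp ReZ [Re (x0 +i* y)]/=.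
  by rewrite ler_wpM2l ?expR_ge0 // lef_pV2 ?posrE ?Re1 ?Re10 ?subr_gt0.
- by apply: (@continuous_itv_integrable _ (fun=> _)) => y _; exact: cvg_cst.
have X2 := @Rintegral_exchange R `]0, +oo[ `[x0, +oo[
  (fun t x => expR (- t) * Im (hankel t c x m))
  (fun x => (- cos m)^-1 * expR (- ((1 - c) * x))) mO (measurable_itv _) (measurable_hankel_Im c m).
case: X2 => [t t0|x _|x _||i2 q2].
- have t1 : 0 < t by move: t0; rewrite /= in_itv /= andbT.
  exact: integrable_scale (measurable_itv _) (integrable_hankel_ray c x0 t1 cm).
- have [h _ _] := laplace_cexp (- 'i%C * cexp (c%:C * (x +i* m))) (Re20 x).
  by apply: integrable_eq h => // t _; rewrite E2.
- have [_ _ h] := laplace_cexp (- 'i%C * cexp (c%:C * (x +i* m))) (Re20 x).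
  under eq_integral do rewrite E2.
  apply: le_trans h _; rewrite lee_fin normcM normcN normc_cexp ReZ.
  have -> : normc ('i%C : R[i]) = 1 by rewrite /= expr0n add0r expr1n sqrtr1.
  rewrite mul1r [Re (x +i* m)]/=.
  have -> : (- cos m)^-1 * expR (- ((1 - c) * x)) = expR (c * x) / (- cos m * expR x).
    rewrite invfM mulrC mulrA -expRN -mulrA [X in _ = _ * X]mulrC mulrA -expRD.
    by congr (expR _ * _); ring.
  have cx0 : 0 < - cos m * expR x by rewrite mulr_gt0 ?oppr_gt0 ?expR_gt0.
  apply: ler_wpM2l; first exact: expR_ge0.
  by rewrite lef_pV2 ?posrE; [exact: Re2|exact: Re20|exact: cx0].
- have c1' : 0 < 1 - c by rewrite subr_gt0.
  exact: integrable_scale (measurable_itv _) (integrable_expRN x0 c1').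
have EC t : `]0, +oo[%classic t -> expR (- t) * contour m x0 (hankel t c) =
    (\int[mu]_(y in `[0, m]) (expR (- t) * Re (hankel t c x0 y))) +
    \int[mu]_(x in `[x0, +oo[) (expR (- t) * Im (hankel t c x m)).
  move=> t0; have t1 : 0 < t by move: t0; rewrite /= in_itv /= andbT.
  have h1 := integrable_hankel_ray c x0 t1 cm.
  have h2 : mu.-integrable `[0, m] (EFin \o (fun y => Re (hankel t c x0 y))).
    apply: continuous_itv_integrable => y _.
    have [_ h] := hol_hankel t c x0 y; exact: cder_Re_cont h.
  rewrite (Rintegral_scale _ (measurable_itv _) h1) (Rintegral_scale _ (measurable_itv _) h2).
  by rewrite -mulrDr.
split.
  apply: (integrable_eq mO (fun t t0 => esym (EC t t0))).
  exact: integrable_add mO i1 i2.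
transitivity (\int[mu]_(t in `]0, +oo[)
    ((\int[mu]_(y in `[0, m]) (expR (- t) * Re (hankel t c x0 y))) +
    \int[mu]_(x in `[x0, +oo[) (expR (- t) * Im (hankel t c x m)))).
  by apply: eq_Rintegral => t /set_mem; exact: EC.
rewrite (Rintegral_add mO i1 i2) q1 q2 /contour; congr (_ + _); apply: eq_Rintegral => y _.
  have [_ <- _] := laplace_cexp (cexp (c%:C * (x0 +i* y))) (Re10 y).
  by apply: eq_Rintegral => t _; rewrite E1.
transitivity (Re (- 'i%C * cexp (c%:C * (y +i* m)) / (1 - cexp (y +i* m)))); last first.
  rewrite -mulrA -/(ckernel c y m); case: (ckernel c y m) => a b /=; ring.
have [_ <- _] := laplace_cexp (- 'i%C * cexp (c%:C * (y +i* m))) (Re20 y).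
by apply: eq_Rintegral => t _; rewrite E2.
Qed.

End LaplaceHankel.

(** * The kernel with a simple pole at the origin *)

Section Kernel.
Context {R : realType}.
Notation mu := (@lebesgue_measure R).

Definition cratio (x y : R) : R[i] := cexp (x +i* y) / (1 - cexp (x +i* y)).
Definition ckernel1 (c x y : R) : R[i] := (c%:C + cratio x y) * ckernel c x y.
Definition ckernel2 (c x y : R) : R[i] :=
  (cratio x y / (1 - cexp (x +i* y)) + (c%:C + cratio x y) ^+ 2) * ckernel c x y.

Lemma hol_1Ncexp (x y : R) :
  hol (fun x y => 1 - cexp (x +i* y)) x y (- cexp (x +i* y)).
Proof.
have := holD (hol_cst 1 x y) (holZ (-1) (hol_cexp x y)).
rewrite add0r mulN1r.
have -> : (fun x y : R => 1 + -1 * cexp (x +i* y)) = (fun x y => 1 - cexp (x +i* y)) => //.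
by apply/funext => a; apply/funext => b; rewrite mulN1r.
Qed.

Lemma hol_ckernel (c x y : R) : 1 - cexp (x +i* y) != 0 ->
  hol (ckernel c) x y (ckernel1 c x y).
Proof.
move=> n0.
apply: hol_eq (holM (hol_exp (holZ c%:C (hol_id x y))) (holV n0 (hol_1Ncexp x y))) _.
by rewrite /ckernel1 /ckernel /cratio; field.
Qed.

Lemma hol_ckernel1 (c x y : R) : 1 - cexp (x +i* y) != 0 ->
  hol (ckernel1 c) x y (ckernel2 c x y).
Proof.
move=> n0.
have h : hol cratio x y (cratio x y / (1 - cexp (x +i* y))).
  apply: hol_eq (holM (hol_cexp x y) (holV n0 (hol_1Ncexp x y))) _.
  by rewrite /cratio; field.
apply: hol_eq (holM (holD (hol_cst c%:C x y) h) (hol_ckernel c n0)) _.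
by rewrite /ckernel2 /ckernel1; ring.
Qed.

(** The half angle separates the two ways of leaving the zero at [w = 0], along [x] and
    along [y]. *)
Lemma normc_1Ncexp (x y : R) :
  normc (1 - cexp (x +i* y)) ^+ 2 = (1 - expR x) ^+ 2 + 4 * expR x * sin (y / 2) ^+ 2.
Proof.
rewrite normcE2 sqr_sqrtr ?addr_ge0 ?sqr_ge0 // !(ReD, ImD, ReN, ImN) /cexp /=.
have -> : cos y = 1 - 2 * sin (y / 2) ^+ 2.
  rewrite [in LHS](_ : y = y / 2 + y / 2); last by rewrite -splitr.
  by rewrite cosD -!expr2 cos2sin2; ring.
have -> : sin y = 2 * sin (y / 2) * cos (y / 2).
  rewrite [in LHS](_ : y = y / 2 + y / 2); last by rewrite -splitr.
  by rewrite sinD; ring.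
transitivity ((1 - expR x * (1 - 2 * sin (y / 2) ^+ 2)) ^+ 2 +
  4 * expR x ^+ 2 * sin (y / 2) ^+ 2 * cos (y / 2) ^+ 2); first by ring.
by rewrite cos2sin2; ring.
Qed.

Lemma le_1Ncexp (x y : R) : `|1 - expR x| <= normc (1 - cexp (x +i* y)).
Proof.
rewrite -(@ler_pXn2r _ 2) ?nnegrE ?normc_ge0 // normc_1Ncexp real_normK ?num_real //.
by rewrite lerDl mulr_ge0 ?sqr_ge0 // mulr_ge0 ?expR_ge0.
Qed.

Lemma le_1Ncexp_ray (x m : R) : - cos m * expR x <= normc (1 - cexp (x +i* m)).
Proof.
apply: le_trans (le_trans (ler_norm _) (ler_Re_normc _)).
by rewrite ReD ReN /cexp /= mulNr mulrC lerDr.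
Qed.

Lemma normc_gt0 (z : R[i]) : (0 < normc z) = (z != 0).
Proof. by rewrite lt_neqAle normc_ge0 andbT eq_sym normc_eq0. Qed.

Lemma normc_ckernel (c x y : R) :
  normc (ckernel c x y) = expR (c * x) / normc (1 - cexp (x +i* y)).
Proof. by rewrite normcM normcV normc_cexp ReZ. Qed.

Lemma ckernel1_bound (c u v e x y : R) : u < x < v -> 0 < e ->
  e <= normc (1 - cexp (x +i* y)) ->
  normc (ckernel1 c x y) <=
  (`|c| + expR v / e) * (expR (`|c| * (`|u| + `|v|)) / e).
Proof.
move=> /andP[ux xv] e0 le; have le0 := lt_le_trans e0 le.
rewrite normcM normc_ckernel; apply: ler_pM; rewrite ?normc_ge0 //.
- by rewrite divr_ge0 ?expR_ge0 // ltW.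
- apply: le_trans (le_normcD _ _) _; rewrite normcR lerD2l normcM normcV normc_cexp /=.
  apply: ler_pM; rewrite ?expR_ge0 ?invr_ge0 ?(ltW le0) //; first by rewrite ler_expR ltW.
  by rewrite lef_pV2 ?posrE.
- apply: ler_pM; rewrite ?expR_ge0 ?invr_ge0 ?(ltW le0) //; last by rewrite lef_pV2 ?posrE.
  rewrite ler_expR; apply: le_trans (ler_norm _) _; rewrite normrM ler_wpM2l //.
  rewrite ler_norml; apply/andP; split.
    by have := ler_norm (- u); rewrite normrN; have := normr_ge0 v; lra.
  by have := ler_norm v; have := normr_ge0 u; lra.
Qed.

Lemma Im_ckernel0 (c x : R) : Im (ckernel c x 0) = 0.
Proof.
rewrite /ckernel ImM ImV !(ImD, ImN) /cexp /=.
by rewrite !(mulr0, mul0r, addr0, sin0, oppr0).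
Qed.

Lemma le_ckernel_ray (c m x : R) : cos m < 0 ->
  normc (ckernel c x m) <= (- cos m)^-1 * expR (- ((1 - c) * x)).
Proof.
move=> cm; have cm' : 0 < - cos m by rewrite oppr_gt0.
have -> : (- cos m)^-1 * expR (- ((1 - c) * x)) = expR (c * x) / (- cos m * expR x).
  rewrite invfM mulrC mulrA -expRN -mulrA [X in _ = _ * X]mulrC mulrA -expRD.
  by congr (expR _ * _); ring.
have h := le_1Ncexp_ray x m.
rewrite normc_ckernel ler_wpM2l ?expR_ge0 // lef_pV2 ?posrE //.
  by apply: lt_le_trans h; rewrite mulr_gt0 ?expR_gt0.
by rewrite mulr_gt0 ?expR_gt0.
Qed.

Lemma neq0_1Ncexp_ray (x m : R) : cos m < 0 -> 1 - cexp (x +i* m) != 0.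
Proof.
move=> cm; rewrite -normc_gt0; apply: lt_le_trans (le_1Ncexp_ray x m).
by rewrite mulr_gt0 ?expR_gt0 // oppr_gt0.
Qed.

Lemma integrable_ckernel_ray (c m a : R) : c < 1 -> cos m < 0 ->
  mu.-integrable `[a, +oo[ (EFin \o (fun x => Im (ckernel c x m))).
Proof.
move=> c1 cm; apply: (@integrable_ray _ _ _ (1 - c) (- cos m)^-1).
- by rewrite subr_gt0.
- by move=> x _; exact: continuous_Im_hol (hol_ckernel c (neq0_1Ncexp_ray x cm)).
- by move=> x _; apply: le_trans (ler_Im_normc _) _; exact: le_ckernel_ray.
Qed.

(** The hypothesis on [e] keeps the moving contour away from the pole [w = 0]. *)
Lemma contour_ckernel_shift (c m u v x0 x1 e : R) : c < 1 -> 0 < m -> cos m < 0 ->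
  u < x0 -> x0 <= x1 -> x1 < v -> 0 < e ->
  (forall x, u < x < v -> e <= `|1 - expR x|) ->
  contour m x0 (ckernel c) = contour m x1 (ckernel c).
Proof.
move=> c1 m0 cm ux0 x01 x1v e0 he.
have n0 x y : u < x < v -> e <= normc (1 - cexp (x +i* y)).
  by move=> /he h; apply: le_trans (le_1Ncexp x y).
have hol' x y : u < x < v -> 0 <= y <= m ->
  [/\ hol (ckernel c) x y (ckernel1 c x y), hol (ckernel1 c) x y (ckernel2 c x y) &
    normc (ckernel1 c x y) <=
    (`|c| + expR v / e) * (expR (`|c| * (`|u| + `|v|)) / e)].
  move=> xuv _; have n0' : 1 - cexp (x +i* y) != 0.
    by rewrite -normc_gt0; exact: lt_le_trans e0 (n0 x y xuv).
  split; [exact: hol_ckernel|exact: hol_ckernel1|].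
  exact: ckernel1_bound xuv e0 (n0 x y xuv).
exact: (contour_shift m0 ux0 x01 x1v hol' (fun x _ => Im_ckernel0 c x)
  (integrable_ckernel_ray x0 c1 cm)).
Qed.

End Kernel.

Section Residue.
Context {R : realType}.
Notation mu := (@lebesgue_measure R).

Lemma Rintegral_le_norm (D : set R) (f g : R -> R) : measurable D ->
  mu.-integrable D (EFin \o f) -> mu.-integrable D (EFin \o g) ->
  (forall x, D x -> `|f x| <= g x) ->
  `|\int[mu]_(x in D) f x| <= \int[mu]_(x in D) g x.
Proof.
move=> mD fi gi fg; have K := @le_normr_Rintegral _ _ _ mu D f mD fi.
apply: (le_trans K); apply: le_Rintegral => //.
have H := @integrable_abse _ _ _ mu D (EFin \o f) fi; exact: H.
Qed.

Lemma Rintegral_itv_bound (f : R -> R) (a b M : R) : a <= b ->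
  {in `[a, b], continuous f} -> (forall x, a <= x <= b -> `|f x| <= M) ->
  `|\int[mu]_(x in `[a, b]) f x| <= M * (b - a).
Proof.
move=> ab cf fM.
have -> : M * (b - a) = \int[mu]_(x in `[a, b]) M.
  transitivity (M * b - M * a); first by rewrite mulrBr.
  apply/esym; apply: (FTC2 (f := fun=> M) (F := fun x => M * x)) => // [x _|x _].
    by apply: is_derive_eq; rewrite /GRing.scale /= mulr1.
  exact: cvg_cst.
apply: Rintegral_le_norm => //.
- exact: continuous_itv_integrable.
- by apply: (@continuous_itv_integrable _ (fun=> M)) => y _; exact: cvg_cst.
Qed.

Lemma ckernel_neq0 (x y : R) : x != 0 -> 1 - cexp (x +i* y) != 0.
Proof.
move=> x0; rewrite -normc_gt0; apply: lt_le_trans (le_1Ncexp x y).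
rewrite normr_gt0 subr_eq0 eq_sym; apply: contra_neq x0 => e.
by apply: expR_inj; rewrite e expR0.
Qed.

Lemma continuous_ckernel_y (c x y : R) : 1 - cexp (x +i* y) != 0 ->
  {for y, continuous (fun y => Re (ckernel c x y))}.
Proof. by move=> n0; have [_ h] := hol_ckernel c n0; exact: cder_Re_cont h. Qed.

Lemma near_succn_ge (d : R) : \forall n \near \oo, d <= n.+1%:R.
Proof.
have [k dk] : exists k : nat, d <= k%:R.
  by exists (Num.truncn d).+1; apply: ltW; exact: truncnS_gt.
near=> n; apply: (le_trans dk); rewrite ler_nat ltnW // ltnS.
by near: n; exact: nbhs_infty_ge.
Unshelve. all: by end_near.
Qed.

Lemma cvgr_succn : (n.+1%:R : R) @[n --> \oo] --> +oo.
Proof. by apply/cvgryPge => d; exact: near_succn_ge. Qed.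

(** Far to the right [ckernel c] is of size [e^((c - 1) x)], on the segment as on the ray. *)
Lemma contour_ckernel_cvg0 (c m : R) : c < 1 -> 0 < m -> cos m < 0 ->
  contour m n.+1%:R (ckernel c) @[n --> \oo] --> 0.
Proof.
move=> c1 m0 cm; have d0 : 0 < 1 - c by rewrite subr_gt0.
have cm' : 0 < - cos m by rewrite oppr_gt0.
pose C := 2 * m + (- cos m)^-1 / (1 - c).
have bd (n : nat) : `|contour m n.+1%:R (ckernel c)| <= C * expR (- ((1 - c) * n.+1%:R)).
  rewrite /contour; apply: le_trans (ler_normD _ _) _; rewrite mulrDl; apply: lerD.
    set N : R := n.+1%:R.
    have N1 : 1 <= N by rewrite ler1n.
    have N0 : N != 0 by rewrite pnatr_eq0.
    have e1 : 1 + N <= expR N by exact: expR_ge1Dx.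
    have -> : 2 * m * expR (- ((1 - c) * N)) = (2 * expR (- ((1 - c) * N))) * (m - 0).
      by rewrite subr0; ring.
    apply: Rintegral_itv_bound.
    - exact: ltW.
    - by move=> y _; apply: continuous_ckernel_y; exact: ckernel_neq0.
    - move=> y _; apply: le_trans (ler_Re_normc _) _; rewrite normc_ckernel.
      have h : expR N / 2 <= normc (1 - cexp (N +i* y)).
        apply: le_trans (le_1Ncexp N y); rewrite ltr0_norm; last by lra.
        by move: e1; set e := expR N; lra.
      have h0 : 0 < expR N / 2 by rewrite divr_gt0 ?expR_gt0.
      have -> : 2 * expR (- ((1 - c) * N)) = expR (c * N) / (expR N / 2).
        have -> : - ((1 - c) * N) = c * N - N by ring.
        by rewrite expRD expRN; field; rewrite gt_eqF ?expR_gt0.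
      apply: ler_wpM2l; first exact: expR_ge0.
      by rewrite lef_pV2 ?posrE; [exact: h|exact: lt_le_trans h0 h|exact: h0].
  have -> : (- cos m)^-1 / (1 - c) * expR (- ((1 - c) * n.+1%:R)) =
    \int[mu]_(x in `[n.+1%:R, +oo[) ((- cos m)^-1 * expR (- ((1 - c) * x))).
    rewrite Rintegral_scale //; last exact: integrable_expRN.
    by rewrite Rintegral_expRN // -mulrA; congr (_ * _); rewrite mulrC.
  apply: Rintegral_le_norm => //.
  - exact: integrable_ckernel_ray.
  - exact: integrable_scale (measurable_itv _) (integrable_expRN _ d0).
  - by move=> x _; apply: le_trans (ler_Im_normc _) (le_ckernel_ray _ _ cm).
apply/norm_cvg0P; apply: (@squeeze_cvgr _ _ _ _ (cst 0) (fun n : nat => C * expR (- ((1 - c) * n.+1%:R)))).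
- by apply: nearW => n; rewrite normr_ge0 bd.
- exact: cvg_cst.
- suff : (C * expR (- ((1 - c) * n.+1%:R))) @[n --> \oo] --> C * 0 by rewrite mulr0.
  apply: cvgMl_tmp.
  apply: (@cvg_comp _ _ _ (fun n : nat => n.+1%:R : R) (fun x => expR (- ((1 - c) * x))) \oo +oo%R).
    exact: cvgr_succn.
  exact: cvg_expRN.
Qed.

(** To the right of the pole the contour can be pushed to infinity. *)
Lemma contour_ckernel_pos (c m d : R) : c < 1 -> 0 < m -> cos m < 0 -> 0 < d ->
  contour m d (ckernel c) = 0.
Proof.
move=> c1 m0 cm d0.
have sh (n : nat) : d <= n.+1%:R -> contour m d (ckernel c) = contour m n.+1%:R (ckernel c).
  move=> dn; apply: (@contour_ckernel_shift _ c m (d / 2) (n.+2%:R) d n.+1%:R (expR (d / 2) - 1)) => //.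
  - lra.
  - by rewrite ltr_nat.
  - by rewrite subr_gt0 -expR0 ltr_expR divr_gt0.
  - move=> x /andP[dx _]; rewrite distrC; apply: le_trans (ler_norm _).
    by rewrite lerD2r ler_expR ltW.
have H : contour m n.+1%:R (ckernel c) @[n --> \oo] --> contour m d (ckernel c).
  apply: cvg_near_cst; near=> n; apply/esym/sh.
  by near: n; exact: near_succn_ge.
exact: (cvg_unique _ H (contour_ckernel_cvg0 c1 m0 cm)).
Unshelve. all: by end_near.
Qed.

End Residue.

(** * The residue and the Hankel formula *)

Section Poisson.
Context {R : realType}.
Notation mu := (@lebesgue_measure R).

Lemma expRB1_le (a : R) : `|expR a - 1| <= expR `|a| * `|a|.
Proof.
have [a0|a0] := leP 0 a.
  rewrite !ger0_norm // ?subr_ge0 -?expR0 ?ler_expR // expR0.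
  have : expR a * (1 - a) <= 1.
    rewrite -[leRHS](expRxMexpNx_1 a) ler_wpM2l ?expR_ge0 //.
    exact: expR_ge1Dx.
  by set e := expR a; lra.
have h := expR_ge1Dx a.
have h1 : 1 <= expR `|a| by rewrite -expR0 ler_expR.
have h2 : expR a < 1 by rewrite -expR0 ltr_expR.
rewrite ltr0_norm ?subr_lt0 // (ltr0_norm a0).
rewrite (ltr0_norm a0) in h1.
apply: (@le_trans _ _ (1 * - a)); last by rewrite ler_wpM2r // oppr_ge0 ltW.
by move: h; set e := expR a; lra.
Qed.

Lemma sinB_le (a b : R) : a <= b -> `|sin b - sin a| <= b - a.
Proof.
move=> ab; rewrite -(@FTC2 _ cos sin a b) // => [|x _]; last exact: continuous_cos.
rewrite -[leRHS]mul1r; apply: Rintegral_itv_bound => // [x _|x _].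
  exact: continuous_cos.
by rewrite ler_norml cos_geN1 cos_le1.
Qed.

Lemma norm_sin_le (b : R) : `|sin b| <= `|b|.
Proof.
have [b0|b0] := leP 0 b.
  by have := sinB_le b0; rewrite sin0 !subr0 (ger0_norm b0).
by have := sinB_le (ltW b0); rewrite sin0 !sub0r normrN (ltr0_norm b0).
Qed.

Lemma norm_cosB1_le (b : R) : `|cos b - 1| <= `|b|.
Proof.
have -> : cos b - 1 = - (2 * sin (b / 2) * sin (b / 2)).
  rewrite [in LHS](_ : b = b / 2 + b / 2); last by rewrite -splitr.
  by rewrite cosD -!expr2 cos2sin2; ring.
rewrite normrN !normrM (ger0_norm (ler0n _ 2)).
have h1 : `|sin (b / 2)| <= 1 by rewrite ler_norml sin_geN1 sin_le1.
have h2 : `|sin (b / 2)| <= `|b| / 2.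
  by apply: le_trans (norm_sin_le _) _; rewrite normrM (@ger0_norm _ 2^-1).
apply: (@le_trans _ _ (2 * (`|b| / 2) * 1)); last by lra.
by apply: ler_pM; rewrite ?mulr_ge0 ?normr_ge0 ?ler_wpM2l ?ler0n //.
Qed.

Lemma normc_cexpB1_le (z : R[i]) :
  normc (cexp z - 1) <= expR `|Re z| * (`|Re z| + 2 * `|Im z|).
Proof.
set a := Re z; set b := Im z.
apply: le_trans (normc_leD1 _) _; rewrite !(ReD, ImD, ReN, ImN) /cexp /= -/a -/b.
rewrite subr0.
have ea : expR a <= expR `|a| by rewrite ler_expR ler_norm.
have h1 : `|expR a * cos b - 1| <= expR `|a| * `|b| + expR `|a| * `|a|.
  have -> : expR a * cos b - 1 = expR a * (cos b - 1) + (expR a - 1) by ring.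
  apply: le_trans (ler_normD _ _) _; apply: lerD; last exact: expRB1_le.
  rewrite normrM (ger0_norm (expR_ge0 _)).
  by apply: ler_pM; rewrite ?expR_ge0 ?normr_ge0 ?norm_cosB1_le ?ea.
have h2 : `|expR a * sin b| <= expR `|a| * `|b|.
  rewrite normrM (ger0_norm (expR_ge0 _)).
  by apply: ler_pM; rewrite ?expR_ge0 ?normr_ge0 ?norm_sin_le ?ea.
move: (lerD h1 h2); set e := expR `|a|; set L := _ + _ => hL; apply: le_trans hL _.
by rewrite mulrDr; lra.
Qed.

(** The difference is the integral of [cos t - cos h], nonnegative since cosine decreases. *)
Lemma sin_lower (z h : R) : 0 <= z -> z <= h -> h <= pi -> z * cos h <= sin z.
Proof.
move=> z0 zh hpi; rewrite -subr_ge0.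
have -> : sin z - z * cos h = \int[mu]_(t in `[0, z]) (cos t - cos h).
  apply/esym; rewrite -[RHS]subr0.
  transitivity ((sin z - z * cos h) - (sin 0 - 0 * cos h)); last by rewrite sin0 mul0r !subr0.
  apply: (FTC2 (F := fun t => sin t - t * cos h)) => // [t _|t _].
    apply: is_derive_eq (is_deriveB (is_derive_sin t) (is_deriveM (is_derive_id t 1) (is_derive_cst (cos h) t 1))) _.
    by rewrite /GRing.scale /= mulr0 add0r mulr1.
  by apply: cvgB; [exact: continuous_cos|exact: cvg_cst].
apply: Rintegral_ge0 => t /=; rewrite in_itv /= => /andP[t0 tz].
rewrite subr_ge0; have th := le_trans tz zh.
move: (th); rewrite le_eqVlt => /predU1P[->//|tlh]; apply: ltW.
by rewrite ltr_cos // in_itv /= ?t0 ?(le_trans t0 th) ?(le_trans th).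
Qed.

(** [1 - e^w] has a simple zero at the origin and no other zero in the strip. The factors of
    the constant come from [expR (-1) <= expR x] and from [sin_lower] at [y / 2]. *)
Lemma normc_1Ncexp_lower (m x y : R) : 0 < m < pi -> -1 <= x <= 1 -> 0 <= y <= m ->
  expR (-1) * cos (m / 2) / 2 * (`|x| + `|y|) <= normc (1 - cexp (x +i* y)).
Proof.
move=> /andP[m0 mpi] /andP[x1 x2] /andP[y0 ym].
have k0 : 0 < cos (m / 2).
  by apply: cos_gt0_pihalf; apply/andP; split; have := pi_gt0 R; lra.
have k1 := cos_le1 (m / 2).
have e0 : 0 < expR (-1) :> R by exact: expR_gt0.
have e1 : expR (-1) <= 1 :> R by rewrite -[leRHS]expR0 ler_expR lerN10.
have ex : expR (-1) <= expR x by rewrite ler_expR.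
have h1 : expR (-1) * `|x| <= `|1 - expR x|.
  have [x0|x0] := leP 0 x.
    have h0 : 1 <= expR x by rewrite -expR0 ler_expR.
    rewrite (ger0_norm x0) distrC ger0_norm ?subr_ge0 //.
    have h := expR_ge1Dx x; apply: (@le_trans _ _ (1 * x)); first by rewrite ler_wpM2r.
    by move: h; set e := expR x; lra.
  have h0 : expR x <= 1 by rewrite -[leRHS]expR0 ler_expR ltW.
  rewrite (ltr0_norm x0) ger0_norm ?subr_ge0 //.
  have h3 : expR x * (1 - x) <= 1.
    by rewrite -[leRHS](expRxMexpNx_1 x) ler_wpM2l ?expR_ge0 // expR_ge1Dx.
  have h4 : expR (-1) * - x <= expR x * - x by rewrite ler_wpM2r // oppr_ge0 ltW.
  by move: h3 h4; set e := expR x; set e' := expR (-1); lra.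
have h2 : y / 2 * cos (m / 2) <= sin (y / 2) by apply: sin_lower; lra.
set k := cos (m / 2) in k0 k1 h2 *.
set q := expR (-1) in e0 e1 ex h1 *.
have s0 : 0 <= y / 2 * k by rewrite mulr_ge0 ?divr_ge0 // ltW.
rewrite -(@ler_pXn2r R 2) ?nnegrE ?normc_ge0 //; last first.
  by rewrite mulr_ge0 ?addr_ge0 // divr_ge0 // mulr_ge0 // ltW.
rewrite normc_1Ncexp.
have H1 : (q * `|x|) ^+ 2 <= (1 - expR x) ^+ 2.
  rewrite -[leRHS]real_normK ?num_real //; apply: lerXn2r => //.
  by rewrite nnegrE mulr_ge0 // ltW.
have H2 : (y / 2 * k) ^+ 2 <= sin (y / 2) ^+ 2.
  by apply: lerXn2r => //; rewrite nnegrE // (le_trans s0).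
have H3 : 4 * q * (y / 2 * k) ^+ 2 <= 4 * expR x * sin (y / 2) ^+ 2.
  apply: ler_pM => //; [by rewrite mulr_ge0 // ltW|exact: sqr_ge0|].
  by rewrite ler_pM2l.
apply: le_trans (lerD H1 H3).
rewrite (ger0_norm y0); set X := `|x|.
have X0 : 0 <= X by exact: normr_ge0.
have kk : k ^+ 2 <= 1 by rewrite expr_le1 // ltW.
have -> : (q * X) ^+ 2 + 4 * q * (y / 2 * k) ^+ 2 = q ^+ 2 * X ^+ 2 + q * k ^+ 2 * y ^+ 2 by field.
have -> : (q * k / 2 * (X + y)) ^+ 2 = (q ^+ 2 * k ^+ 2) * ((X + y) ^+ 2 / 4) by field.
have H4 : q ^+ 2 * k ^+ 2 * X ^+ 2 <= q ^+ 2 * X ^+ 2.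
  by rewrite ler_wpM2r ?sqr_ge0 // -[leRHS]mulr1 ler_wpM2l ?sqr_ge0.
have H5 : q ^+ 2 * k ^+ 2 * y ^+ 2 <= q * k ^+ 2 * y ^+ 2.
  rewrite ler_wpM2r ?sqr_ge0 // ler_wpM2r ?sqr_ge0 // expr2 -[leRHS]mulr1.
  by rewrite ler_wpM2l // ltW.
apply: le_trans (lerD H4 H5); rewrite -mulrDr ler_wpM2l //.
  by rewrite mulr_ge0 ?sqr_ge0.
have : 0 <= (X - y) ^+ 2 by exact: sqr_ge0.
by rewrite sqrrB sqrrD; set A := X ^+ 2; set B := y ^+ 2; set C := X * y; have : 0 <= A by [exact: sqr_ge0]; have : 0 <= B by [exact: sqr_ge0]; rewrite !mulr2n; lra.
Qed.

(** The numerator [e^(c w) - 1] of the difference vanishes at the pole, which it cancels. *)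
Lemma ckernelB_bound (c m : R) : 0 < m < pi -> exists C : R, forall x y,
  -1 <= x <= 1 -> 0 < y <= m -> normc (ckernel c x y - ckernel 0 x y) <= C.
Proof.
move=> mpi; have /andP[m0 m1] := mpi.
have k0 : 0 < cos (m / 2).
  by apply: cos_gt0_pihalf; apply/andP; split; have := pi_gt0 R; lra.
set k := expR (-1) * cos (m / 2) / 2.
have kp : 0 < k by rewrite divr_gt0 // mulr_gt0 // expR_gt0.
exists (2 * `|c| * expR `|c| / k) => x y x1 /andP[y0 ym].
have L : k * (`|x| + `|y|) <= normc (1 - cexp (x +i* y)).
  by apply: normc_1Ncexp_lower => //; rewrite ltW.
have s0 : 0 < `|x| + `|y| by rewrite ltr_wpDl // normr_gt0 gt_eqF.
have L0 : 0 < k * (`|x| + `|y|) by rewrite mulr_gt0.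
have -> : ckernel c x y - ckernel 0 x y =
   (cexp (c%:C * (x +i* y)) - 1) / (1 - cexp (x +i* y)).
  by rewrite /ckernel mul0r cexp0 -mulrBl.
rewrite normcM normcV.
have U : normc (cexp (c%:C * (x +i* y)) - 1) <= 2 * `|c| * expR `|c| * (`|x| + `|y|).
  apply: le_trans (normc_cexpB1_le _) _; rewrite ReZ ImZ /= !normrM.
  have h : `|c| * `|x| <= `|c|.
    by rewrite -[leRHS]mulr1 ler_wpM2l // ler_norml.
  have h' : expR (`|c| * `|x|) <= expR `|c| by rewrite ler_expR.
  have -> : 2 * `|c| * expR `|c| * (`|x| + `|y|) = expR `|c| * (2 * `|c| * (`|x| + `|y|)) by ring.
  apply: ler_pM => //.
  have : 0 <= `|c| * `|x| by rewrite mulr_ge0.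
  by rewrite mulrDr -!mulrA; set A := `|c| * `|x|; set B := `|c| * `|y|; lra.
have -> : 2 * `|c| * expR `|c| / k =
    (2 * `|c| * expR `|c| * (`|x| + `|y|)) / (k * (`|x| + `|y|)).
  by field; rewrite !gt_eqF.
apply: ler_pM; [exact: normc_ge0| |exact: U|].
  by rewrite invr_ge0 normc_ge0.
by rewrite lef_pV2 ?posrE; [exact: L|exact: lt_le_trans L0 L|exact: L0].
Qed.

End Poisson.

Section ResidueLimit.
Context {R : realType}.
Notation mu := (@lebesgue_measure R).

(** The right-hand side is the Poisson kernel of the unit disc at radius [expR (- d)]. *)
Lemma poisson_kernelE (d y : R) : d != 0 ->
  Re (ckernel 0 (- d) y) - Re (ckernel 0 d y) =
  (expR d ^+ 2 - 1) / (expR d ^+ 2 - 2 * expR d * cos y + 1).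
Proof.
move=> d0.
have E x : x != 0 -> Re (ckernel 0 x y) = (1 - expR x * cos y) / (expR x ^+ 2 - 2 * expR x * cos y + 1).
  move=> x0; rewrite /ckernel mul0r cexp0 div1r ReV !(ReD, ReN, ImD, ImN) /cexp /=.
  congr (_ / _); rewrite sub0r sqrrN exprMn (sin2cos2 y); ring.
have P x : x != 0 -> expR x ^+ 2 - 2 * expR x * cos y + 1 != 0.
  move=> x0; have := ckernel_neq0 y x0; apply: contra_neq => h.
  apply: eq0_normc; apply/eqP; rewrite -sqrf_eq0 normcE2 sqr_sqrtr ?addr_ge0 ?sqr_ge0 //.
  rewrite !(ReD, ReN, ImD, ImN) /cexp /= sub0r sqrrN exprMn (sin2cos2 y) -h; apply/eqP; ring.
have N0 : - d != 0 by rewrite oppr_eq0.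
rewrite !E // expRN.
have := P _ d0; have := P _ N0; rewrite expRN.
have a0 : expR d != 0 by rewrite gt_eqF ?expR_gt0.
move: a0; set a := expR d => a0 p1 p2.
by field; rewrite p2 a0.
Qed.

(** The antiderivative comes from the half-angle substitution [tan (y / 2)]. *)
Lemma poisson_integral (d m : R) : 0 < d -> 0 < m < pi ->
  \int[mu]_(y in `[0, m]) (Re (ckernel 0 (- d) y) - Re (ckernel 0 d y)) =
  2 * atan ((expR d + 1) / (expR d - 1) * tan (m / 2)).
Proof.
move=> d0 /andP[m0 mpi].
have dn0 : d != 0 by rewrite gt_eqF.
have Nd0 : - d != 0 by rewrite oppr_eq0.
set k := (expR d + 1) / (expR d - 1).
pose G y := 2 * atan (k * tan (y / 2)).
transitivity (G m - G 0); last by rewrite /G mul0r tan0 mulr0 atan0 mulr0 subr0.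
have c0 (y : R) : 0 <= y <= m -> 0 < cos (y / 2).
  move=> /andP[y0 ym]; apply: cos_gt0_pihalf; apply/andP; split; have := pi_gt0 R; lra.
apply: FTC2; first exact: ltW.
  move=> y; rewrite in_itv /= => ym.
  have cy := c0 y ym; have cyn : cos (y / 2) != 0 by rewrite gt_eqF.
  have d1 : is_derive y 1 (fun y : R => y / 2) (2^-1).
    by apply: is_derive_eq; rewrite /GRing.scale /=; ring.
  have d2 := @is_derive1_comp _ tan (fun y : R => y / 2) y _ _ (is_derive_tan cyn) d1.
  have d3 := is_deriveZ k d2.
  have d4 := @is_derive1_comp _ atan (fun y : R => k * tan (y / 2)) y _ _ (is_derive1_atan (k * tan (y / 2))) d3.
  apply: is_derive_eq (is_deriveZ 2 d4) _.
  rewrite poisson_kernelE // /GRing.scale /= /tan.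
  have -> : cos y = cos (y / 2) ^+ 2 - sin (y / 2) ^+ 2.
    by rewrite [in LHS](splitr y) cosD -!expr2.
  have e1 : expR d - 1 != 0.
    by rewrite subr_eq0 gt_eqF // -expR0 ltr_expR.
  have s1 : sin (y / 2) ^+ 2 = 1 - cos (y / 2) ^+ 2 by rewrite sin2cos2.
  rewrite /k; move: cyn e1 s1.
  set a := expR d; set C := cos (y / 2); set S := sin (y / 2) => C0 a1 s1.
  have Dp : (a - 1) ^+ 2 * C ^+ 2 + (a + 1) ^+ 2 * S ^+ 2 != 0.
    apply/lt0r_neq0/ltr_wpDr; first by rewrite mulr_ge0 ?sqr_ge0.
    by rewrite -exprMn lt_neqAle eq_sym sqr_ge0 sqrf_eq0 mulf_eq0 negb_or a1 C0.
  transitivity ((a ^+ 2 - 1) / ((a - 1) ^+ 2 * C ^+ 2 + (a + 1) ^+ 2 * S ^+ 2)).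
    by field; rewrite a1 C0 !exprMn Dp.
  by congr (_ / _); rewrite s1; ring.
move=> y _; apply: cvgB; apply: continuous_ckernel_y; exact: ckernel_neq0.
Qed.

(** The slope in front of [tan (m / 2)] tends to infinity with [n]: the Poisson kernel
    concentrates at [y = 0], and half of its mass [2 pi] lies on the side [y > 0]. *)
Lemma poisson_limit (m : R) : 0 < m < pi ->
  2 * atan ((expR n.+1%:R^-1 + 1) / (expR n.+1%:R^-1 - 1) * tan (m / 2)) @[n --> \oo] --> (pi : R).
Proof.
move=> /andP[m0 mpi].
have T0 : 0 < tan (m / 2).
  rewrite divr_gt0 //.
    by apply: sin_gt0_pi; apply/andP; split; have := pi_gt0 R; lra.
  by apply: cos_gt0_pihalf; apply/andP; split; have := pi_gt0 R; lra.
suff : 2 * atan ((expR n.+1%:R^-1 + 1) / (expR n.+1%:R^-1 - 1) * tan (m / 2)) @[n --> \oo] --> 2 * (pi / 2 : R).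
  by rewrite mulrCA divff // mulr1.
apply: cvgMl_tmp.
apply: (@cvg_comp _ _ _ (fun n : nat => (expR n.+1%:R^-1 + 1) / (expR n.+1%:R^-1 - 1) * tan (m / 2)) atan \oo +oo%R); last exact: cvgy_atan.
apply/cvgryPge => A; near=> n.
set d : R := n.+1%:R^-1.
have d0 : 0 < d by rewrite invr_gt0.
have d1 : d <= 1 by rewrite invf_le1 // ler1n.
have e0 : 0 < expR d - 1 by rewrite subr_gt0 -expR0 ltr_expR.
have E0 : 0 < expR 1 :> R by exact: expR_gt0.
have h : expR d - 1 <= expR 1 * d.
  have := expRB1_le d; rewrite (gtr0_norm d0) (gtr0_norm e0).
  move=> h; apply: (le_trans h); rewrite ler_wpM2r ?(ltW d0) //.
  by rewrite ler_expR.
have h2 : (expR 1 * d)^-1 <= (expR d + 1) / (expR d - 1).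
  apply: (@le_trans _ _ (expR d - 1)^-1).
    by rewrite lef_pV2 ?posrE ?mulr_gt0.
  rewrite -[leLHS]mul1r ler_wpM2r ?invr_ge0 ?(ltW e0) //.
  by rewrite lerDr expR_ge0.
have h3 : A * expR 1 / tan (m / 2) <= n.+1%:R by near: n; exact: near_succn_ge.
apply: (@le_trans _ _ ((expR 1 * d)^-1 * tan (m / 2))); last by rewrite ler_wpM2r // ltW.
by rewrite invfM /d invrK mulrAC -mulrA ler_pdivlMl // (mulrC _ A) [tan _ * _]mulrC -ler_pdivrMr.
Unshelve. all: by end_near.
Qed.

Lemma neq0_1Ncexp_strip (m x y : R) : 0 < m < pi -> -1 <= x <= 1 -> 0 < y <= m ->
  1 - cexp (x +i* y) != 0.
Proof.
move=> mpi x1 /andP[y0 ym].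
have k0 : 0 < cos (m / 2).
  have /andP[m0 m1] := mpi.
  by apply: cos_gt0_pihalf; apply/andP; split; have := pi_gt0 R; lra.
have y0m : 0 <= y <= m by rewrite ltW.
have h := normc_1Ncexp_lower mpi x1 y0m.
rewrite -normc_gt0; apply: lt_le_trans h; apply: mulr_gt0.
  by apply: divr_gt0; [apply: mulr_gt0; [exact: expR_gt0|exact: k0]|exact: ltr0n].
by apply: ltr_wpDl; [exact: normr_ge0|rewrite normr_gt0 gt_eqF].
Qed.

(** Near the pole the kernel differs from [1 / (1 - e^w)] by a bounded function that is
    continuous across [x = 0], so that only the Poisson kernel contributes to the jump. *)
Lemma ckernel_jump (c m : R) : 0 < m < pi ->
  \int[mu]_(y in `[0, m])
    (Re (ckernel c (- n.+1%:R^-1) y) - Re (ckernel c n.+1%:R^-1 y)) @[n --> \oo] --> (pi : R).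
Proof.
move=> mpi; have /andP[m0 _] := mpi.
pose r (x y : R) := Re (ckernel c x y) - Re (ckernel 0 x y).
have [C hC] := ckernelB_bound c mpi.
have dn (n : nat) : (n.+1%:R^-1 : R) != 0 by rewrite invr_eq0 pnatr_eq0.
have dn' (n : nat) : (- n.+1%:R^-1 : R) != 0 by rewrite oppr_eq0.
have bd (n : nat) : -1 <= (n.+1%:R^-1 : R) <= 1.
  by rewrite invf_le1 ?ler1n // andbT (le_trans _ (_ : 0 <= _)) ?lerN10 // invr_ge0.
have bd' (n : nat) : -1 <= - (n.+1%:R^-1 : R) <= 1.
  by have /andP[h1 h2] := bd n; rewrite lerN2 h2 lerNl.
have rC x y : -1 <= x <= 1 -> 0 < y <= m -> `|r x y| <= C.
  move=> x1 ym; apply: le_trans (hC x y x1 ym).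
  by rewrite /r -ReN -ReD; exact: ler_Re_normc.
have cr x y : x != 0 -> {for y, continuous (r x)}.
  by move=> x0; apply: cvgB; apply: continuous_ckernel_y; exact: ckernel_neq0.
have ci c' x : x != 0 -> mu.-integrable `[0, m] (EFin \o (fun y => Re (ckernel c' x y))).
  by move=> x0; apply: continuous_itv_integrable => y _; apply: continuous_ckernel_y; exact: ckernel_neq0.
pose F n y := r (- n.+1%:R^-1) y - r n.+1%:R^-1 y.
have cF n : continuous (F n).
  by move=> y; apply: cvgB; exact: cr.
have lim0 : \int[mu]_(y in `]0, m]) F n y @[n --> \oo] --> (0 : R).
  suff : \int[mu]_(y in `]0, m]) F n y @[n --> \oo] --> \int[mu]_(y in `]0, m]) (0 : R).
    by rewrite Rintegral_cst // mul0r.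
  apply: (@cvg_Rintegral_dominated R `]0, m] F (fun=> 0) (fun=> 2 * C) (measurable_itv _)).
  - by move=> n; apply: measurable_funTS; exact: continuous_measurable_fun (cF n).
  - move=> y; rewrite /= in_itv /= => /andP[y0 ym].
    have n0 : 1 - cexp (0 +i* y) != 0.
      apply: (neq0_1Ncexp_strip mpi); last by rewrite y0 ym.
      by rewrite lerN10 ler01.
    have c1 := @continuous_Re_hol R (ckernel c) (ckernel1 c) y 0 (hol_ckernel c n0).
    have c2 := @continuous_Re_hol R (ckernel 0) (ckernel1 0) y 0 (hol_ckernel 0 n0).
    have cr0 : r x y @[x --> 0] --> r 0 y by exact: cvgB c1 c2.
    have ch : (n.+1%:R^-1 : R) @[n --> \oo] --> (0 : R) by exact: cvg_harmonic.
    have ch' : (- n.+1%:R^-1 : R) @[n --> \oo] --> (0 : R).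
      by have h := cvgN ch; rewrite oppr0 in h; exact: h.
    have l1 : r (- n.+1%:R^-1) y @[n --> \oo] --> r 0 y.
      exact: (@cvg_comp _ _ _ (fun n : nat => - n.+1%:R^-1 : R) (r ^~ y) \oo (nbhs 0) _ ch' cr0).
    have l2 : r n.+1%:R^-1 y @[n --> \oo] --> r 0 y.
      exact: (@cvg_comp _ _ _ (fun n : nat => n.+1%:R^-1 : R) (r ^~ y) \oo (nbhs 0) _ ch cr0).
    by have h := cvgB l1 l2; rewrite subrr in h; exact: h.
  - have h : mu.-integrable `[0, m] (EFin \o (fun=> 2 * C)).
      by apply: (@continuous_itv_integrable _ (fun=> 2 * C)) => x _; exact: cvg_cst.
    by apply: integrableS h => //; exact: subset_itv_oc_cc.
  - move=> n y; rewrite /= in_itv /= => ym.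
    apply: le_trans (ler_normB _ _) _.
    by rewrite mulr_natl mulr2n; apply: lerD; apply: rC.
have E (n : nat) : \int[mu]_(y in `[0, m]) (Re (ckernel c (- n.+1%:R^-1) y) - Re (ckernel c n.+1%:R^-1 y)) =
    2 * atan ((expR n.+1%:R^-1 + 1) / (expR n.+1%:R^-1 - 1) * tan (m / 2)) +
    \int[mu]_(y in `]0, m]) F n y.
  rewrite -poisson_integral ?invr_gt0 //.
  rewrite Rintegral_itv_obnd_cbnd; last first.
    have h : mu.-integrable `[0, m] (EFin \o F n) by apply: continuous_itv_integrable => x _; exact: cF.
    by apply: integrableS h => //; exact: subset_itv_oc_cc.
  rewrite -Rintegral_add //.
  - by apply: eq_Rintegral => y _; rewrite /F /r; ring.
  - by apply: continuous_itv_integrable => y _; apply: cvgB; apply: continuous_ckernel_y; exact: ckernel_neq0.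
  - by apply: continuous_itv_integrable => y _; exact: cF.
under eq_cvg do rewrite E.
have h := cvgD (poisson_limit mpi) lim0; rewrite addr0 in h; exact: h.
Qed.

Lemma contour_ckernel_neg_shift (c m x0 x1 : R) : c < 1 -> 0 < m -> cos m < 0 ->
  x0 < 0 -> x1 < 0 -> contour m x0 (ckernel c) = contour m x1 (ckernel c).
Proof.
move=> c1 m0 cm; wlog x01 : x0 x1 / x0 <= x1.
  move=> h p0 p1; have [/h|/ltW/h] := leP x0 x1; first exact.
  by move=> ->.
move=> x00 x10.
have e0 : 0 < 1 - expR (x1 / 2) by rewrite subr_gt0 -[ltRHS]expR0 ltr_expR; lra.
apply: (@contour_ckernel_shift _ c m (x0 - 1) (x1 / 2) x0 x1 _ c1 m0 cm _ x01 _ e0); [lra|lra|].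
move=> x /andP[_ xx]; apply: le_trans (ler_norm _).
by rewrite lerD2l lerN2 ler_expR ltW.
Qed.

(** From the right of the pole, where the contour integral is [0], to its left, the integral
    changes by the jump of the segment, of limit [pi], and by the part of the ray above
    [[-d, d]], of limit [0]. *)
Lemma contour_ckernel (c m x0 : R) : c < 1 -> 0 < m < pi -> cos m < 0 -> x0 < 0 ->
  contour m x0 (ckernel c) = pi.
Proof.
move=> c1 mpi cm x00; have /andP[m0 _] := mpi.
have cm' : 0 < - cos m by rewrite oppr_gt0.
pose V x := Im (ckernel c x m).
have cV : continuous V.
  by move=> x; exact: continuous_Im_hol (hol_ckernel c (neq0_1Ncexp_ray x cm)).
have iV a : mu.-integrable `[a, +oo[ (EFin \o V) by exact: integrable_ckernel_ray.
pose K := (- cos m)^-1 * expR (1 - c).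
have VK x : -1 <= x -> `|V x| <= K.
  move=> x1; apply: le_trans (ler_Im_normc _) _.
  apply: le_trans (le_ckernel_ray c x cm) _.
  apply: ler_wpM2l; first by rewrite invr_ge0 ltW.
  rewrite ler_expR -mulrN -[leRHS]mulr1 ler_wpM2l //; first by rewrite subr_ge0 ltW.
  lra.
have E (n : nat) : contour m x0 (ckernel c) =
    \int[mu]_(y in `[0, m]) (Re (ckernel c (- n.+1%:R^-1) y) - Re (ckernel c n.+1%:R^-1 y))
    + \int[mu]_(x in `[- n.+1%:R^-1, n.+1%:R^-1]) V x.
  set d : R := n.+1%:R^-1.
  have d0 : 0 < d by rewrite invr_gt0.
  have Nd0 : - d < 0 by rewrite oppr_lt0.
  have ci x : x != 0 -> mu.-integrable `[0, m] (EFin \o (fun y => Re (ckernel c x y))).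
    by move=> x0'; apply: continuous_itv_integrable => y _; apply: continuous_ckernel_y; exact: ckernel_neq0.
  have := contour_ckernel_pos c1 m0 cm d0.
  rewrite (contour_ckernel_neg_shift c1 m0 cm x00 Nd0) /contour.
  have dd : - d <= d by apply: le_trans (ltW d0); exact: ltW.
  rewrite (Rintegral_splitcy dd (iV _)).
  have -> : \int[mu]_(y in `[0, m]) (Re (ckernel c (- d) y) - Re (ckernel c d y)) =
    \int[mu]_(y in `[0, m]) Re (ckernel c (- d) y) - \int[mu]_(y in `[0, m]) Re (ckernel c d y).
    have i1 := ci _ (ltr0_neq0 Nd0); have i2 := ci _ (lt0r_neq0 d0).
    have H := @RintegralB _ _ _ mu _ _ _ (measurable_itv _) i1 i2; exact: H.
  set a := Rintegral _ _ _; set b := Rintegral _ _ _.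
  rewrite -/V.
  set e := Rintegral _ _ _; set f := Rintegral _ _ _; lra.
have lim : contour m x0 (ckernel c) @[n --> \oo] --> (pi + 0 : R).
  under eq_cvg => n do rewrite (E n).
  apply: cvgD; first exact: ckernel_jump.
  have ch : (K * (2 * n.+1%:R^-1) : R) @[n --> \oo] --> (0 : R).
    suff : (K * (2 * n.+1%:R^-1) : R) @[n --> \oo] --> K * (2 * 0) by rewrite !mulr0.
    by apply: cvgMl_tmp; apply: cvgMl_tmp; exact: cvg_harmonic.
  apply/norm_cvg0P; apply: (@squeeze_cvgr _ _ _ _ (cst 0) (fun n : nat => K * (2 * n.+1%:R^-1)) _ _ _ _ ch).
    apply: nearW => n; apply/andP; split; first exact: normr_ge0.
    have d0 : 0 < (n.+1%:R^-1 : R) by rewrite invr_gt0.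
    have d1 : (n.+1%:R^-1 : R) <= 1 by rewrite invf_le1 // ler1n.
    have -> : 2 * n.+1%:R^-1 = n.+1%:R^-1 - - n.+1%:R^-1 :> R by rewrite opprK mulr_natl mulr2n.
    apply: Rintegral_itv_bound; [by rewrite (le_trans _ (ltW d0)) // oppr_le0 ltW|by move=> x _; exact: cV|].
    by move=> x /andP[h _]; apply: VK; apply: le_trans h; rewrite lerN2.
  exact: cvg_cst.
rewrite -[RHS]addr0.
exact: (cvg_unique _ (cvg_cst _) lim).
Qed.

(** By scaling, [t ^ (s - 1) * contour m x0 (hankel 1 (1 - s))] is the contour integral of
    [hankel t (1 - s)], whose Laplace integral is [pi] by [laplace_contour] and
    [contour_ckernel]. *)
Theorem Gamma_hankel (s m x0 : R) : 0 < s -> 0 < m < pi -> cos m < 0 ->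
  Gamma s * contour m x0 (hankel 1 (1 - s)) = pi.
Proof.
move=> s0 mpi cm; have /andP[m0 _] := mpi.
have c1 : 1 - s < 1 by rewrite ltrBlDr ltrDl.
rewrite (@contour_hankel_shift R 1 (1 - s) m x0 (-1)) //.
have [i q] := laplace_contour c1 m0 cm (ltrN10 R).
rewrite contour_ckernel ?ltrN10 // in q.
set H := contour m (-1) (hankel 1 (1 - s)).
pose phi t : R := t `^ (s - 1) * expR (- t).
have E t : `]0, +oo[%classic t -> expR (- t) * contour m (-1) (hankel t (1 - s)) = H * phi t.
  rewrite /= in_itv /= andbT => t0; rewrite contour_hankel_scale // -/H /phi opprB.
  by rewrite mulrA mulrC; congr (_ * _); rewrite mulrC.
have q' : \int[mu]_(t in `]0, +oo[) (H * phi t) = pi.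
  by rewrite -q; apply: eq_Rintegral => t /set_mem /E.
(* The Gamma integrand is integrable because its multiple by [H] is. *)
have H0 : H != 0.
  apply/eqP => H0; have := pi_gt0 R; rewrite -q' H0.
  rewrite (_ : (fun t => 0 * phi t) = (fun=> 0)); last by apply/funext => t; rewrite mul0r.
  by rewrite Rintegral_cst // mul0r ltxx.
have ip : mu.-integrable `]0, +oo[ (EFin \o phi).
  have i' := integrable_scale H^-1 (measurable_itv _) i.
  apply: integrable_eq (measurable_itv _) _ i' => t t0.
  by rewrite E // mulKf.
by rewrite -q' (Rintegral_scale _ (measurable_itv _) ip) mulrC.
Qed.

End ResidueLimit.

(** * Mittag-Leffler functions as contour integrals *)

Section MittagLefflerKernel.
Context {R : realType}.
Notation mu := (@lebesgue_measure R).

Definition mlden (A y x t : R) : R[i] := cexp (A%:C * (x +i* t)) + y%:C.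
(** For [w = log z], the integrand [e^z z^(A - b) / (z^A + y) dz]. *)
Definition mlk (A b y x t : R) : R[i] := hankel 1 (1 - b + A) x t / mlden A y x t.
Definition mlr (A y x t : R) : R[i] := cexp (A%:C * (x +i* t)) / mlden A y x t.
Definition mlk1 (A b y x t : R) : R[i] :=
  (cexp (x +i* t) + (1 - b + A)%:C - A%:C * mlr A y x t) * mlk A b y x t.
Definition mlr1 (A y x t : R) : R[i] := A%:C * mlr A y x t * (y%:C / mlden A y x t).
Definition mlk2 (A b y x t : R) : R[i] :=
  (cexp (x +i* t) - A%:C * mlr1 A y x t +
   (cexp (x +i* t) + (1 - b + A)%:C - A%:C * mlr A y x t) ^+ 2) * mlk A b y x t.

Arguments mlden : simpl never.
Arguments mlk : simpl never.

Lemma hol_mlden (A y x t : R) :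
  hol (mlden A y) x t (A%:C * cexp (A%:C * (x +i* t))).
Proof.
apply: hol_eq (holD (hol_exp (holZ A%:C (hol_id x t))) (hol_cst y%:C x t)) _.
by rewrite addr0 mulr1.
Qed.

Lemma hol_mlk (A b y x t : R) : mlden A y x t != 0 ->
  hol (mlk A b y) x t (mlk1 A b y x t).
Proof.
move=> n0; apply: hol_eq (holM (hol_hankel 1 (1 - b + A) x t) (holV n0 (hol_mlden A y x t))) _.
by rewrite /mlk1 /mlk /mlr /hankel1; field.
Qed.

Lemma hol_mlk1 (A b y x t : R) : mlden A y x t != 0 ->
  hol (mlk1 A b y) x t (mlk2 A b y x t).
Proof.
move=> n0.
have hr : hol (mlr A y) x t (mlr1 A y x t).
  apply: hol_eq (holM (hol_exp (holZ A%:C (hol_id x t))) (holV n0 (hol_mlden A y x t))) _.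
  rewrite /mlr1 /mlr.
  have -> : y%:C = mlden A y x t - cexp (A%:C * (x +i* t)) by rewrite /mlden addrC addKr.
  by field.
have h1 := holD (holD (hol_cexp x t) (hol_cst (1 - b + A)%:C x t)) (holZ (- A%:C) hr).
have h2 := holM h1 (hol_mlk b n0).
rewrite /mlk1; have E : (fun x t => (cexp (x +i* t) + (1 - b + A)%:C - A%:C * mlr A y x t) * mlk A b y x t) =
  (fun x t => (cexp (x +i* t) + (1 - b + A)%:C + - A%:C * mlr A y x t) * mlk A b y x t).
  by apply/funext => u; apply/funext => v; rewrite mulNr.
rewrite E; apply: hol_eq h2 _; rewrite /mlk2 /mlk1; ring.
Qed.

Section Sector.
Variables (A m : R).
Hypotheses (A0 : 0 < A) (m0 : 0 < m) (Am : A * m < pi) (cm : cos m < 0).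

(** The cosine of [A m / 2] divided by [sqrt 2], positive as long as [A m < pi]. *)
Definition sect := Num.sqrt ((1 + cos (A * m)) / 4).

Lemma sect_gt0 : 0 < sect.
Proof.
rewrite sqrtr_gt0 divr_gt0 // -ltrBlDl sub0r -cospi ltr_cos // in_itv /= ?lexx ?pi_ge0 //.
by rewrite mulr_ge0 ?ltW.
Qed.

(** The vectors [z^A] and [y] make an angle of at most [A m < pi] and cannot cancel. *)
Lemma mlden_lower (y x t : R) : 0 <= y -> 0 <= t <= m ->
  sect * (expR (A * x) + y) <= normc (mlden A y x t).
Proof.
move=> y0 /andP[t0 tm]; set r := expR (A * x).
have r0 : 0 < r by exact: expR_gt0.
have hc : cos (A * m) <= cos (A * t).
  have: A * t <= A * m by rewrite ler_pM2l.
  rewrite le_eqVlt => /predU1P[->//|h]; apply: ltW.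
  have At : 0 <= A * t by rewrite mulr_ge0 // ltW.
  by rewrite ltr_cos // in_itv /= ?At ?(ltW (lt_trans h Am)) ?(le_trans At (ltW h)) ?(ltW Am).
have k1 : cos (A * m) <= 1 by exact: cos_le1.
have k2 : -1 <= cos (A * m) by exact: cos_geN1.
rewrite normcE2 /mlden !(ReD, ImD) /cexp /= !(mul0r, subr0, addr0) -/r.
have -> : r + y = Num.sqrt ((r + y) ^+ 2).
  by rewrite sqrtr_sqr ger0_norm // addr_ge0 // ltW.
rewrite /sect -sqrtrM; last by rewrite divr_ge0 //; lra.
apply: ler_wsqrtr.
have -> : (r * cos (A * t) + y) ^+ 2 + (r * sin (A * t)) ^+ 2 =
   r ^+ 2 + y ^+ 2 + 2 * (r * y) * cos (A * t).
  by rewrite exprMn sin2cos2; ring.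
have ry : 0 <= r * y by rewrite mulr_ge0 // ltW.
have h : 2 * (r * y) * cos (A * m) <= 2 * (r * y) * cos (A * t).
  by rewrite ler_wpM2l // mulr_ge0.
apply: (@le_trans _ _ (r ^+ 2 + y ^+ 2 + 2 * (r * y) * cos (A * m))); last by rewrite lerD2l.
set k := cos (A * m) in k1 k2 h *.
rewrite -subr_ge0.
have -> : r ^+ 2 + y ^+ 2 + 2 * (r * y) * k - (1 + k) / 4 * (r + y) ^+ 2 =
  (3 - k) / 4 * (r - y) ^+ 2 + (1 + k) * (r * y) by field.
by rewrite addr_ge0 // mulr_ge0 ?sqr_ge0 //; lra.
Qed.

Lemma mlden_gt0 (y x t : R) : 0 <= y -> 0 <= t <= m ->
  0 < sect * (expR (A * x) + y).
Proof.
by move=> y0 _; apply: mulr_gt0; [exact: sect_gt0|apply: ltr_pwDl => //; exact: expR_gt0].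
Qed.

Lemma mlden_neq0 (y x t : R) : 0 <= y -> 0 <= t <= m -> mlden A y x t != 0.
Proof.
move=> y0 tm; rewrite -normc_gt0.
exact: lt_le_trans (mlden_gt0 x y0 tm) (mlden_lower x y0 tm).
Qed.

Lemma normc_mlk_le (b y x t : R) : 0 <= y -> 0 <= t <= m ->
  normc (mlk A b y x t) <=
  expR (expR x * cos t + (1 - b + A) * x) / (sect * (expR (A * x) + y)).
Proof.
move=> y0 tm; rewrite normcM normcV normc_hankel mul1r.
apply: ler_wpM2l; first exact: expR_ge0.
have h := mlden_lower x y0 tm; have p := mlden_gt0 x y0 tm.
by rewrite lef_pV2 ?posrE; [exact: h|exact: lt_le_trans p h|exact: p].
Qed.

Lemma mlk1_bound (b y u v x t : R) : 0 <= y -> 0 <= t <= m -> u < x < v ->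
  normc (mlk1 A b y x t) <= (expR v + `|1 - b + A| + A / sect) *
    (expR (expR v + `|1 - b + A| * (`|u| + `|v|)) / (sect * expR (A * u))).
Proof.
move=> y0 tm /andP[ux xv]; set c := 1 - b + A.
have s0 := sect_gt0.
have h := mlden_lower x y0 tm; have p := mlden_gt0 x y0 tm.
rewrite /mlk1 -/c normcM; apply: ler_pM; try exact: normc_ge0.
  apply: le_trans (le_normcD _ _) _; rewrite normcN; apply: lerD.
    apply: le_trans (le_normcD _ _) _; rewrite normcR normc_cexp /= lerD2r.
    by rewrite ler_expR ltW.
  rewrite normcM normcR (gtr0_norm A0) ler_pM2l // normcM normcV normc_cexp ReZ /=.
  rewrite ler_pdivrMr; last exact: lt_le_trans p h.
  rewrite -ler_pdivrMl ?invr_gt0 // invrK; apply: le_trans h.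
  by rewrite ler_pM2l // lerDl.
apply: le_trans (normc_mlk_le b x y0 tm) _.
apply: ler_pM; [exact: expR_ge0|by rewrite invr_ge0 ltW| |].
  rewrite ler_expR; apply: lerD.
    apply: (@le_trans _ _ (expR x * 1)).
      by apply: ler_wpM2l; [exact: expR_ge0|exact: cos_le1].
    by rewrite mulr1 ler_expR ltW.
  apply: le_trans (ler_norm _) _; rewrite normrM -/c ler_wpM2l //.
  rewrite ler_norml; apply/andP; split.
    by have := ler_norm (- u); rewrite normrN; have := normr_ge0 v; lra.
  by have := ler_norm v; have := normr_ge0 u; lra.
rewrite lef_pV2 ?posrE; [|exact: p|by apply: mulr_gt0; [exact: s0|exact: expR_gt0]].
rewrite ler_pM2l //; apply: (@le_trans _ _ (expR (A * x))); last by rewrite lerDl.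
by rewrite ler_expR ler_pM2l // ltW.
Qed.

Lemma Im_mlk0 (b y x : R) : Im (mlk A b y x 0) = 0.
Proof.
rewrite /mlk ImM ImV Im_hankel0 /mlden !ImD /cexp /=.
by rewrite !(mulr0, mul0r, addr0, sin0, oppr0).
Qed.

Lemma arc_end : 0 <= m <= m. Proof. by rewrite lexx ltW. Qed.

(** On the ray [cos m < 0] makes [e^z] decay doubly exponentially. The constant [C] is
    uniform in [y], so that the decay in [y] of the denominator is kept. *)
Lemma mlk_decay (b a : R) : exists C, forall y x, 0 <= y -> a <= x ->
  normc (mlk A b y x m) <= expR C / (sect * (expR (A * a) + y)) * expR (- (1 * x)).
Proof.
have cm' : 0 < - cos m by rewrite oppr_gt0.
have [C hC] := superexp_decay (1 - b + A) a cm'.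
exists C => y x y0 ax; apply: le_trans (normc_mlk_le b x y0 arc_end) _.
have p := mlden_gt0 a y0 arc_end; have p' := mlden_gt0 x y0 arc_end.
rewrite mulrAC -expRD; apply: ler_pM; [exact: expR_ge0|by rewrite invr_ge0 ltW| |].
  by rewrite ler_expR mul1r; move: (hC x ax); set e := expR x; lra.
rewrite lef_pV2 ?posrE; [|exact: p'|exact: p].
by rewrite ler_pM2l ?sect_gt0 // lerD2r ler_expR ler_pM2l.
Qed.

Lemma integrable_mlk_ray (b y a : R) : 0 <= y ->
  mu.-integrable `[a, +oo[ (EFin \o (fun x => Im (mlk A b y x m))).
Proof.
move=> y0; have [C hC] := mlk_decay b a.
apply: (@integrable_ray _ _ _ 1 (expR C / (sect * (expR (A * a) + y)))) => //.
- by move=> x _; exact: continuous_Im_hol (hol_mlk b (mlden_neq0 x y0 arc_end)).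
- by move=> x ax; apply: le_trans (ler_Im_normc _) _; exact: hC.
Qed.

Lemma continuous_mlk_arc (b y x : R) : 0 <= y ->
  {in `[0, m], continuous (fun t => Re (mlk A b y x t))}.
Proof.
move=> y0 t; rewrite in_itv /= => tm.
have [_ h] := hol_mlk b (mlden_neq0 x y0 tm); exact: cder_Re_cont h.
Qed.

Lemma contour_mlk_shift (b y x0 x1 : R) : 0 <= y -> x0 <= x1 ->
  contour m x0 (mlk A b y) = contour m x1 (mlk A b y).
Proof.
move=> y0 x01; pose u := x0 - 1; pose v := x1 + 1.
have ux : u < x0 by rewrite /u; lra.
have xv : x1 < v by rewrite /v; lra.
have h x t : u < x < v -> 0 <= t <= m ->
  [/\ hol (mlk A b y) x t (mlk1 A b y x t), hol (mlk1 A b y) x t (mlk2 A b y x t) &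
    normc (mlk1 A b y x t) <= (expR v + `|1 - b + A| + A / sect) *
    (expR (expR v + `|1 - b + A| * (`|u| + `|v|)) / (sect * expR (A * u)))].
  move=> xuv tm; have n0 := mlden_neq0 x y0 tm.
  by split; [exact: hol_mlk|exact: hol_mlk1|exact: mlk1_bound].
exact: (contour_shift m0 ux x01 xv h (fun x _ => Im_mlk0 b y x) (integrable_mlk_ray b x0 y0)).
Qed.

Lemma contour_bound (f : R -> R -> R[i]) (x0 M K : R) :
  {in `[0, m], continuous (fun t => Re (f x0 t))} ->
  mu.-integrable `[x0, +oo[ (EFin \o (fun x => Im (f x m))) ->
  (forall t, 0 <= t <= m -> normc (f x0 t) <= M) ->
  (forall x, x0 <= x -> normc (f x m) <= K * expR (- (1 * x))) ->
  `|contour m x0 f| <= M * m + K * expR (- x0).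
Proof.
move=> cf fi fM fK; apply: le_trans (ler_normD _ _) _; apply: lerD.
  have -> : M * m = M * (m - 0) by rewrite subr0.
  apply: Rintegral_itv_bound => //; first exact: ltW.
  by move=> t tm; apply: le_trans (ler_Re_normc _) _; exact: fM.
have -> : K * expR (- x0) = \int[mu]_(x in `[x0, +oo[) (K * expR (- (1 * x))).
  rewrite Rintegral_scale //; last exact: integrable_expRN.
  by rewrite Rintegral_expRN // divr1 mul1r.
apply: Rintegral_le_norm => //.
  by apply: integrable_scale => //; exact: integrable_expRN.
move=> x; rewrite /= in_itv /= andbT => xx.
by apply: le_trans (ler_Im_normc _) _; exact: fK.
Qed.

(** [z^A / (z^A + y) = 1 - y / (z^A + y)]. In terms of series this is
    [E_(A,b)(-y) = 1 / Gamma b - y E_(A,b+A)(-y)]. *)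
Lemma contour_mlk_rec (b y x0 : R) : 0 <= y ->
  contour m x0 (mlk A b y) =
  contour m x0 (hankel 1 (1 - b)) - y * contour m x0 (mlk A (b + A) y).
Proof.
move=> y0.
have E x t : 0 <= t <= m ->
    mlk A b y x t = hankel 1 (1 - b) x t + (- y)%:C * mlk A (b + A) y x t.
  move=> tm; have n0 := mlden_neq0 x y0 tm.
  have E1 : hankel 1 (1 - b + A) x t = hankel 1 (1 - b) x t * cexp (A%:C * (x +i* t)).
    rewrite /hankel -cexpD; congr cexp.
    by apply: eqRI; rewrite !(ReD, ImD, ReZ, ImZ) /=; ring.
  have E2 : mlk A (b + A) y x t = hankel 1 (1 - b) x t / mlden A y x t.
    have bA : 1 - (b + A) + A = 1 - b by ring.
    by rewrite /mlk bA.
  have E0 : mlk A b y x t = hankel 1 (1 - b) x t * cexp (A%:C * (x +i* t)) / mlden A y x t.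
    by rewrite -E1.
  apply: (etrans E0); rewrite E2.
  have E3 : cexp (A%:C * (x +i* t)) = mlden A y x t - y%:C by rewrite /mlden addrK.
  have NY : (- y)%:C = - y%:C :> R[i] by rewrite (rmorphN (real_complex R)).
  rewrite E3 NY; move: n0.
  set h := hankel _ _ _ _; set d := mlden _ _ _ _ => n0.
  rewrite mulNr mulrA mulrBr mulrBl mulfK //; congr (_ - _).
  by rewrite [h * _]mulrC -mulrA.
have i1 : mu.-integrable `[0, m] (EFin \o (fun t => Re (hankel 1 (1 - b) x0 t))).
  apply: continuous_itv_integrable => t _.
  have [_ h] := hol_hankel 1 (1 - b) x0 t; exact: cder_Re_cont h.
have i2 : mu.-integrable `[0, m] (EFin \o (fun t => Re (mlk A (b + A) y x0 t))).
  by apply: continuous_itv_integrable; exact: continuous_mlk_arc.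
have i3 := integrable_hankel_ray (1 - b) x0 ltr01 cm.
have i4 := integrable_mlk_ray (b + A) x0 y0.
have mI (i : interval R) := measurable_itv i.
have q1 : \int[mu]_(t in `[0, m]) Re (mlk A b y x0 t) =
   \int[mu]_(t in `[0, m]) Re (hankel 1 (1 - b) x0 t) +
   - y * \int[mu]_(t in `[0, m]) Re (mlk A (b + A) y x0 t).
  rewrite -(Rintegral_scale _ (mI _) i2) -(Rintegral_add (mI _) i1 (integrable_scale _ (mI _) i2)).
  apply: eq_Rintegral => t /set_mem t01.
  have tm : 0 <= t <= m by move: t01; rewrite /= in_itv.
  by rewrite E // ReD ReZ.
have q2 : \int[mu]_(x in `[x0, +oo[) Im (mlk A b y x m) =
   \int[mu]_(x in `[x0, +oo[) Im (hankel 1 (1 - b) x m) +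
   - y * \int[mu]_(x in `[x0, +oo[) Im (mlk A (b + A) y x m).
  rewrite -(Rintegral_scale _ (mI _) i4) -(Rintegral_add (mI _) i3 (integrable_scale _ (mI _) i4)).
  apply: eq_Rintegral => x _.
  by rewrite E ?arc_end // ImD ImZ.
by rewrite /contour q1 q2; ring.
Qed.

End Sector.
End MittagLefflerKernel.
Arguments mlden : simpl never.
Arguments mlk : simpl never.

(** * Decay of the Mittag-Leffler function on the imaginary axis *)

Section RealAxis.
Context {R : realType}.
Variables (A m : R).
Hypotheses (A0 : 0 < A) (m0 : 0 < m) (mpi : m < pi) (Am : A * m < pi) (cm : cos m < 0).

Lemma Gamma_neq0 (s : R) : 0 < s -> Gamma s != 0.
Proof.
move=> s0; have mm' : 0 < m < pi by rewrite m0.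
have h := Gamma_hankel 0 s0 mm' cm.
by apply/eqP => G0; have := pi_gt0 R; rewrite -h G0 mul0r ltxx.
Qed.

Lemma contour_hankelE (s x0 : R) : 0 < s ->
  contour m x0 (hankel 1 (1 - s)) = pi / Gamma s.
Proof.
move=> s0; have mm' : 0 < m < pi by rewrite m0.
by rewrite -(Gamma_hankel x0 s0 mm' cm) mulrC mulKf // Gamma_neq0.
Qed.

(** By [ml_sum_cvg], [pi] times [E_(A,b)(-y)]. *)
Definition mlJ (b y : R) : R := contour m 0 (mlk A b y).

(** Iterate [contour_mlk_rec]. *)
Lemma ml_partial (b y : R) (n : nat) : 0 < b -> 0 <= y ->
  \sum_(k < n) (- y) ^+ k / Gamma (A * k%:R + b) =
  (mlJ b y - (- y) ^+ n * mlJ (A * n%:R + b) y) / pi.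
Proof.
move=> b0 y0; have p0 : (pi : R) != 0 by rewrite gt_eqF ?pi_gt0.
elim: n => [|n IH].
  by rewrite big_ord0 expr0 mul1r mulr0 add0r subrr mul0r.
rewrite big_ord_recr /= IH.
set s := A * n%:R + b.
have s0 : 0 < s by rewrite ltr_wpDl // mulr_ge0 // ltW.
have -> : A * n.+1%:R + b = s + A by rewrite /s -natr1; ring.
have -> : mlJ s y = pi / Gamma s - y * mlJ (s + A) y.
  by rewrite /mlJ (contour_mlk_rec A0 m0 Am cm s 0 y0) contour_hankelE.
rewrite exprS; move: p0 (Gamma_neq0 s0).
by move: (pi : R) (Gamma s) => p g p0 g0; field; rewrite p0.
Qed.

Lemma normc_mlk_shift (b y x t : R) (n : nat) :
  normc (mlk A (A * n%:R + b) y x t) = expR (- (A * n%:R * x)) * normc (mlk A b y x t).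
Proof.
have n1 c : normc (mlk A c y x t) = expR (1 * (expR x * cos t) + (1 - c + A) * x) / normc (mlden A y x t).
  by rewrite normcM normcV normc_hankel.
rewrite !n1 [RHS]mulrA -expRD.
have -> : 1 * (expR x * cos t) + (1 - (A * n%:R + b) + A) * x =
  - (A * n%:R * x) + (1 * (expR x * cos t) + (1 - b + A) * x) by ring.
by [].
Qed.

(** At abscissa [x] the modulus of the kernel of index [A n + b] is [e^(-A n x)] times that of
    index [b]. On a contour far enough to the right this beats [y^n]. *)
Lemma ml_tail (b y : R) : 0 <= y ->
  (- y) ^+ n * mlJ (A * n%:R + b) y @[n --> \oo] --> 0.
Proof.
(* The abscissa where [e^(A X) = 1 + 2 y], so that [y e^(-A X) <= 1 / 2]. *)
move=> y0; pose X := ln (1 + 2 * y) / A.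
have y1 : 0 < 1 + 2 * y by lra.
have X0 : 0 <= X by rewrite divr_ge0 ?ln_ge0 ?(ltW A0) //; lra.
have eX : expR (A * X) = 1 + 2 * y by rewrite /X mulrC mulfVK ?gt_eqF // lnK.
have [C hC] := mlk_decay A0 m0 Am cm b X.
pose K := expR C / (sect A m * (expR (A * X) + y)).
have {}hC x : X <= x -> normc (mlk A b y x m) <= K * expR (- (1 * x)) by exact: hC.
pose M := expR (expR X + (1 - b + A) * X) / (sect A m * (expR (A * X) + y)).
have hM t : 0 <= t <= m -> normc (mlk A b y X t) <= M.
  move=> tm; apply: le_trans (normc_mlk_le A0 m0 Am b X y0 tm) _.
  have p := mlden_gt0 A0 m0 Am X y0 tm.
  apply: ler_wpM2r; first by rewrite invr_ge0 ltW.
  rewrite ler_expR lerD2r -[leRHS]mulr1.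
  by apply: ler_wpM2l; [exact: expR_ge0|exact: cos_le1].
have s0 := sect_gt0 A0 m0 Am.
pose e n := expR (- (A * n%:R * X)).
have bd n : `|mlJ (A * n%:R + b) y| <= e n * (M * m + K * expR (- X)).
  rewrite /mlJ (contour_mlk_shift A0 m0 Am cm (A * n%:R + b) y0 X0).
  rewrite mulrDr mulrA [e n * (K * _)]mulrA.
  have e0 : 0 <= e n by exact: expR_ge0.
  apply: contour_bound => //.
  - exact: continuous_mlk_arc.
  - exact: integrable_mlk_ray.
  - by move=> t tm; rewrite normc_mlk_shift; apply: ler_wpM2l => //; exact: hM.
  - move=> x Xx; rewrite normc_mlk_shift -[leRHS]mulrA; apply: ler_pM.
    + exact: expR_ge0.
    + exact: normc_ge0.
    + rewrite /e ler_expR lerN2; apply: ler_wpM2l => //.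
      by rewrite mulr_ge0 // ltW.
    + exact: hC.
set D := M * m + _ in bd.
have q1 : y / (1 + 2 * y) <= 1 / 2 by rewrite ler_pdivrMr //; lra.
have q0 : 0 <= y / (1 + 2 * y) by rewrite divr_ge0 // ltW.
have en n : y ^+ n * e n = (y / (1 + 2 * y)) ^+ n.
  rewrite /e expr_div_n -eX -expRM_natl expRN; congr (_ / expR _); ring.
have cg : (y / (1 + 2 * y)) ^+ n * D @[n --> \oo] --> 0.
  have h : (y / (1 + 2 * y)) ^+ n @[n --> \oo] --> 0.
    by apply: cvg_expr; rewrite ger0_norm //; apply: le_lt_trans q1 _; lra.
  suff : (y / (1 + 2 * y)) ^+ n * D @[n --> \oo] --> 0 * D by rewrite mul0r.
  exact: cvgMr_tmp.
apply/norm_cvg0P; apply: (@squeeze_cvgr _ _ _ _ (cst 0) (fun n => (y / (1 + 2 * y)) ^+ n * D)).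
- apply: nearW => n; rewrite normr_ge0 /= normrM normrX normrN (ger0_norm y0).
  rewrite -en -mulrA; apply: ler_wpM2l; first exact: exprn_ge0.
  exact: bd.
- exact: cvg_cst.
- exact: cg.
Qed.

(** On the contour at abscissa [0] the denominator is at least [sect A m * (1 + y)]. *)
Lemma mlJ_bound (b : R) : exists C, forall y, 0 <= y -> `|mlJ b y| <= C / (1 + y).
Proof.
have [C hC] := mlk_decay A0 m0 Am cm b 0.
have s0 := sect_gt0 A0 m0 Am.
exists ((expR 1 * m + expR C) / sect A m) => y y0.
have y1 : 0 < 1 + y by lra.
have sn : sect A m != 0 by rewrite gt_eqF.
have yn : 1 + y != 0 by rewrite gt_eqF.
have -> : (expR 1 * m + expR C) / sect A m / (1 + y) =
  expR 1 / (sect A m * (1 + y)) * m + expR C / (sect A m * (1 + y)) * expR (- 0).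
  by rewrite oppr0 expR0; field; rewrite yn sn.
apply: contour_bound => //.
- exact: continuous_mlk_arc.
- exact: integrable_mlk_ray.
- move=> t tm; apply: le_trans (normc_mlk_le A0 m0 Am b 0 y0 tm) _.
  rewrite !mulr0 !expR0 mul1r addr0.
  apply: ler_wpM2r; first by rewrite invr_ge0 mulr_ge0 ?ltW.
  by rewrite ler_expR; exact: cos_le1.
- move=> x x0; have := hC y x y0 x0; by rewrite mulr0 expR0.
Qed.

Lemma ml_sum_cvg (b y : R) : 0 < b -> 0 <= y ->
  \sum_(k < n) (- y) ^+ k / Gamma (A * k%:R + b) @[n --> \oo] --> mlJ b y / pi.
Proof.
move=> b0 y0; under eq_cvg => n do rewrite ml_partial //.
have h := cvgB (cvg_cst (mlJ b y)) (ml_tail b y0).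
by rewrite subr0 in h; apply: cvgMr_tmp; exact: h.
Qed.

End RealAxis.

Section ImaginaryAxis.
Context {R : realType}.

Lemma cvg_complex (u : nat -> R[i]) (l : R[i]) :
  Re (u n) @[n --> \oo] --> Re l -> Im (u n) @[n --> \oo] --> Im l ->
  (u : nat -> R[i]^o) n @[n --> \oo] --> (l : R[i]^o).
Proof.
move=> /cvgrPdist_lt h1 /cvgrPdist_lt h2; apply/cvgrPdist_lt => -[e e'].
rewrite ltcE /= => /andP[/eqP -> e0]; near=> n.
rewrite complexr0 normc_def ltcR -normcE2.
apply: le_lt_trans (normc_leD1 _) _; rewrite !(ReD, ImD, ReN, ImN) (splitr e).
by apply: ltrD; near: n; [apply: h1|apply: h2]; rewrite divr_gt0.
Unshelve. all: by end_near.
Qed.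

Lemma imag_pow (t : R) (j : nat) :
  ('i%C * t%:C) ^+ j.*2 = ((- (t ^+ 2)) ^+ j)%:C :> R[i].
Proof.
have E : ('i%C * t%:C) ^+ 2 = (- (t ^+ 2))%:C :> R[i].
  by apply: eqRI; rewrite expr2 /=; ring.
by rewrite -muln2 mulnC exprM E (rmorphXn (real_complex R)).
Qed.

(** Even powers of [i t] are real and odd ones imaginary. *)
Lemma imag_series (g e o : nat -> R) (t : R) (n : nat) :
  (forall k, g k.*2 = e k) -> (forall k, g k.*2.+1 = o k) ->
  \sum_(k < n) ('i%C * t%:C) ^+ k * (g k)%:C =
  (\sum_(k < uphalf n) (- t ^+ 2) ^+ k * e k) +i*
  (t * \sum_(k < n./2) (- t ^+ 2) ^+ k * o k).
Proof.
move=> ge go; elim: n => [|n IH]; first by rewrite !big_ord0 mulr0.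
rewrite big_ord_recr /= IH.
have [j [b ->]] : exists j, exists b : bool, n = (b + j.*2)%N.
  by exists n./2, (odd n); rewrite odd_double_half.
case: b; last first.
  rewrite add0n uphalf_double /= doubleK big_ord_recr /= imag_pow -(rmorphM (real_complex R)) ge.
  by apply: eqRI => /=; rewrite ?addr0 ?uphalf_double.
have E : ('i%C * t%:C) ^+ (1 + j.*2) * (g (1 + j.*2)%N)%:C =
    0 +i* (t * ((- t ^+ 2) ^+ j * o j)) :> R[i].
  rewrite -go add1n exprS imag_pow; set a := _ ^+ j.
  by apply: eqRI => /=; ring.
rewrite E.
apply: eqRI => /=; rewrite ?addr0 ?uphalf_double ?doubleK //.
by rewrite -mulrDr big_ord_recr.
Qed.

Lemma ml_series (alpha beta t : R) (n : nat) :
  \sum_(k < n) (('i%C * t%:C) ^+ k / (Gamma (alpha * k%:R + beta))%:C : R[i]) =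
  (\sum_(k < uphalf n) (- t ^+ 2) ^+ k / Gamma (2 * alpha * k%:R + beta)) +i*
  (t * \sum_(k < n./2) (- t ^+ 2) ^+ k / Gamma (2 * alpha * k%:R + (alpha + beta))).
Proof.
under eq_bigr => k _ do rewrite -(fmorphV (real_complex R)).
apply: (@imag_series (fun k => (Gamma (alpha * k%:R + beta))^-1)
  (fun k => (Gamma (2 * alpha * k%:R + beta))^-1)
  (fun k => (Gamma (2 * alpha * k%:R + (alpha + beta)))^-1)) => k.
  by rewrite (_ : alpha * _ + _ = 2 * alpha * k%:R + beta) // -muln2 natrM; ring.
rewrite (_ : alpha * _ + _ = 2 * alpha * k%:R + (alpha + beta)) //.
by rewrite -natr1 -muln2 natrM; ring.
Qed.

(** [E_(alpha,beta)(i t) = E_(2 alpha,beta)(-t^2) + i t E_(2 alpha,alpha+beta)(-t^2)], where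
    both functions on the right are [O(1 / (1 + t^2))] by [mlJ_bound]. *)
Theorem mittag_leffler_imag (alpha beta : R) : 0 < alpha -> alpha < 1 -> 0 < beta ->
  exists2 C, 0 < C & forall t : R,
    normc (mittag_leffler alpha beta ('i%C * t%:C)) <= C / (1 + `|t|).
Proof.
move=> a0 a1 b0; have p0 := pi_gt0 R.
(* An angle between [pi / 2] and the smaller of [pi] and [pi / (2 alpha)]. *)
pose A := 2 * alpha; pose m : R := pi / (1 + alpha).
have A0 : 0 < A by rewrite mulr_gt0.
have a1' : 0 < 1 + alpha by lra.
have m0 : 0 < m by rewrite divr_gt0.
have mpi : m < pi by rewrite ltr_pdivrMr // ltr_pMr //; lra.
have Am : A * m < pi.
  by rewrite /m mulrA ltr_pdivrMr // mulrC ltr_pM2l // /A; lra.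
have m2 : pi / 2 < m by rewrite /m ltr_pM2l // ltf_pV2 ?posrE //; lra.
have cm : cos m < 0.
  rewrite -(subrK (pi / 2) m) cosDpihalf oppr_lt0.
  by apply: sin_gt0_pi; apply/andP; split; lra.
have [C1 h1] := mlJ_bound A0 m0 Am cm beta.
have [C2 h2] := mlJ_bound A0 m0 Am cm (alpha + beta).
exists (2 * (`|C1| + `|C2| + 1) / pi).
  by rewrite divr_gt0 // mulr_gt0 // ltr_wpDl // addr_ge0.
move=> t; pose y := t ^+ 2; have y0 : 0 <= y by exact: sqr_ge0.
have ab0 : 0 < alpha + beta by rewrite addr_gt0.
pose L : R[i] := (mlJ A m beta y / pi) +i* (t * (mlJ A m (alpha + beta) y / pi)).
have -> : mittag_leffler alpha beta ('i%C * t%:C) = L.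
  rewrite /mittag_leffler; apply: (@cvg_lim R[i]^o) => //; rewrite seriesEord.
  have up : uphalf n @[n --> \oo] --> \oo.
    apply/cvgnyPge => k; exists k.*2 => // n /= kn.
    by rewrite geq_uphalf_double; exact: leq_trans kn (leqnSn n).
  have dn : n./2 @[n --> \oo] --> \oo.
    by apply/cvgnyPge => k; exists k.*2 => // n /= kn; rewrite geq_half_double.
  have s1 := ml_sum_cvg A0 m0 mpi Am cm b0 y0.
  have s2 := ml_sum_cvg A0 m0 mpi Am cm ab0 y0.
  apply: cvg_complex.
    under eq_cvg => n do rewrite ml_series [Re _]/=.
    exact: (@cvg_comp _ _ _ uphalf
      (fun n => \sum_(k < n) (- y) ^+ k / Gamma (A * k%:R + beta)) _ _ _ up s1).
  under eq_cvg => n do rewrite ml_series [Im _]/=.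
  rewrite [Im L]/=; apply: cvgMl_tmp.
  exact: (@cvg_comp _ _ _ half
    (fun n => \sum_(k < n) (- y) ^+ k / Gamma (A * k%:R + (alpha + beta))) _ _ _ dn s2).
have ya : y = `|t| ^+ 2 by rewrite real_normK ?num_real.
have T0 : 0 <= `|t| by exact: normr_ge0.
have y1 : 0 < 1 + y by lra.
have g1 := h1 y y0; have g2 := h2 y y0.
apply: le_trans (normc_leD1 _) _; rewrite /L /= !normrM (gtr0_norm (_ : 0 < pi^-1)) ?invr_gt0 //.
have k1 : `|mlJ A m beta y| <= `|C1| / (1 + y).
  by apply: (le_trans g1); rewrite ler_wpM2r ?invr_ge0 ?(ltW y1) // ler_norm.
have k2 : `|mlJ A m (alpha + beta) y| <= `|C2| / (1 + y).
  by apply: (le_trans g2); rewrite ler_wpM2r ?invr_ge0 ?(ltW y1) // ler_norm.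
set J1 := `|mlJ A m beta y| in k1 *; set J2 := `|mlJ A m _ y| in k2 *.
have c1 : 0 <= `|C1| by []; have c2 : 0 <= `|C2| by [].
have T1 : 0 < 1 + `|t| by lra.
rewrite mulrA -mulrDl mulrAC ler_pM2r ?invr_gt0 //.
apply: (@le_trans _ _ ((`|C1| + `|t| * `|C2|) / (1 + y))).
  by rewrite mulrDl -mulrA; apply: lerD => //; rewrite ler_wpM2l.
rewrite ler_pdivlMr // mulrAC ler_pdivrMr //.
set T := `|t| in ya T0 T1 *; rewrite ya.
have q : T <= (1 + T ^+ 2) / 2.
  have : 0 <= (T - 1) ^+ 2 by exact: sqr_ge0.
  by rewrite sqrrB1 mulr2n; set S := T ^+ 2; lra.
have q1 : 1 + T <= 2 * (1 + T ^+ 2) by move: q; have := sqr_ge0 T; set S := T ^+ 2; lra.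
have q2 : T * (1 + T) <= 2 * (1 + T ^+ 2).
  by rewrite mulrDr mulr1 -expr2; move: q; have := sqr_ge0 T; set S := T ^+ 2; lra.
have w0 : 0 <= 1 + T ^+ 2 by rewrite addr_ge0 ?sqr_ge0.
have e1 : `|C1| * (1 + T) <= `|C1| * (2 * (1 + T ^+ 2)) by rewrite ler_wpM2l.
have e2 : `|C2| * (T * (1 + T)) <= `|C2| * (2 * (1 + T ^+ 2)) by rewrite ler_wpM2l.
rewrite (_ : (_ + _) * _ = `|C1| * (1 + T) + `|C2| * (T * (1 + T))); last by ring.
apply: le_trans (lerD e1 e2) _.
rewrite (_ : 2 * _ * _ = `|C1| * (2 * (1 + T ^+ 2)) + `|C2| * (2 * (1 + T ^+ 2)) + 2 * (1 + T ^+ 2)); last by ring.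
by rewrite lerDl mulr_ge0.
Unshelve. all: by end_near.
Qed.

End ImaginaryAxis.

(** * Cube-root weights *)

Section CubeRootWeight.
Context {R : realType}.
Notation mu := (@lebesgue_measure R).

Lemma cvg_expn (f : R -> R) (x l : R) (n : nat) : f t @[t --> x] --> l ->
  f t ^+ n @[t --> x] --> l ^+ n.
Proof.
move=> fl; elim: n => [|n IH]; first by rewrite expr0; exact: cvg_cst.
by rewrite exprS; under eq_cvg do rewrite exprS; exact: cvgM.
Qed.

Definition cbrt (x : R) : R := `|x| `^ 3^-1.

Lemma cbrt_ge0 x : 0 <= cbrt x. Proof. exact: powR_ge0. Qed.
Lemma cbrtK x : cbrt x ^+ 3 = `|x|.
Proof.
rewrite -powR_mulrn ?cbrt_ge0 // /cbrt -powRrM mulVf ?pnatr_eq0 //.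
by rewrite powRr1.
Qed.
Lemma cbrt_gt0 x : x != 0 -> 0 < cbrt x.
Proof. by move=> x0; rewrite powR_gt0 // normr_gt0. Qed.
Lemma cbrt0 : cbrt 0 = 0.
Proof. by rewrite /cbrt normr0 powR0 // invr_neq0 // pnatr_eq0. Qed.
Lemma cbrtN x : cbrt (- x) = cbrt x. Proof. by rewrite /cbrt normrN. Qed.

Lemma measurable_cbrt : measurable_fun setT cbrt.
Proof.
exact: (measurableT_comp (@measurable_powR R 3^-1) (@normr_measurable R setT)).
Qed.

(** The cube of [weight] is comparable to [|x|] near [0] and to [x^2] at infinity, as is a
    product of two linear factors, one of which vanishes at [0]. In this form its power
    [-2/3] has an elementary antiderivative. *)
Definition weight (x : R) : R := cbrt x * (1 + cbrt x).

Lemma weight_ge0 x : 0 <= weight x.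
Proof. by rewrite mulr_ge0 ?addr_ge0 ?cbrt_ge0. Qed.

Lemma weight_gt0 x : x != 0 -> 0 < weight x.
Proof. by move=> x0; rewrite mulr_gt0 ?cbrt_gt0 // ltr_pwDl ?cbrt_ge0. Qed.

Lemma weightN x : weight (- x) = weight x. Proof. by rewrite /weight cbrtN. Qed.

Lemma measurable_weight : measurable_fun setT weight.
Proof.
apply: measurable_funM; first exact: measurable_cbrt.
by apply: measurable_funD => //; exact: measurable_cbrt.
Qed.

Lemma measurable_weight2 : measurable_fun setT (fun x => (weight x ^+ 2)^-1).
Proof.
have -> : (fun x => (weight x ^+ 2)^-1) = (fun x => weight x `^ (- 2%:R)).
  by apply/funext => x; rewrite powR_invn // weight_ge0.
exact: (measurableT_comp (@measurable_powR R (- 2%:R)) measurable_weight).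
Qed.

Lemma is_derive_weight (x : R) : 0 < x ->
  is_derive x 1 (fun x => - 3 / (1 + x `^ 3^-1)) ((weight x ^+ 2)^-1).
Proof.
move=> x0; have d1 := @is_derive1_powR R 3^-1 x x0.
have p0 : 0 < x `^ 3^-1 by rewrite powR_gt0.
have d2 := is_deriveD (is_derive_cst (1 : R) x 1) d1.
have n0 : (cst 1 + (@powR R) ^~ 3^-1) x != 0 :> R by rewrite fctE /= gt_eqF // ltr_pwDl // ltW.
have d3 := is_deriveZ (- 3) (is_deriveV n0 d2).
apply: is_derive_eq d3 _.
rewrite /GRing.scale /= fctE /= add0r /weight /cbrt (gtr0_norm x0).
have -> : x `^ (3^-1 - 1) = (x `^ 3^-1 ^+ 2)^-1.
  rewrite -powR_mulrn ?powR_ge0 // -powRrM -powRN; congr (_ `^ _); by field.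
set u := x `^ 3^-1 in p0 *.
have u1 : 1 + u != 0 by rewrite gt_eqF // ltr_pwDl // ltW.
by field; rewrite u1 gt_eqF.
Qed.

Lemma weight2_int_pos :
  (\int[mu]_(x in `]0%R, +oo[) ((weight x ^+ 2)^-1)%:E <= 3%:E)%E.
Proof.
pose F (n : nat) : set R := `[n.+1%:R^-1, n.+1%:R]%classic.
have p n : 0 < (n.+1%:R^-1 : R) by rewrite invr_gt0.
have -> : `]0, +oo[%classic = \bigcup_n F n :> set R.
  apply/seteqP; split => x /=.
    rewrite in_itv /= andbT => x0.
    pose n := Num.truncn (Num.max x x^-1).
    have := truncnS_gt (Num.max x x^-1); rewrite -/n gt_max => /andP[h1 h2].
    exists n => //=; rewrite /F /= in_itv /= (ltW h1) andbT.
    by rewrite -[leRHS]invrK lef_pV2 ?posrE ?invr_gt0 // ltW.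
  by move=> [n _]; rewrite /F /= !in_itv /= andbT => /andP[+ _]; apply: lt_le_trans.
have nd : nondecreasing_seq F.
  move=> n k nk; rewrite subsetEset => x; rewrite /F /= !in_itv /= => /andP[h1 h2].
  apply/andP; split.
    by apply: le_trans h1; rewrite lef_pV2 ?posrE // ler_nat ltnS.
  by apply: le_trans h2 _; rewrite ler_nat ltnS.
have mw : measurable_fun setT (fun x => ((weight x ^+ 2)^-1)%:E).
  by apply/measurable_EFinP; exact: measurable_weight2.
have H := @ge0_nondecreasing_set_cvg_integral _ (measurableTypeR R) R F (fun x => ((weight x ^+ 2)^-1)%:E) mu nd
  (fun n => measurable_itv _) (fun n => measurable_funTS mw).
have {}H : (\int[mu]_(x in F n) ((weight x ^+ 2)^-1)%:E)%E @[n --> \oo] -->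
   (\int[mu]_(x in \bigcup_n F n) ((weight x ^+ 2)^-1)%:E)%E.
  by apply: H => n x _; rewrite lee_fin invr_ge0 sqr_ge0.
rewrite -(cvg_lim _ H) //; apply: lime_le; first by apply/cvg_ex; eexists; exact: H.
apply: nearW => n; rewrite /F.
have cw : {in `[n.+1%:R^-1, n.+1%:R], continuous (fun x => (weight x ^+ 2)^-1)}.
  move=> x; rewrite in_itv /= => /andP[+ _] => h.
  have x0 : 0 < x := lt_le_trans (p n) h.
  have c1 : cbrt t @[t --> x] --> cbrt x.
    apply: (@continuous_comp _ _ _ (fun t : R => `|t|) ((@powR R) ^~ 3^-1)).
      exact: norm_continuous.
    apply: is_derive_continuous (is_derive1_powR 3^-1 _).
    by rewrite normr_gt0 gt_eqF.
  have c2 : weight t @[t --> x] --> weight x.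
    by apply: cvgM => //; apply: cvgD => //; exact: cvg_cst.
  apply: cvgV; first by rewrite expf_neq0 // gt_eqF // weight_gt0 // gt_eqF.
  exact: cvg_expn.
have iw := continuous_itv_integrable cw.
rewrite -[leLHS]fineK ?integrable_fin_num // lee_fin -/(Rintegral _ _ _).
have le_n : (n.+1%:R^-1 : R) <= n.+1%:R by rewrite (@le_trans _ _ 1) ?invf_le1 ?ler1n.
rewrite (@FTC2 _ _ (fun x => - 3 / (1 + x `^ 3^-1)) _ _ le_n _ cw); last first.
  move=> x; rewrite in_itv /= => /andP[h _]; apply: is_derive_weight.
  exact: lt_le_trans (p n) h.
have q (x : R) : 0 <= 3 / (1 + x `^ 3^-1) <= 3.
  have u0 : 0 <= x `^ 3^-1 by exact: powR_ge0.
  rewrite divr_ge0 ?addr_ge0 //= ler_pdivrMr ?ltr_pwDl //.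
  by rewrite mulrDr mulr1 lerDl mulr_ge0.
have /andP[q1 q2] := q n.+1%:R; have /andP[q3 q4] := q n.+1%:R^-1.
by rewrite !mulNr opprK; move: q1 q2 q3 q4; set A := 3 / _; set B := 3 / _; lra.
Qed.

Lemma weight2_int :
  (\int[mu]_x ((weight x ^+ 2)^-1)%:E <= 6%:E)%E.
Proof.
pose f x := ((weight x ^+ 2)^-1)%:E.
pose g := f \_ `]0, +oo[.
have f0 x : (0 <= f x)%E by rewrite lee_fin invr_ge0 sqr_ge0.
have mf : measurable_fun setT f by apply/measurable_EFinP; exact: measurable_weight2.
have mg : measurable_fun setT g by apply/(measurable_restrictT f) => //; exact: measurable_funTS.
have g0 x : (0 <= g x)%E by rewrite /g patchE; case: ifP.
have E x : f x = (g x + g (- 1 * x + 0)%R)%E.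
  rewrite mulN1r addr0 /g !patchE !mem_setE !in_itv /= !andbT oppr_gt0.
  have [x0|x0|<-] := ltrgtP 0 x.
  - by rewrite adde0.
  - by rewrite add0e /f weightN.
  - by rewrite adde0 /f /weight cbrt0 mul0r expr0n invr0.
have n1 : (- 1 : R) != 0 by rewrite oppr_eq0 oner_eq0.
have -> : (\int[mu]_x f x = \int[mu]_x (g x + g (- 1 * x + 0)%R))%E by apply: eq_integral => x _.
rewrite ge0_integralD //; last first.
  apply: (measurableT_comp mg).
  by apply: measurable_funD => //; exact: measurable_funM.
have := ge0_integral_affine 0 n1 mg g0; rewrite normrN1 mul1e => <-.
have -> : (\int[mu]_x g x = \int[mu]_(x in `]0%R, +oo[) f x)%E by rewrite [RHS]integral_mkcond.
have -> : (6 : R) = 3 + 3 by lra.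
by rewrite EFinD; apply: leeD; exact: weight2_int_pos.
Qed.

(** The value [+oo] at the origin cannot be left to the convention [0^-1 = 0], since [inner]
    is infinite at a real root of the form. *)
Definition wker (x : R) : \bar R := if x == 0 then +oo%E else ((weight x ^+ 2)^-1)%:E.

Lemma wker_ge0 x : (0 <= wker x)%E.
Proof. by rewrite /wker; case: ifP => // _; rewrite lee_fin invr_ge0 sqr_ge0. Qed.

Lemma measurable_wker : measurable_fun setT wker.
Proof.
apply: measurable_fun_ifT => //.
- by apply: measurable_fun_eqr => //; exact: measurable_id.
- by apply/measurable_EFinP; exact: measurable_weight2.
Qed.

Lemma wker_int : (\int[mu]_x wker x <= 6%:E)%E.
Proof.
apply: le_trans weight2_int; rewrite le_eqVlt; apply/predU1P; left.
apply: ge0_ae_eq_integral => //.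
- exact: measurable_wker.
- by apply/measurable_EFinP; exact: measurable_weight2.
- by move=> x _; exact: wker_ge0.
- by move=> x _; rewrite lee_fin invr_ge0 sqr_ge0.
- exists [set 0]; split => //; first exact: lebesgue_measure_set1.
  move=> x /= h; apply/eqP; apply: contra_notT h => x0 _.
  by rewrite /wker (negbTE x0).
Qed.

Lemma wker_affine_int (x0 d : R) : 0 < d ->
  (\int[mu]_t wker ((t - x0) / d)%R <= (6 * d)%:E)%E.
Proof.
move=> d0; have dn : d != 0 by rewrite gt_eqF.
have dn' : d^-1 != 0 by rewrite invr_eq0.
have := ge0_integral_affine (- x0 / d) dn' measurable_wker wker_ge0.
have -> : (\int[mu]_x wker (d^-1 * x + - x0 / d)%R = \int[mu]_t wker ((t - x0) / d)%R)%E.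
  by apply: eq_integral => t _; congr wker; by field.
set I := (\int[mu]_t wker ((t - x0) / d)%R)%E; rewrite gtr0_norm ?invr_gt0 // => e.
have : (d%:E * (d^-1%:E * I) <= d%:E * 6%:E)%E.
  rewrite -e; apply: lee_wpmul2l; first by rewrite lee_fin ltW.
  exact: wker_int.
by rewrite muleA -!EFinM divff // mul1e mulrC.
Qed.

Lemma arctan_int (k : R) : 0 < k ->
  (\int[mu]_y ((1 + (k * y) ^+ 2)^-1)%:E = (pi / k)%:E)%E.
Proof.
move=> k0; pose f (x : R) := (oneDsqr x)^-1.
have f0 x : 0 <= f x by rewrite invr_ge0 addr_ge0 // sqr_ge0.
have cf : continuous f by exact: continuous_oneDsqrV.
have base : (\int[mu]_x (f x)%:E = pi%:E)%E.
  rewrite (ge0_symfun_integralT f0 cf); last by move=> x; rewrite /f /oneDsqr /= sqrrN.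
  rewrite -set_itvcy integral0y_oneDsqr -EFinM mulrC divfK //.
have mf : measurable_fun setT (fun x => (f x)%:E).
  by apply/measurable_EFinP; exact: continuous_measurable_fun.
have kn : k != 0 by rewrite gt_eqF.
have := @ge0_integral_affine _ (fun x => (f x)%:E) k 0 kn mf (fun x => f0 x).
rewrite base gtr0_norm // => e.
have -> : (\int[mu]_y ((1 + (k * y) ^+ 2)^-1)%:E = \int[mu]_x (f (k * x + 0)%R)%:E)%E.
  by apply: eq_integral => y _; rewrite addr0.
set I := (\int[mu]_x _)%E in e *.
have : (k^-1%:E * pi%:E = k^-1%:E * (k%:E * I))%E by rewrite e.
by rewrite muleA -!EFinM mulVf // mul1e mulrC => <-.
Qed.

(** The contribution to the plane integral of the line [x1 = t x2] when [q = |P3 (t, 1)|]. *)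
Definition inner (q : R) : \bar R :=
  (\int[mu]_y (`|y| / (1 + `|y| ^+ 3 * q))%:E)%E.

(** With [v = k |y|], the integrand is at most [v / (k (1 + v^3)) <= 2 / (k (1 + v^2))]. *)
Lemma inner_bound (b q x : R) : 0 < b -> (b * weight x) ^+ 3 <= q ->
  (inner q <= (2 * pi / b ^+ 2)%:E * wker x)%E.
Proof.
move=> b0 bq; rewrite /wker; case: eqP => [_|/eqP x0].
  by rewrite gt0_muley ?leey // lte_fin divr_gt0 ?exprn_gt0 // mulr_gt0 ?pi_gt0.
have w0 := weight_gt0 x0; set k := b * weight x in bq *.
have k0 : 0 < k by rewrite mulr_gt0.
have q0 : 0 < q by apply: lt_le_trans bq; rewrite exprn_gt0.
have -> : ((2 * pi / b ^+ 2)%:E * ((weight x ^+ 2)^-1)%:E = (2 / k)%:E * (pi / k)%:E)%E.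
  rewrite -!EFinM; congr EFin; rewrite /k.
  move: (pi : R) (weight x) w0 => P w w0; field; rewrite ?gt_eqF //.
rewrite -(arctan_int k0) -ge0_integralZl //; last 3 first.
- apply/measurable_EFinP; apply: continuous_measurable_fun => y.
  apply: cvgV; first by rewrite gt_eqF // ltr_pwDl // sqr_ge0.
  apply: cvgD; first exact: cvg_cst.
  by apply: cvg_expn; exact: mulrl_continuous.
- by move=> y _; rewrite lee_fin invr_ge0 addr_ge0 // sqr_ge0.
- by rewrite lee_fin divr_ge0 // ltW.
apply: ge0_le_integral => //.
- by move=> y _; rewrite lee_fin divr_ge0 // addr_ge0 // mulr_ge0 ?exprn_ge0 // ltW.
- apply/measurable_EFinP; apply: continuous_measurable_fun => y.
  apply: cvgM; first exact: norm_continuous.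
  apply: cvgV; first by rewrite gt_eqF // ltr_pwDl // mulr_ge0 ?exprn_ge0 // ltW.
  apply: cvgD; first exact: cvg_cst.
  apply: cvgMr_tmp.
  by apply: cvg_expn; exact: norm_continuous.
- apply: measurable_funeM; apply/measurable_EFinP; apply: continuous_measurable_fun => y.
  apply: cvgV; first by rewrite gt_eqF // ltr_pwDl // sqr_ge0.
  apply: cvgD; first exact: cvg_cst.
  by apply: cvg_expn; exact: mulrl_continuous.
move=> y _; rewrite -EFinM lee_fin.
set v := k * `|y|.
have v0 : 0 <= v by rewrite mulr_ge0 // ltW.
have -> : (k * y) ^+ 2 = v ^+ 2 by rewrite /v !exprMn real_normK ?num_real.
have d1 : 0 < 1 + v ^+ 3 by rewrite ltr_pwDl // exprn_ge0.
have d2 : 0 < 1 + v ^+ 2 by rewrite ltr_pwDl // exprn_ge0.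
apply: (@le_trans _ _ (`|y| / (1 + v ^+ 3))).
  apply: ler_wpM2l => //; rewrite lef_pV2 ?posrE //; last first.
    by rewrite ltr_pwDl // mulr_ge0 ?exprn_ge0 // ltW.
  by rewrite lerD2l /v exprMn mulrC ler_wpM2l // exprn_ge0.
have -> : `|y| = v / k by rewrite /v mulrC mulKf // gt_eqF.
rewrite mulrAC [leRHS]mulrAC ler_pM2r ?invr_gt0 //.
rewrite ler_pdivrMr // mulrAC ler_pdivlMr //.
have h : v <= 1 + v ^+ 3.
  have [v1|v1] := leP v 1; first by rewrite (le_trans v1) // lerDl exprn_ge0.
  by rewrite (@le_trans _ _ (v ^+ 3)) ?lerDr // exprS ler_peMr // exprn_ege1 // ltW.
have -> : v * (1 + v ^+ 2) = v + v ^+ 3 by ring.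
by move: h; set z := v ^+ 3; lra.
Qed.

End CubeRootWeight.

(** * Lower bounds for binary cubic forms *)

Section Roots.
Context {R : realType}.

(** Vieta's formulas, read off from the values of the polynomial at [0], [1] and [-1]. *)
Lemma cubic_roots (a0 a1 a2 a3 : R[i]) : a0 != 0 ->
  exists z1 z2 z3 : R[i],
    [/\ a1 = - a0 * (z1 + z2 + z3), a2 = a0 * (z1 * z2 + z1 * z3 + z2 * z3) &
        a3 = - a0 * (z1 * z2 * z3)].
Proof.
move=> a00.
have [r pr] := closed_field_poly_normal (Poly [:: a3; a2; a1; a0]).
have sp : size (Poly [:: a3; a2; a1; a0]) = 4%N.
  by rewrite (@PolyK _ 0) //=.
have lc : lead_coef (Poly [:: a3; a2; a1; a0]) = a0.
  by rewrite lead_coefE sp coef_Poly.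
have sr : size r = 3%N.
  move: sp; rewrite pr lc size_scale // size_prod_XsubC; by case.
case: r sr pr => [//|z1 [//|z2 [//|z3 [|//]]]] _.
rewrite lc !big_cons big_nil mulr1 => pr.
exists z1, z2, z3.
have ev x : a0 * x ^+ 3 + a1 * x ^+ 2 + a2 * x + a3 = a0 * ((x - z1) * ((x - z2) * (x - z3))).
  have := congr1 (fun p : {poly R[i]} => p.[x]) pr.
  rewrite horner_Poly hornerZ !hornerM !hornerXsubC => <- /=; ring.
have e0 := ev 0; have e1 := ev 1; have e2 := ev (-1).
have h3 : a3 = - a0 * (z1 * z2 * z3).
  by rewrite !expr0n !mulr0 !add0r in e0; rewrite e0; ring.
have two : (2 : R[i]) != 0 by rewrite pnatr_eq0.
split=> //; apply: (mulfI two).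
  have -> : 2 * a1 = (a0 * 1 ^+ 3 + a1 * 1 ^+ 2 + a2 * 1 + a3) +
     (a0 * (-1) ^+ 3 + a1 * (-1) ^+ 2 + a2 * -1 + a3) - 2 * a3 by ring.
  by rewrite e1 e2 h3; ring.
have -> : 2 * a2 = (a0 * 1 ^+ 3 + a1 * 1 ^+ 2 + a2 * 1 + a3) -
   (a0 * (-1) ^+ 3 + a1 * (-1) ^+ 2 + a2 * -1 + a3) - 2 * a0 by ring.
by rewrite e1 e2; ring.
Qed.

Lemma quadratic_roots (a b c : R[i]) : a != 0 ->
  exists z1 z2 : R[i], b = - a * (z1 + z2) /\ c = a * (z1 * z2).
Proof.
move=> a0; have [z1 [z2 [z3 [h1 h2 h3]]]] := @cubic_roots a b c 0 a0.
have : z1 * z2 * z3 == 0.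
  by move/esym/eqP: h3; rewrite mulf_eq0 oppr_eq0 (negbTE a0).
rewrite !mulf_eq0 -orbA => /or3P[] /eqP e; move: h1 h2; rewrite e => h1 h2.
- by exists z2, z3; rewrite h1 h2; split; ring.
- by exists z1, z3; rewrite h1 h2; split; ring.
- by exists z1, z2; rewrite h1 h2; split; ring.
Qed.

Lemma normcB (z w : R[i]) : normc (z - w) = normc (w - z).
Proof. by rewrite -opprB normcN. Qed.

Lemma normc_triangle (z w v : R[i]) : normc (z - w) <= normc (v - z) + normc (v - w).
Proof.
rewrite (_ : z - w = (z - v) + (v - w)); last by ring.
by apply: le_trans (le_normcD _ _) _; rewrite (normcB z v).
Qed.

(** With [u = cbrt (s / d)] the claim reads [d ((1 + u) / 4)^3 <= r], which follows from
    [d / 2 <= r] if [u <= 1], and from [s = d u^3 <= r] otherwise. *)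
Lemma pair_lower (s d r : R) : 0 <= s -> 0 < d -> s <= r -> d / 2 <= r ->
  d ^+ 2 * weight (s / d) ^+ 3 / 64 <= s * r.
Proof.
move=> s0 d0 sr dr.
have x0 : 0 <= s / d by rewrite divr_ge0 // ltW.
pose u := cbrt (s / d).
have u0 : 0 <= u by exact: cbrt_ge0.
have u3 : u ^+ 3 = s / d by rewrite cbrtK ger0_norm.
have sE : s = d * u ^+ 3 by rewrite u3 mulrC divfK // gt_eqF.
have -> : d ^+ 2 * weight (s / d) ^+ 3 / 64 = s * (d * ((1 + u) / 4) ^+ 3).
  transitivity (d * u ^+ 3 * (d * ((1 + u) / 4) ^+ 3)); last by rewrite -sE.
  by rewrite /weight -/u; field.
apply: ler_wpM2l => //.
have [u1|u1] := leP u 1.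
  apply: le_trans dr; rewrite ler_pM2l //.
  have h : (1 + u) / 4 <= 2^-1 by lra.
  apply: (@le_trans _ _ (2^-1 ^+ 3)); first by rewrite lerXn2r ?nnegrE //; lra.
  by rewrite !exprS expr0; lra.
apply: le_trans sr; rewrite [leRHS]sE ler_pM2l //.
by rewrite lerXn2r ?nnegrE //; lra.
Qed.

(** As [z1] is the root nearest to [t], each other root is at least half as far from [t] as
    from [z1]. This and [pair_lower] bound the factors belonging to [z3] and [z2]. *)
Lemma nearest3 (t : R) (z1 z2 z3 : R[i]) :
  normc (t%:C - z1) <= normc (t%:C - z2) -> normc (t%:C - z1) <= normc (t%:C - z3) ->
  0 < normc (z1 - z2) -> normc (z1 - z2) <= normc (z1 - z3) ->
  normc (z1 - z2) ^+ 2 * normc (z1 - z3) * weight ((t - Re z1) / normc (z1 - z2)) ^+ 3 / 128 <=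
  normc (t%:C - z1) * normc (t%:C - z2) * normc (t%:C - z3).
Proof.
move=> n2 n3 d0 d23.
have t2 := normc_triangle z1 z2 t%:C; have t3 := normc_triangle z1 z3 t%:C.
set d := normc (z1 - z2) in d0 d23 t2 *; set M := normc (z1 - z3) in d23 t3 *.
set r1 := normc (t%:C - z1) in n2 n3 t2 t3 *.
set r2 := normc (t%:C - z2) in n2 t2 *; set r3 := normc (t%:C - z3) in n3 t3 *.
have r10 : 0 <= r1 by exact: normc_ge0.
pose s := `|t - Re z1|.
have s1 : s <= r1.
  by apply: le_trans (ler_Re_normc _); rewrite ReD ReN.
have s0 : 0 <= s by exact: normr_ge0.
have -> : weight ((t - Re z1) / d) = weight (s / d).
  rewrite /s; have [h|h] := leP 0 (t - Re z1); first by rewrite ger0_norm.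
  by rewrite ltr0_norm // mulNr weightN.
have p : d ^+ 2 * weight (s / d) ^+ 3 / 64 <= s * r2 by apply: pair_lower => //; lra.
have -> : d ^+ 2 * M * weight (s / d) ^+ 3 / 128 =
  (d ^+ 2 * weight (s / d) ^+ 3 / 64) * (M / 2) by field.
have w0 : 0 <= weight (s / d) ^+ 3 by rewrite exprn_ge0 // weight_ge0.
apply: ler_pM.
- by rewrite divr_ge0 // mulr_ge0 // sqr_ge0.
- by rewrite divr_ge0 // normc_ge0.
- by apply: le_trans p _; apply: ler_wpM2r => //; lra.
- by lra.
Qed.

Lemma nearest2 (t : R) (z1 z2 : R[i]) :
  normc (t%:C - z1) <= normc (t%:C - z2) -> 0 < normc (z1 - z2) ->
  normc (z1 - z2) ^+ 2 * weight ((t - Re z1) / normc (z1 - z2)) ^+ 3 / 64 <=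
  normc (t%:C - z1) * normc (t%:C - z2).
Proof.
move=> n2 d0.
have t2 := normc_triangle z1 z2 t%:C.
set d := normc (z1 - z2) in d0 t2 *.
set r1 := normc (t%:C - z1) in n2 t2 *; set r2 := normc (t%:C - z2) in n2 t2 *.
have r10 : 0 <= r1 by exact: normc_ge0.
pose s := `|t - Re z1|.
have s1 : s <= r1.
  by apply: le_trans (ler_Re_normc _); rewrite ReD ReN.
have s0 : 0 <= s by exact: normr_ge0.
have -> : weight ((t - Re z1) / d) = weight (s / d).
  rewrite /s; have [h|h] := leP 0 (t - Re z1); first by rewrite ger0_norm.
  by rewrite ltr0_norm // mulNr weightN.
have p : d ^+ 2 * weight (s / d) ^+ 3 / 64 <= s * r2 by apply: pair_lower => //; lra.
by apply: le_trans p _; apply: ler_wpM2r => //; lra.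
Qed.

(** The function [B * weight ((t - x) / d) ^+ 3], to the power [-2/3], has an integral of order
    [d / B ^ (2/3)]; the inequality bounds it by a multiple of [D ^ (-1/6)]. *)
Definition admissible (D : R) (d B : R) :=
  [/\ 0 < d, 0 < B & d ^+ 6 * D <= 128 ^+ 4 * B ^+ 4].

(** The three functions are centred at the real parts of the roots, and the root nearest to
    [t] supplies the one that bounds [q t] from below. *)
Definition dominated (D : R) (q : R -> R) :=
  exists x1 d1 B1 x2 d2 B2 x3 d3 B3 : R,
    [/\ admissible D d1 B1, admissible D d2 B2, admissible D d3 B3 &
    forall t, [\/ B1 * weight ((t - x1) / d1) ^+ 3 <= q t,
                 B2 * weight ((t - x2) / d2) ^+ 3 <= q t |
                 B3 * weight ((t - x3) / d3) ^+ 3 <= q t]].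

(** The distance from [z1] to the nearer of the other roots; [rheight] is the factor that
    [nearest3] then provides. *)
Definition rwidth (z1 z2 z3 : R[i]) : R := Num.min (normc (z1 - z2)) (normc (z1 - z3)).
Definition rheight (a : R) (z1 z2 z3 : R[i]) : R :=
  a * (rwidth z1 z2 z3 ^+ 2 * Num.max (normc (z1 - z2)) (normc (z1 - z3)) / 128).

Lemma nearest3_sym (t : R) (z1 z2 z3 : R[i]) (a : R) : 0 <= a ->
  normc (t%:C - z1) <= normc (t%:C - z2) -> normc (t%:C - z1) <= normc (t%:C - z3) ->
  0 < normc (z1 - z2) -> 0 < normc (z1 - z3) ->
  rheight a z1 z2 z3 * weight ((t - Re z1) / rwidth z1 z2 z3) ^+ 3 <=
  a * (normc (t%:C - z1) * normc (t%:C - z2) * normc (t%:C - z3)).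
Proof.
move=> a0 n2 n3 p2 p3; rewrite /rheight -mulrA; apply: ler_wpM2l => //.
rewrite /rwidth; have [h|h] := leP (normc (z1 - z2)) (normc (z1 - z3)).
  rewrite mulrAC; exact: nearest3.
rewrite mulrAC [X in _ <= X]mulrAC; apply: nearest3 => //; exact: ltW.
Qed.

(** In terms of the smaller distance [d] and the larger one [M], both sides of the inequality
    are multiples of [a^4 d^8 M^4], since [|z2 - z3| <= 2 M]. *)
Lemma admissible_root (a D : R) (z1 z2 z3 : R[i]) : 0 < a ->
  0 < normc (z1 - z2) -> 0 < normc (z1 - z3) ->
  27 * D = a ^+ 4 * (normc (z1 - z2) * normc (z1 - z3) * normc (z2 - z3)) ^+ 2 ->
  admissible D (rwidth z1 z2 z3) (rheight a z1 z2 z3).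
Proof.
move=> a0 p2 p3 e.
have t := normc_triangle z2 z3 z1.
rewrite /admissible /rheight /rwidth.
set d := Num.min _ _; set M := Num.max _ _.
have d0 : 0 < d by rewrite lt_min p2 p3.
have dM : normc (z1 - z2) * normc (z1 - z3) = d * M.
  by rewrite /d /M; case: leP => // _; rewrite mulrC.
have M0 : 0 < M by rewrite lt_max p2.
have l : normc (z2 - z3) <= 2 * M.
  apply: le_trans t _; rewrite mulr_natl mulr2n; apply: lerD; rewrite /M le_max lexx ?orbT //.
split => //; first by rewrite !mulr_gt0 ?exprn_gt0 ?invr_gt0.
rewrite dM exprMn in e.
have l2 : normc (z2 - z3) ^+ 2 <= (2 * M) ^+ 2.
  by rewrite lerXn2r ?nnegrE ?normc_ge0 // mulr_ge0 // ltW.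
have -> : 128 ^+ 4 * (a * (d ^+ 2 * M / 128)) ^+ 4 = a ^+ 4 * d ^+ 8 * M ^+ 4 by field.
rewrite -(@ler_pM2l _ 27) // mulrCA e.
set n := normc (z2 - z3) ^+ 2 in l2 *.
have -> : d ^+ 6 * (a ^+ 4 * ((d * M) ^+ 2 * n)) = a ^+ 4 * d ^+ 8 * M ^+ 2 * n by ring.
apply: (@le_trans _ _ (a ^+ 4 * d ^+ 8 * M ^+ 2 * (2 * M) ^+ 2)).
  by rewrite ler_wpM2l // !mulr_ge0 ?exprn_ge0 // ltW.
have -> : a ^+ 4 * d ^+ 8 * M ^+ 2 * (2 * M) ^+ 2 = 4 * (a ^+ 4 * d ^+ 8 * M ^+ 4) by ring.
have : 0 <= a ^+ 4 * d ^+ 8 * M ^+ 4 by rewrite !mulr_ge0 ?exprn_ge0 // ltW.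
by set Z := a ^+ 4 * _ * _; lra.
Qed.

End Roots.

Section Domination.
Context {R : realType}.

(** Because of the binomial coefficients in [P3], its classical discriminant is [27 * disc3]. *)
Lemma disc3_roots (a0 a1 a2 a3 : R) (z1 z2 z3 : R[i]) :
  (3 * a1)%:C = - a0%:C * (z1 + z2 + z3) ->
  (3 * a2)%:C = a0%:C * (z1 * z2 + z1 * z3 + z2 * z3) ->
  a3%:C = - a0%:C * (z1 * z2 * z3) ->
  (27 * disc3 a0 a1 a2 a3)%:C = a0%:C ^+ 4 * ((z1 - z2) * (z1 - z3) * (z2 - z3)) ^+ 2.
Proof.
rewrite !rmorphM !rmorph_nat => e1 e2 e3.
rewrite /disc3 !(rmorphB, rmorphD, rmorphM, rmorphXn, rmorph_nat) /= e3.
have n3 : (3 : R[i]) != 0 by rewrite pnatr_eq0.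
have -> : a1%:C = - a0%:C * (z1 + z2 + z3) / 3 by rewrite -e1; field.
have -> : a2%:C = a0%:C * (z1 * z2 + z1 * z3 + z2 * z3) / 3 by rewrite -e2; field.
by field.
Qed.

Lemma P3_dehomogenized (a0 a1 a2 a3 t : R) : (P3 a0 a1 a2 a3 (t, 1))%:C =
  a0%:C * t%:C ^+ 3 + (3 * a1)%:C * t%:C ^+ 2 + (3 * a2)%:C * t%:C + a3%:C.
Proof. by rewrite /P3 /= !expr1n !mulr1 !(rmorphD, rmorphM, rmorphXn). Qed.

Lemma dominated_cubic (a0 a1 a2 a3 : R) : a0 != 0 -> disc3 a0 a1 a2 a3 != 0 ->
  dominated `|disc3 a0 a1 a2 a3| (fun t => `|P3 a0 a1 a2 a3 (t, 1)|).
Proof.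
move=> a00 D0.
have a0C : a0%:C != 0 by rewrite -normc_eq0 normcR normr_eq0.
have [z1 [z2 [z3 [e1 e2 e3]]]] := @cubic_roots R a0%:C (3 * a1)%:C (3 * a2)%:C a3%:C a0C.
have := congr1 (@normc R) (disc3_roots e1 e2 e3).
rewrite normcR normrM normr_nat normcM 2!normcX normcR 2!normcM => e.
have D1 : 0 < `|disc3 a0 a1 a2 a3| by rewrite normr_gt0.
have a1p : 0 < `|a0| by rewrite normr_gt0.
have pos : [/\ 0 < normc (z1 - z2), 0 < normc (z1 - z3) & 0 < normc (z2 - z3)].
  have : `|a0| ^+ 4 * (normc (z1 - z2) * normc (z1 - z3) * normc (z2 - z3)) ^+ 2 != 0.
    by rewrite -e mulf_neq0 ?pnatr_eq0 // gt_eqF.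
  rewrite mulf_eq0 negb_or => /andP[_]; rewrite expf_eq0 /= !mulf_eq0 !negb_or.
  by move=> /andP[/andP[n1 n2] n3]; split; rewrite lt_def normc_ge0 andbT.
have [p12 p13 p23] := pos.
have [p21 p31 p32] : [/\ 0 < normc (z2 - z1), 0 < normc (z3 - z1) & 0 < normc (z3 - z2)].
  by rewrite (normcB z2 z1) (normcB z3 z1) (normcB z3 z2).
have val t : `|P3 a0 a1 a2 a3 (t, 1)| =
    `|a0| * (normc (t%:C - z1) * normc (t%:C - z2) * normc (t%:C - z3)).
  rewrite -!normcR -!normcM; congr normc.
  by rewrite P3_dehomogenized e1 e2 e3; ring.
exists (Re z1), (rwidth z1 z2 z3), (rheight `|a0| z1 z2 z3).
exists (Re z2), (rwidth z2 z1 z3), (rheight `|a0| z2 z1 z3).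
exists (Re z3), (rwidth z3 z1 z2), (rheight `|a0| z3 z1 z2).
split.
- exact: admissible_root.
- apply: admissible_root => //.
  by rewrite e (normcB z2 z1); ring.
- apply: admissible_root => //.
  by rewrite e (normcB z3 z1) (normcB z3 z2); ring.
move=> t; rewrite val.
have [h12|/ltW h12] := leP (normc (t%:C - z1)) (normc (t%:C - z2)).
  have [h13|/ltW h13] := leP (normc (t%:C - z1)) (normc (t%:C - z3)).
    by constructor 1; apply: nearest3_sym.
  constructor 3.
  rewrite (_ : _ * _ * normc (t%:C - z3) = normc (t%:C - z3) * normc (t%:C - z1) * normc (t%:C - z2)); last by ring.
  by apply: nearest3_sym => //; exact: le_trans h13 h12.
have [h23|/ltW h23] := leP (normc (t%:C - z2)) (normc (t%:C - z3)).
  constructor 2.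
  rewrite (_ : normc (t%:C - z1) * _ = normc (t%:C - z2) * normc (t%:C - z1)); last by ring.
  by apply: nearest3_sym.
constructor 3.
rewrite (_ : _ * _ * normc (t%:C - z3) = (normc (t%:C - z3) * normc (t%:C - z1) * normc (t%:C - z2))); last by ring.
by apply: nearest3_sym => //; exact: le_trans h23 h12.
Qed.

(** With one root at infinity only two weights occur; the third one repeats the second. *)
Lemma dominated_quadratic (a1 a2 a3 : R) : disc3 0 a1 a2 a3 != 0 ->
  dominated `|disc3 0 a1 a2 a3| (fun t => `|P3 0 a1 a2 a3 (t, 1)|).
Proof.
have DE : disc3 0 a1 a2 a3 = a1 ^+ 2 * (3 * a2 ^+ 2 - 4 * a1 * a3) by rewrite /disc3; ring.
move=> D0.
have a10 : a1 != 0.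
  by apply: contra_neq D0 => a10; rewrite DE a10 expr0n mul0r.
have n3 : (3 : R[i]) != 0 by rewrite pnatr_eq0.
have aC : (3 * a1)%:C != 0.
  by rewrite -normc_eq0 normcR normr_eq0 mulf_neq0 // pnatr_eq0.
have [z1 [z2 [e1 e2]]] := @quadratic_roots R (3 * a1)%:C (3 * a2)%:C a3%:C aC.
have e : `|disc3 0 a1 a2 a3| = 3 * `|a1| ^+ 4 * normc (z1 - z2) ^+ 2.
  rewrite -(normcR a1) -(normcR (disc3 _ _ _ _)) -!normcX -[3 in RHS](@normr_nat R) -normcR -!normcM.
  congr normc; rewrite DE !(rmorphB, rmorphM, rmorphXn, rmorph_nat) /=.
  move: e1 e2; rewrite !rmorphM !rmorph_nat /= => e1 ->.
  have -> : a2%:C = - (3 * a1%:C) * (z1 + z2) / 3 by rewrite -e1; field.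
  by field.
have D1 : 0 < `|disc3 0 a1 a2 a3| by rewrite normr_gt0.
have a1p : 0 < `|a1| by rewrite normr_gt0.
have p12 : 0 < normc (z1 - z2).
  rewrite lt_def normc_ge0 andbT; apply: contraTN D1 => /eqP h.
  by rewrite e h expr0n mulr0 ltxx.
have val t : `|P3 0 a1 a2 a3 (t, 1)| =
    (3 * `|a1|) * (normc (t%:C - z1) * normc (t%:C - z2)).
  rewrite -[3](@normr_nat R) -normrM -!normcR -!normcM; congr normc.
  by rewrite P3_dehomogenized e1 e2 rmorph0; ring.
set d := normc (z1 - z2) in p12 e *.
have ad : admissible `|disc3 0 a1 a2 a3| d (3 * `|a1| * d ^+ 2 / 64).
  split => //; first by rewrite !mulr_gt0 ?exprn_gt0 // invr_gt0.
  rewrite e -(@ler_pM2l _ (64 ^+ 4)) ?exprn_gt0 //.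
  have -> : 64 ^+ 4 * (d ^+ 6 * (3 * `|a1| ^+ 4 * d ^+ 2)) = 3 * 64 ^+ 4 * (`|a1| ^+ 4 * d ^+ 8) by ring.
  have -> : 64 ^+ 4 * (128 ^+ 4 * (3 * `|a1| * d ^+ 2 / 64) ^+ 4) = 128 ^+ 4 * 81 * (`|a1| ^+ 4 * d ^+ 8) by field.
  rewrite ler_pM2r ?mulr_gt0 ?exprn_gt0 //.
  by rewrite !exprS expr0; lra.
exists (Re z1), d, (3 * `|a1| * d ^+ 2 / 64), (Re z2), d, (3 * `|a1| * d ^+ 2 / 64).
exists (Re z2), d, (3 * `|a1| * d ^+ 2 / 64).
split => // t; rewrite val.
have E x : 3 * `|a1| * d ^+ 2 / 64 * x = 3 * `|a1| * (d ^+ 2 * x / 64) by rewrite -!mulrA (mulrC 64^-1).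
have [h|/ltW h] := leP (normc (t%:C - z1)) (normc (t%:C - z2)).
  constructor 1; rewrite E; apply: ler_wpM2l; first by rewrite mulr_ge0 // ltW.
  exact: nearest2.
constructor 2; rewrite E; apply: ler_wpM2l; first by rewrite mulr_ge0 // ltW.
rewrite /d normcB [X in _ <= X]mulrC; apply: nearest2 => //.
by rewrite normcB.
Qed.

Lemma dominated_P3 (a0 a1 a2 a3 : R) : disc3 a0 a1 a2 a3 != 0 ->
  dominated `|disc3 a0 a1 a2 a3| (fun t => `|P3 a0 a1 a2 a3 (t, 1)|).
Proof.
have [->|a00] := eqVneq a0 0; first exact: dominated_quadratic.
exact: dominated_cubic.
Qed.

End Domination.

(** * Integrating the weights *)

Section NonnegIntegral.
Context d (T : measurableType d) {R : realType}.
Variable mu : {measure set T -> \bar R}.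

(** The integral of a nonnegative function is a supremum over the simple functions below it,
    so it is monotone without any measurability. *)
Lemma ge0_le_integral_subset (D : set T) (f g : T -> \bar R) :
  (forall x, D x -> 0 <= f x)%E -> (forall x, 0 <= g x)%E ->
  (forall x, D x -> f x <= g x)%E ->
  (\int[mu]_(x in D) f x <= \int[mu]_x g x)%E.
Proof.
move=> f0 g0 fg; rewrite ge0_integralE // ge0_integralTE //.
apply: ereal_sup_le => _ /= [h hf <-]; exists h => // x.
apply: le_trans (hf x) _; rewrite patchE; case: ifPn => // xD.
by apply: fg; rewrite inE in xD.
Qed.

(** The positive and negative parts of [f] are both at most [g]. *)
Lemma Rintegral_le_upper (D : set T) (f : T -> R) (g : T -> \bar R) :
  (forall x, 0 <= g x)%E -> (forall x, D x -> `|f x|%:E <= g x)%E ->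
  (`|Rintegral mu D f|%:E <= \int[mu]_x g x)%E.
Proof.
move=> g0 fg.
have := @integral_ge0 _ _ _ mu setT g (fun x _ => g0 x).
have pos : (\int[mu]_(x in D) (fun x => (f x)%:E)^\+ x <= \int[mu]_x g x)%E.
  apply: ge0_le_integral_subset => // x Dx; apply: le_trans (fg x Dx).
  by rewrite funeposE ge_max !lee_fin normr_ge0 ler_norm.
have neg : (\int[mu]_(x in D) (fun x => (f x)%:E)^\- x <= \int[mu]_x g x)%E.
  apply: ge0_le_integral_subset => // x Dx; apply: le_trans (fg x Dx).
  by rewrite funenegE ge_max !lee_fin normr_ge0 andbT -normrN ler_norm.
have pos0 : (0 <= \int[mu]_(x in D) (fun x => (f x)%:E)^\+ x)%E by exact: integral_ge0.
have neg0 : (0 <= \int[mu]_(x in D) (fun x => (f x)%:E)^\- x)%E by exact: integral_ge0.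
rewrite /Rintegral (integralE mu D).
move: (\int[mu]_x g x)%E pos neg => G.
move: (\int[mu]_(x in D) (fun x => (f x)%:E)^\+ x)%E pos0 => A.
move: (\int[mu]_(x in D) (fun x => (f x)%:E)^\- x)%E neg0 => B.
case: G => [G| |]; last 2 first.
- by move=> *; exact: leey.
- by move=> _ _; rewrite leeNy_eq.
case: A => [A| |]; last 2 first.
- by move=> _; rewrite leye_eq.
- by rewrite leeNy_eq.
case: B => [B| |]; last 2 first.
- by move=> _ _ ; rewrite leye_eq.
- by rewrite leeNy_eq.
rewrite !lee_fin /= => B0 A0 h1 h2 h3.
by rewrite ler_norml; apply/andP; split; lra.
Qed.

End NonnegIntegral.

Section PlaneIntegral.
Context {R : realType}.
Notation mu := (@lebesgue_measure R).

(** The constant [26] is chosen with [128 ^ 4 <= 26 ^ 6]. *)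
Lemma admissible_ratio (D d B : R) : 0 < D -> admissible D d B ->
  d / cbrt B ^+ 2 <= 26 / D `^ 6^-1.
Proof.
move=> D0 [d0 B0 h].
have b0 : 0 < cbrt B by rewrite cbrt_gt0 // gt_eqF.
have b3 : cbrt B ^+ 3 = B by rewrite cbrtK gtr0_norm.
set b := cbrt B in b0 b3 *; set e := D `^ 6^-1.
have e0 : 0 < e by rewrite powR_gt0.
have e6 : e ^+ 6 = D.
  by rewrite -powR_mulrn ?powR_ge0 // /e -powRrM mulVf ?pnatr_eq0 // powRr1 // ltW.
rewrite ler_pdivrMr ?exprn_gt0 // mulrAC ler_pdivlMr //.
rewrite -(@ler_pXn2r _ 6) ?nnegrE //; last 2 first.
- by rewrite mulr_ge0 // ltW.
- by rewrite mulr_ge0 // exprn_ge0 // ltW.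
rewrite exprMn e6; apply: le_trans h _.
have -> : (26 * b ^+ 2) ^+ 6 = 26 ^+ 6 * (b ^+ 3) ^+ 4 by ring.
rewrite b3 ler_pM2r ?exprn_gt0 //.
by rewrite !exprS expr0; lra.
Qed.

Let wterm (x d B t : R) : \bar R :=
  ((2 * pi / cbrt B ^+ 2)%:E * wker ((t - x) / d)%R)%E.

Let wterm_ge0 x d B t : (0 <= wterm x d B t)%E.
Proof.
by apply: mule_ge0; rewrite ?wker_ge0 // lee_fin divr_ge0 ?sqr_ge0 // mulr_ge0 // pi_ge0.
Qed.

Let measurable_wterm x d B : measurable_fun setT (wterm x d B).
Proof.
apply: measurable_funeM; apply: (measurableT_comp measurable_wker).
by apply: measurable_funM => //; apply: measurable_funB.
Qed.

Let wterm_int (D x d B : R) : 0 < D -> admissible D d B ->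
  (\int[mu]_t wterm x d B t <= (312 * pi / D `^ 6^-1)%:E)%E.
Proof.
move=> D0 a; have [d0 B0 _] := a; have r := admissible_ratio D0 a.
have p0 : 0 <= 2 * pi / cbrt B ^+ 2 :> R by rewrite divr_ge0 ?sqr_ge0 // mulr_ge0 // pi_ge0.
rewrite ge0_integralZl //; last 2 first.
- apply: (measurableT_comp measurable_wker).
  by apply: measurable_funM => //; apply: measurable_funB.
- by move=> t _; exact: wker_ge0.
apply: (@le_trans _ _ ((2 * pi / cbrt B ^+ 2)%:E * (6 * d)%:E)%E).
  by apply: lee_wpmul2l; rewrite ?lee_fin //; exact: wker_affine_int.
rewrite -EFinM lee_fin.
have -> : 2 * pi / cbrt B ^+ 2 * (6 * d) = 12 * pi * (d / cbrt B ^+ 2) by ring.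
have -> : 312 * pi / D `^ 6^-1 = 12 * pi * (26 / D `^ 6^-1) by ring.
by apply: ler_wpM2l => //; rewrite mulr_ge0 // pi_ge0.
Qed.

Lemma inner_ge0 q : 0 <= q -> (0 <= @inner R q)%E.
Proof.
move=> q0; apply: integral_ge0 => y _.
by rewrite lee_fin divr_ge0 // addr_ge0 // mulr_ge0 // exprn_ge0.
Qed.

(** At each [t] one of three weights bounds [inner], and each of them integrates to a multiple
    of [D ^ (-1/6)]. *)
Lemma inner_int (D : R) (q : R -> R) : 0 < D -> (forall t, 0 <= q t) ->
  dominated D q ->
  (\int[mu]_t inner (q t) <= (936 * pi / D `^ 6^-1)%:E)%E.
Proof.
move=> D0 q0 [x1 [d1 [B1 [x2 [d2 [B2 [x3 [d3 [B3 [a1 a2 a3 dom]]]]]]]]]].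
have key x d B t : admissible D d B -> B * weight ((t - x) / d) ^+ 3 <= q t ->
    (inner (q t) <= wterm x d B t)%E.
  move=> [_ B0 _] h; apply: inner_bound; first by rewrite cbrt_gt0 // gt_eqF.
  by rewrite exprMn cbrtK gtr0_norm.
pose W t := (wterm x1 d1 B1 t + (wterm x2 d2 B2 t + wterm x3 d3 B3 t))%E.
apply: (@le_trans _ _ (\int[mu]_t W t)%E).
  apply: ge0_le_integral_subset => [t _|t|t _].
  - exact: inner_ge0.
  - by rewrite !adde_ge0.
  - rewrite /W; case: (dom t) => h.
    + by apply: le_trans (key _ _ _ _ a1 h) _; rewrite leeDl // adde_ge0.
    + by apply: le_trans (key _ _ _ _ a2 h) _; rewrite addeCA leeDl // adde_ge0.
    + by apply: le_trans (key _ _ _ _ a3 h) _; rewrite addeA leeDr // adde_ge0.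
have m23 : measurable_fun setT (fun t => wterm x2 d2 B2 t + wterm x3 d3 B3 t)%E.
  by apply: emeasurable_funD; exact: measurable_wterm.
rewrite ge0_integralD //; [|exact: measurable_wterm|by move=> t _; rewrite adde_ge0].
rewrite ge0_integralD //; try exact: measurable_wterm.
have -> : 936 * pi / D `^ 6^-1 = 312 * pi / D `^ 6^-1 + (312 * pi / D `^ 6^-1 + 312 * pi / D `^ 6^-1) by ring.
by rewrite !EFinD; apply: leeD; [|apply: leeD]; exact: wterm_int.
Qed.

End PlaneIntegral.

(** * The integral over the plane *)

Section PlaneIntegral.
Context {R : realType}.
Notation mu := (@lebesgue_measure R).

Lemma measurable_inv1Dnorm d (T : measurableType d) (f : T -> R) :
  measurable_fun setT f -> measurable_fun setT (fun x => (1 + `|f x|)^-1).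
Proof.
move=> mf; apply: (measurableT_comp _ mf (f := fun u : R => (1 + `|u|)^-1)).
apply: continuous_measurable_fun => y.
apply: cvgV; first by rewrite gt_eqF // ltr_pwDl.
by apply: cvgD; [exact: cvg_cst|exact: norm_continuous].
Qed.

Lemma measurable_P3 a0 a1 a2 a3 :
  measurable_fun setT (P3 a0 a1 a2 a3 : measurableTypeR R * measurableTypeR R -> measurableTypeR R).
Proof.
have m1 (n : nat) : measurable_fun setT (fun x : measurableTypeR R * measurableTypeR R => (x.1 : R) ^+ n).
  by apply: measurable_funX; exact: measurable_fst.
have m2 (n : nat) : measurable_fun setT (fun x : measurableTypeR R * measurableTypeR R => (x.2 : R) ^+ n).
  by apply: measurable_funX; exact: measurable_snd.
have mk (k : R) (n m : nat) :
    measurable_fun setT (fun x : measurableTypeR R * measurableTypeR R => k * x.1 ^+ n * x.2 ^+ m).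
  by apply: measurable_funM => //; apply: measurable_funM.
have -> : P3 a0 a1 a2 a3 = fun x => a0 * x.1 ^+ 3 * x.2 ^+ 0 + 3 * a1 * x.1 ^+ 2 * x.2 ^+ 1 +
    3 * a2 * x.1 ^+ 1 * x.2 ^+ 2 + a3 * x.1 ^+ 0 * x.2 ^+ 3.
  by apply/funext => x; rewrite /P3 !expr0 !expr1 !mulr1.
by do !apply: measurable_funD; exact: mk.
Qed.

Lemma P3_homogeneous (a0 a1 a2 a3 t y : R) :
  P3 a0 a1 a2 a3 (y * t, y) = y ^+ 3 * P3 a0 a1 a2 a3 (t, 1).
Proof. by rewrite /P3 /=; ring. Qed.

(** The substitution [x1 = t x2] gives [P3 (t x2, x2) = x2^3 P3 (t, 1)]; by Tonelli's theorem
    one integrates in [x2] first, which is [inner]. *)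
Lemma plane_int (a0 a1 a2 a3 : R) : disc3 a0 a1 a2 a3 != 0 ->
  (\int[@lebesgue2 R]_x ((1 + `|P3 a0 a1 a2 a3 x|)^-1)%:E <=
     (936 * pi / `|disc3 a0 a1 a2 a3| `^ 6^-1)%:E)%E.
Proof.
move=> D0; set P := P3 a0 a1 a2 a3.
have D1 : 0 < `|disc3 a0 a1 a2 a3| by rewrite normr_gt0.
pose q t := `|P (t, 1)|.
have mP : measurable_fun setT P by exact: measurable_P3.
pose f x := ((1 + `|P x|)^-1)%:E.
have mf : measurable_fun setT f.
  by apply/measurable_EFinP; exact: measurable_inv1Dnorm.
have f0 x : (0 <= f x)%E by rewrite lee_fin invr_ge0 addr_ge0.
pose h (x : R * R) := (`|x.2| / (1 + `|x.2| ^+ 3 * q x.1))%:E.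
have h0 x : (0 <= h x)%E.
  by rewrite lee_fin divr_ge0 // addr_ge0 // mulr_ge0 ?exprn_ge0 // normr_ge0.
have mh : measurable_fun setT (h : measurableTypeR R * measurableTypeR R -> \bar R).
  apply/measurable_EFinP.
  have -> : (fun x : R * R => `|x.2| / (1 + `|x.2| ^+ 3 * q x.1)) =
      fun x => `|x.2| * (1 + `|x.2 ^+ 3 * P (x.1, 1)|)^-1.
    by apply/funext => x; rewrite normrM normrX.
  apply: measurable_funM; first by apply: measurableT_comp => //; exact: measurable_snd.
  apply: measurable_inv1Dnorm; apply: measurable_funM.
    by apply: measurable_funX; exact: measurable_snd.
  apply: (measurableT_comp mP).
  by apply: measurable_fun_pair => //; exact: measurable_fst.
rewrite /lebesgue2 (@fubini_tonelli2 _ _ _ _ _ mu mu f mf f0).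
have -> : (\int[mu]_y fubini_G mu f y = \int[mu]_y \int[mu]_t h (t, y))%E.
  apply: ge0_ae_eq_integral => //.
  - have H := @measurable_fun_fubini_tonelli_G _ _ _ _ _ mu f mf f0. exact: H.
  - have H := @measurable_fun_fubini_tonelli_G _ _ _ _ _ mu h mh h0. exact: H.
  - by move=> y _; exact: integral_ge0.
  - by move=> y _; exact: integral_ge0.
  (* The two inner integrals may differ on the line [y = 0] only. *)
  - exists [set 0]; split => //; first exact: lebesgue_measure_set1.
    move=> y /= hy; apply/eqP; apply: contra_notT hy => y0 _.
    have mfy : measurable_fun setT (fun x => f (x, y)).
      by apply: (measurableT_comp mf); exact: pair2_measurable.
    rewrite /fubini_G (ge0_integral_affine 0 y0 mfy (fun x => f0 (x, y))).
    rewrite -ge0_integralZl //; last first.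
      apply: (measurableT_comp mfy).
      by apply: measurable_funD => //; apply: measurable_funM.
    apply: eq_integral => t _.
    by rewrite -EFinM addr0 /f /h /P P3_homogeneous normrM normrX.
have -> : (\int[mu]_y \int[mu]_t h (t, y) = \int[mu]_t inner (q t))%E.
  by rewrite -(@fubini_tonelli _ _ _ _ _ mu mu h mh h0).
by apply: inner_int => // [t|]; [exact: normr_ge0|exact: dominated_P3].
Qed.

End PlaneIntegral.

(** * The oscillatory integral *)

Section Assembly.
Context {R : realType}.

Lemma normc_Cintegral_le (D : set (R * R)) (F : R * R -> R[i]) (g : R * R -> \bar R) :
  (forall x, 0 <= g x)%E -> (forall x, D x -> (normc (F x))%:E <= g x)%E ->
  ((normc (Cintegral D F))%:E <= 2%:E * \int[@lebesgue2 R]_x g x)%E.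
Proof.
move=> g0 Fg.
have hR : (`|Rintegral (@lebesgue2 R) D (fun x => Re (F x))|%:E <= \int[@lebesgue2 R]_x g x)%E.
  apply: Rintegral_le_upper => // x Dx; apply: le_trans (Fg x Dx).
  by rewrite lee_fin; exact: ler_Re_normc.
have hI : (`|Rintegral (@lebesgue2 R) D (fun x => Im (F x))|%:E <= \int[@lebesgue2 R]_x g x)%E.
  apply: Rintegral_le_upper => // x Dx; apply: le_trans (Fg x Dx).
  by rewrite lee_fin; exact: ler_Im_normc.
rewrite mule_natl mule2n; apply: le_trans (leeD hR hI).
by rewrite -EFinD lee_fin; exact: normc_leD1.
Qed.

Lemma Linfty_norm_ae (D : set (R * R)) (psi : R * R -> R[i]) (r : R) :
  Linfty_norm D psi = r%:E ->
  \forall x \ae (@lebesgue2 R), D x -> normc (psi x) <= r.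
Proof.
rewrite /Linfty_norm Lnorm.unlock; case: ifPn => [_ e|m0 _]; last first.
  (* If the plane were null, everything would hold almost everywhere. *)
  have m00 : @lebesgue2 R setT = 0%E.
    by apply/eqP; rewrite eq_le measure_ge0 andbT leNgt.
  by exists setT; split => //; exact: measurableT.
have := @ess_sup_inf.ess_sup_ge _ _ _ (@lebesgue2 R)
  (abse \o (fun x => (\1_D x * normc (psi x))%:E)).
rewrite e; apply: filterS => x h Dx; apply: le_trans (ler_norm _) _.
by move: h; rewrite /= lee_fin indicE mem_set // mul1r.
Qed.

(** An upper function may be infinite on a measurable null set, so that a bound almost
    everywhere suffices. *)
Lemma normc_Cintegral_ae_le (D : set (R * R)) (F : R * R -> R[i]) (g : R * R -> \bar R) :
  (forall x, 0 <= g x)%E ->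
  measurable_fun setT (g : measurableTypeR R * measurableTypeR R -> \bar R) ->
  (\forall x \ae (@lebesgue2 R), D x -> (normc (F x))%:E <= g x)%E ->
  ((normc (Cintegral D F))%:E <= 2%:E * \int[@lebesgue2 R]_x g x)%E.
Proof.
move=> g0 mg [N [mN N0 hN]].
pose k x := if x \in N then +oo%E else g x.
have k0 x : (0 <= k x)%E by rewrite /k; case: ifP.
have mk : measurable_fun setT (k : measurableTypeR R * measurableTypeR R -> \bar R).
  apply: measurable_fun_ifT => //.
  by apply: (measurable_fun_bool true); rewrite setTI (_ : _ @^-1` _ = N) //; apply/seteqP; split => x; [exact: set_mem|exact: mem_set].
have <- : (\int[@lebesgue2 R]_x k x = \int[@lebesgue2 R]_x g x)%E.
  apply: ge0_ae_eq_integral => //.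
  exists N; split => // x /= h; apply: contra_notP h => xN _.
  by rewrite /k memNset.
apply: normc_Cintegral_le => // x Dx; rewrite /k; case: ifPn => [_|xN]; first exact: leey.
apply: contrapT => h; move/negP: xN; apply; rewrite inE; apply: hN => /= H.
by apply: h; exact: H.
Qed.

End Assembly.

Local Close Scope classical_set_scope.

Theorem theorem4 (R : realType) (alpha beta : R)
    (halpha0 : 0 < alpha) (halpha1 : alpha < 1) (hbeta : 0 < beta) :
  exists c : R,
    forall (psi : R * R -> R[i]) (a0 a1 a2 a3 : R),
      Csmooth2 psi ->
      disc3 a0 a1 a2 a3 != 0 ->
      ((normc (Iab alpha beta a0 a1 a2 a3 psi))%:E <=
         c%:E * Linfty_norm (@unit_disc R) psi
           * ((`|disc3 a0 a1 a2 a3| `^ 6^-1)^-1)%:E)%E.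
Proof.
have [C C0 hC] := mittag_leffler_imag halpha0 halpha1 hbeta.
have [K K0 hK] : exists2 K : R, 0 < K & forall a0 a1 a2 a3 : R, disc3 a0 a1 a2 a3 != 0 ->
    (\int[@lebesgue2 R]_x ((1 + `|P3 a0 a1 a2 a3 x|)^-1)%:E <=
     (K * (`|disc3 a0 a1 a2 a3| `^ 6^-1)^-1)%:E)%E.
  exists (936 * pi) => [|a0 a1 a2 a3 h]; last exact: plane_int.
  by rewrite mulr_gt0 ?ltr0n ?pi_gt0.
have c0 : 0 < 2 * C * K by rewrite !mulr_gt0.
exists (2 * C * K) => psi a0 a1 a2 a3 _ D0.
have d0 : 0 < (`|disc3 a0 a1 a2 a3| `^ 6^-1)^-1.
  by rewrite invr_gt0 powR_gt0 // normr_gt0.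
have := hK _ _ _ _ D0.
set d := (_ `^ _)^-1 in d0 *; set P := P3 a0 a1 a2 a3 => hP.
have := Lnorm_ge0 (@lebesgue2 R) +oo%E (fun x => (\1_(@unit_disc R) x * normc (psi x))%:E).
rewrite -/(Linfty_norm (@unit_disc R) psi).
case e : (Linfty_norm (@unit_disc R) psi) => [r| |] r0; last 2 first.
- by rewrite gt0_muley ?lte_fin // gt0_mulye ?lte_fin // leey.
- by rewrite leeNy_eq in r0.
rewrite lee_fin in r0.
have Cr0 : 0 <= C * r by rewrite mulr_ge0 // ltW.
have mP : measurable_fun setT (fun x : measurableTypeR R * measurableTypeR R => ((1 + `|P x|)^-1)%:E).
  by apply/measurable_EFinP; apply: measurable_inv1Dnorm; exact: measurable_P3.
have := @normc_Cintegral_ae_le R (@unit_disc R)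
  (fun x => mittag_leffler alpha beta ('i%C * (P x)%:C) * psi x)
  (fun x => ((C * r)%:E * ((1 + `|P x|)^-1)%:E)%E).
move=> H; apply: le_trans (H _ _ _) _.
- by move=> x; rewrite -EFinM lee_fin mulr_ge0 // invr_ge0 addr_ge0.
- exact: measurable_funeM.
- have [N [mN N0 hN]] := Linfty_norm_ae e; exists N; split => // x /= nx.
  apply: hN => /= h; apply: nx => Dx.
  rewrite -EFinM lee_fin normcM mulrAC.
  by apply: ler_pM (hC _) (h Dx); exact: normc_ge0.
rewrite ge0_integralZl // muleA -!EFinM.
apply: (@le_trans _ _ ((2 * (C * r))%:E * (K * d)%:E)%E).
  by apply: lee_wpmul2l => //; rewrite lee_fin mulr_ge0.
by rewrite -EFinM lee_fin le_eqVlt; apply/predU1P; left; ring.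
Qed.
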